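(* Let $(\mathcal{A},X,D)$ be a compact Banach spectral triple (respectively, a possibly kernel-degenerate compact Banach spectral triple) over an algebra $\mathcal{A}$ via a homomorphism $\pi:\mathcal{A}\to\mathrm{B}(X)$. Then $(X,\pi,\mathrm{sgn}\,D)$ is an odd Banach Fredholm module (respectively, a possibly kernel-degenerate Banach Fredholm module) over $\mathcal{A}$.
   Context: Bisectors: for $\theta\in(0,\frac{\pi}{2})$, $\Sigma_\theta=\{z\in\mathbb{C}\setminus\{0\}:|\arg z|<\theta\}$ and $\Sigma^{\mathrm{bi}}_\theta=\Sigma_\theta\cup(-\Sigma_\theta)$. A closed densely defined operator $D$ on a Banach space $X$ is bisectorial of type $\omega\in(0,\frac\pi2)$ if $\sigma(D)\subset\overline{\Sigma^{\mathrm{bi}}_\omega}$ and $\{z(z-D)^{-1}: z\notin\overline{\Sigma^{\mathrm{bi}}_\omega}\}$ is bounded in $\mathrm{B}(X)$; $\omega_{\mathrm{bi}}(D)$ is the infimum of such $\omega$. For $\theta>\omega_{\mathrm{bi}}(D)$ and $f$ in $\mathrm{H}^\infty_0(\Sigma^{\mathrm{bi}}_\theta)$ (bounded holomorphic functions with $|f(z)|\le C\min\{|z|^s,|z|^{-s}\}$ for some $C,s>0$), $f(D)=\frac{1}{2\pi i}\int_{\partial\Sigma^{\mathrm{bi}}_\nu}f(z)(z-D)^{-1}\,dz$ with $\omega_{\mathrm{bi}}(D)<\nu<\theta$ and counterclockwise orientation. $D$ has a bounded $\mathrm{H}^\infty(\Sigma^{\mathrm{bi}}_\theta)$ functional calculus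 if $\|f(D)\|\le C\sup_{\Sigma^{\mathrm{bi}}_\theta}|f|$ for all such $f$. If $X$ is reflexive, $X=\overline{\mathrm{Ran}\,D}\oplus\ker D$, the calculus extends to all bounded holomorphic functions on $\Sigma_\theta^{\mathrm{bi}}$ on $\overline{\mathrm{Ran}\,D}$; $\mathrm{sgn}\,D$ is the bounded operator obtained from $\mathrm{sgn}=1_{\Sigma_\theta}-1_{-\Sigma_\theta}$ on $\overline{\mathrm{Ran}\,D}$ and equal to $0$ on $\ker D$. A compact Banach spectral triple $(\mathcal{A},X,D)$ consists of a reflexive Banach space $X$, a densely defined bisectorial operator $D$ on $X$, and a Banach algebra $\mathcal{A}$ with a continuous homomorphism $\pi:\mathcal{A}\to\mathrm{B}(X)$ such that: (1) $D$ admits a bounded $\mathrm{H}^\infty(\Sigma^{\mathrm{bi}}_\theta)$ functional calculus for some $\theta\in(\omega_{\mathrm{bi}}(D),\frac\pi2)$; (2) $D$ has compact resolvent; (3) the Lipschitz algebra $\mathrm{Lip}_D(\mathcal{A})=\{a\in\mathcal{A}:\pi(a)\,\mathrm{dom}\,D\subset\mathrm{dom}\,D$ and $[D,\pi(a)]:\mathrm{dom}\,D\to X$ extends to a bounded operator on $X\}$ is dense in $\mathcal{A}$. If (2) is replaced by ''$D^{-1}$ is a compact operator on $\overline{\mathrm{Ran}\,D}$'', the triple is called possibly kernel-degenerate. An odd Banach Fredholm module $(X,\pi,F)$ over $\mathcal{A}$: Banach space $X$, homomorphism $\pi:\mathcal{A}\to\mathrm{B}(X)$, bounded $F$ on $X$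 with $F^2-\mathrm{Id}_X$ and $[F,\pi(a)]$ compact for all $a\in\mathcal{A}$. A possibly kernel-degenerate Banach Fredholm module: same data, such that $X=Y\oplus\ker F$ for some Banach space $Y$, with bounded projection $Q$ of $X$ onto $Y$ along $\ker F$, such that $Q(F^2-\mathrm{Id}_X)|_Y$ is compact on $Y$ and $Q[F,\pi(a)]|_Y$ is compact on $Y$ for all $a\in\mathcal{A}$. *)

(* Defs.v *)
From HB Require Import structures.
From mathcomp Require Import all_boot all_order all_algebra.
From mathcomp Require Import complex.
From mathcomp Require Import all_classical all_reals all_analysis.
Set Implicit Arguments.
Unset Strict Implicit.
Unset Printing Implicit Defensive.
Import Order.TTheory GRing.Theory Num.Theory.
Import numFieldNormedType.Exports.
Import Normc.
Local Open Scope classical_set_scope.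
Local Open Scope complex_scope.
Local Open Scope ring_scope.

(* Complex Banach spaces are [completeNormedModType R[i]]. The norm [`|x|] of
   such a space takes its values in [R[i]], whose order makes [a <= b] mean
   that [b - a] is a nonnegative real; real constants are embedded by [%:C]. *)

Section BoundedOperators.
Variable R : realType.

Definition bounded_linear (V W : normedModType R[i]) (T : V -> W) : Prop :=
  linear T /\ exists M : R, forall x, `|T x| <= M%:C * `|x|.

(* [T] is only considered on the linear subspace [Y], as an operator [Y -> Y];
   its values outside [Y] are irrelevant. *)
Definition linear_on (X : normedModType R[i]) (Y : set X) (T : X -> X) : Prop :=
  (forall x, Y x -> Y (T x)) /\
  (forall (a : R[i]) x y, Y x -> Y y -> T (a *: x + y) = a *: T x + T y).

Definition bounded_on (X : normedModType R[i]) (Y : set X) (T : X -> X) : Prop :=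
  linear_on Y T /\ exists M : R, forall x, Y x -> `|T x| <= M%:C * `|x|.

(* For closed [Y], relative compactness in [Y] and in [X] agree. *)
Definition compact_on (X : normedModType R[i]) (Y : set X) (T : X -> X) : Prop :=
  linear_on Y T /\ precompact (T @` (Y `&` [set x | `|x| <= 1])).

Definition compact_operator (X : normedModType R[i]) (T : X -> X) : Prop :=
  compact_on setT T.

(* The canonical embedding of [X] into its bidual is onto. Elements of the dual
   are the bounded linear [phi], and [Phi] is only considered on those. *)
Definition reflexive_space (X : normedModType R[i]) : Prop :=
  forall Phi : (X -> R[i]^o) -> R[i],
    (forall (a : R[i]) (phi psi : X -> R[i]^o), bounded_linear phi -> bounded_linear psi ->
       Phi (fun x => a *: phi x + psi x) = a * Phi phi + Phi psi) ->
    (exists M : R, forall (phi : X -> R[i]^o) (N : R), bounded_linear phi -> 0 <= N ->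
       (forall x, `|phi x| <= N%:C * `|x|) -> `|Phi phi| <= (M * N)%:C) ->
    exists x : X, forall phi : X -> R[i]^o, bounded_linear phi -> Phi phi = phi x.

End BoundedOperators.

(* The values of [opval] outside [dom] are irrelevant. *)
Record unbounded_operator (R : realType) (X : normedModType R[i]) := UnboundedOperator {
  dom : set X;
  opval :> X -> X;
  dom0 : dom 0;
  dom_linear : forall (a : R[i]) x y, dom x -> dom y -> dom (a *: x + y);
  opval_linear : forall (a : R[i]) x y, dom x -> dom y ->
    opval (a *: x + y) = a *: opval x + opval y }.

Section UnboundedOperators.
Variables (R : realType) (X : normedModType R[i]) (D : unbounded_operator X).

Definition Ran : set X := D @` dom D.

Definition Ker : set X := [set x | dom D x /\ D x = 0].

Definition closed_operator : Prop :=
  closed [set p : X * X | dom D p.1 /\ D p.1 = p.2].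

Definition resolvent_set : set R[i] :=
  [set z | exists T : X -> X,
     [/\ bounded_linear T,
         forall x, dom D (T x) /\ z *: T x - D (T x) = x &
         forall y, dom D y -> T (z *: y - D y) = y]].

Definition spectrum : set R[i] := ~` resolvent_set.

(* [(z - D)^-1 x], meaningful for [z] in the resolvent set. *)
Definition resolvent (z : R[i]) (x : X) : X :=
  xget 0 [set y | dom D y /\ z *: y - D y = x].

Definition compact_resolvent : Prop :=
  exists2 z, resolvent_set z & compact_operator (resolvent z).

(* The restriction of [D] to the closure of its range is a bijection from its
   domain onto that closure, with compact inverse. *)
Definition compact_inverse_on_range : Prop :=
  exists T : X -> X,
    [/\ compact_on (closure Ran) T,
        forall y, closure Ran y -> dom D (T y) /\ D (T y) = y &
        forall x, closure Ran x -> dom D x -> T (D x) = x].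

End UnboundedOperators.

Section Sectors.
Variable R : realType.

Definition cis (t : R) : R[i] := cos t +i* sin t.

Definition sector (theta : R) : set R[i] :=
  [set z | exists r t : R, [/\ 0 < r, `|t| < theta & z = r%:C * cis t]].

Definition opp_sector (theta : R) : set R[i] := [set - z | z in sector theta].

Definition bisector (theta : R) : set R[i] := sector theta `|` opp_sector theta.

Definition Hoo (theta : R) (f : R[i] -> R[i]) : Prop :=
  (forall z, bisector theta z -> derivable (f : R[i]^o -> R[i]^o) z 1) /\
  exists M : R, forall z, bisector theta z -> normc (f z) <= M.

Definition Hoo0 (theta : R) (f : R[i] -> R[i]) : Prop :=
  Hoo theta f /\
  exists C s : R, [/\ 0 < C, 0 < s & forall z, bisector theta z ->
    normc (f z) <=
      C * Num.min (normc z `^ s) (normc z `^ (- s))].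

Definition sup_norm (theta : R) (f : R[i] -> R[i]) : R :=
  sup [set normc (f z) | z in bisector theta].

Definition sgn_bisector (theta : R) (z : R[i]) : R[i] :=
  \1_(sector theta) z - \1_(opp_sector theta) z.

End Sectors.

Section Integrals.
Variables (R : realType) (X : normedModType R[i]).

(* Riemann integral over [[a, b]], through the partitions
   [a = t 0 <= ... <= t n = b] with tags [xi i] in [[t i, t i.+1]]. *)
Definition is_Riemann_integral (g : R -> X) (a b : R) (J : X) : Prop :=
  forall e : R, 0 < e -> exists2 delta : R, 0 < delta &
    forall (n : nat) (t xi : nat -> R),
      t 0%N = a -> t n = b ->
      (forall i, (i < n)%N -> t i <= xi i <= t i.+1 /\ t i.+1 - t i < delta) ->
      `|\sum_(i < n) (t i.+1 - t i)%:C *: g (xi i) - J| < e%:C.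

(* Improper Riemann integral over [(0, +oo)], both ends being independent. *)
Definition is_integral_0oo (g : R -> X) (I : X) : Prop :=
  forall e : R, 0 < e -> exists r0 s0 : R, 0 < r0 <= s0 /\
    forall r s : R, 0 < r <= r0 -> s0 <= s ->
      exists2 J, is_Riemann_integral g r s J & `|J - I| < e%:C.

Definition integral_0oo (g : R -> X) : X := xget 0 (is_integral_0oo g).

(* Integral of [h(z) dz] along the ray [t |-> t u], [0 < t < +oo]. *)
Definition ray_integral (h : R[i] -> X) (u : R[i]) : X :=
  integral_0oo (fun t : R => u *: h (t%:C * u)).

(* Counterclockwise orientation: each of the two sectors lies to the left of
   its boundary, so its lower ray (rotated by pi for the left sector) is
   followed outwards and its upper ray inwards. *)
Definition contour_integral (nu : R) (h : R[i] -> X) : X :=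
  (ray_integral h (cis (- nu)) - ray_integral h (cis nu)) +
  (ray_integral h (- cis (- nu)) - ray_integral h (- cis nu)).

End Integrals.

Section Bisectorial.
Variables (R : realType) (X : normedModType R[i]) (D : unbounded_operator X).

Definition bisectorial_type (w : R) : Prop :=
  [/\ closed_operator D, dense (dom D), 0 < w < pi / 2,
      spectrum D `<=` closure (bisector w : set R[i]^o) &
      exists M : R, forall z, ~ closure (bisector w : set R[i]^o) z ->
        forall x, `|z *: resolvent D z x| <= M%:C * `|x|].

Definition bisectorial : Prop := exists w, bisectorial_type w.

Definition omega_bi : R := inf [set w | bisectorial_type w].

(* [f(D) x], the operator-valued contour integral being evaluated at [x].
   For [f] in [Hoo0 theta] it does not depend on [nu] in
   [(omega_bi, theta)] by Cauchy's theorem. *)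
Definition fcalc (nu : R) (f : R[i] -> R[i]) (x : X) : X :=
  (2%:R * 'i%C * (pi : R)%:C)^-1 *:
    contour_integral nu (fun z => f z *: resolvent D z x).

Definition bounded_Hoo_calculus (theta : R) : Prop :=
  exists C : R, forall nu f, omega_bi < nu < theta -> Hoo0 theta f ->
    forall x, `|fcalc nu f x| <= (C * sup_norm theta f)%:C * `|x|.

(* [T] is [f(D)] on the closure of the range of [D], for a bounded holomorphic
   [f]: the value at [f] of the multiplicative extension of the calculus. It is
   determined by [f(D) g(D) = (f g)(D)] for [g] in [Hoo0 theta], as the ranges
   of the operators [g(D)] span a dense subspace. *)
Definition Hoo_calculus (theta : R) (f : R[i] -> R[i]) (T : X -> X) : Prop :=
  bounded_on (closure (Ran D)) T /\
  forall nu g, omega_bi < nu < theta -> Hoo0 theta g ->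
    forall x, closure (Ran D) x ->
      T (fcalc nu g x) = fcalc nu (fun z => f z * g z) x.

Definition is_sgn (F : X -> X) : Prop :=
  [/\ bounded_linear F,
      forall x, Ker D x -> F x = 0 &
      forall theta, omega_bi < theta < pi / 2 -> bounded_Hoo_calculus theta ->
        Hoo_calculus theta (sgn_bisector theta) F].

End Bisectorial.

Section Modules.
Variables (R : realType) (A X : completeNormedModType R[i]).
Variables (mul : A -> A -> A) (rep : A -> X -> X).

(* Complex Banach algebra with product [mul], not necessarily unital. *)
Definition Banach_algebra : Prop :=
  [/\ associative mul,
      forall a, linear (mul a),
      forall b, linear (mul^~ b) &
      forall a b, `|mul a b| <= `|a| * `|b|].

Definition is_homomorphism : Prop :=
  [/\ forall a, bounded_linear (rep a),
      forall (k : R[i]) a b x, rep (k *: a + b) x = k *: rep a x + rep b x &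
      forall a b x, rep (mul a b) x = rep a (rep b x)].

(* Continuity for the operator norm on [B(X)]; for a linear map this is
   boundedness. *)
Definition continuous_homomorphism : Prop :=
  is_homomorphism /\
  exists M : R, forall a x, `|rep a x| <= M%:C * `|a| * `|x|.

Definition Lip (D : unbounded_operator X) : set A :=
  [set a | (forall x, dom D x -> dom D (rep a x)) /\
     exists2 T : X -> X, bounded_linear T &
       forall x, dom D x -> T x = D (rep a x) - rep a (D x)].

Definition pre_spectral_triple (D : unbounded_operator X) : Prop :=
  [/\ Banach_algebra /\ continuous_homomorphism,
      reflexive_space X,
      bisectorial D,
      exists2 theta, omega_bi D < theta < pi / 2 & bounded_Hoo_calculus D theta &
      dense (Lip D)].

Definition compact_spectral_triple (D : unbounded_operator X) : Prop :=
  pre_spectral_triple D /\ compact_resolvent D.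

Definition degenerate_compact_spectral_triple (D : unbounded_operator X) : Prop :=
  pre_spectral_triple D /\ compact_inverse_on_range D.

Definition odd_Fredholm_module (F : X -> X) : Prop :=
  [/\ is_homomorphism, bounded_linear F,
      compact_operator (fun x => F (F x) - x) &
      forall a, compact_operator (fun x => F (rep a x) - rep a (F x))].

(* [X] is the direct sum of the closed subspace [Y] and [N], and [Q] is the
   bounded projection onto [Y] along [N]. *)
Definition projection_along (Q : X -> X) (Y N : set X) : Prop :=
  [/\ closed Y, bounded_linear Q, forall x, Y (Q x),
      forall y, Y y -> Q y = y & forall x, Q x = 0 <-> N x].

Definition degenerate_Fredholm_module (F : X -> X) : Prop :=
  [/\ is_homomorphism, bounded_linear F &
      exists (Y : set X) (Q : X -> X),
        [/\ projection_along Q Y [set x | F x = 0],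
            compact_on Y (fun y => Q (F (F y) - y)) &
            forall a, compact_on Y (fun y => Q (F (rep a y) - rep a (F y)))]].

End Modules.

(* Main.v *)
From HB Require Import structures.
Require Import Defs.
From mathcomp Require Import all_boot all_order all_algebra.
From mathcomp Require Import complex.
From mathcomp Require Import all_classical all_reals all_analysis.
From mathcomp Require Import ring lra.
Import numFieldNormedType.Exports.
Set Implicit Arguments.
Unset Strict Implicit.
Unset Printing Implicit Defensive.
Import Order.TTheory GRing.Theory Num.Theory.
Import Normc.
Local Open Scope classical_set_scope.
Local Open Scope complex_scope.
Local Open Scope ring_scope.

(** Why the theorem is true.

    Write [R(z)] for the resolvent of [D], [Y] for the closure of the range, and
    [r_t(z) = z / (t^2 + z^2)]. Everything rests on the formula
    [sgn z = (2 / pi) * \int_0^oo r_t(z) dt], valid off the imaginary axis, and on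
    [r_t(D) = - (R(i t) + R(- i t)) / 2]: the sign of [D] is a strong limit of Riemann
    sums [sgnD k], in steps of [2 ^- k] up to [t = 2 ^ k], of resolvents taken on the
    imaginary axis.

    The sign. The kernel is split off first: [z R(z)] fixes the kernel and tends to
    zero on [Y] as [z = i t] tends to zero, so that [X = ker D + Y] as soon as every
    vector of the domain splits; here this comes from the compactness hypothesis. On the
    kernel the sums [sgnD k] vanish. On [Y] they are values of the calculus at the
    rational functions [sgn_approx k], which are bounded uniformly in [k] on the
    bisector: the bounded calculus bounds the [sgnD k], and for [g] with decay at [0] and
    infinity, [sgn_approx k * g] tends to [sgn * g] with a rate, so that
    [sgnD k g(D) x] tends to [(sgn * g)(D) x]. The ranges of the [r_t(D)] being dense in
    [Y], the [sgnD k] converge strongly, the limit [F] is an [is_sgn] operator, it is the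
    only one, and [F (F y) = y] on [Y] because [sgn * (sgn * r_t) = r_t].
    Three facts on the contour integral are needed: linearity and absolute
    convergence; [r_t(D) g(D) = (r_t g)(D)], where the resolvent identity leaves a term
    that Cauchy's theorem kills ([rD_fcalc]); and that the contour integral of [r_t] is
    the above combination of resolvents ([fcalc_rker]). In the last one the pole
    of [r_t] is removed by subtracting an explicit scalar function times a fixed vector,
    whose ray integrals are computed by an arctangent. The only form of Cauchy's theorem
    used is for sectors with the vertex at the origin, obtained from Goursat's argument
    on polar rectangles ([sector_Cauchy]).

    Compactness. For [a] in the Lipschitz algebra, with [delta = [D, a]] bounded,
    [[R(z), a] = R(z) delta R(z)]. Let [Q] be the projection onto [Y] along the kernel. On
    [Y], [D] is bounded below and [R(i t)] is compact, so that
    [Q [R(i t), a] = R(i t) Q delta R(i t)] is compact, of norm [O((1 + t)^-2)] and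
    Lipschitz in [t] with a comparable bound. The Riemann sums that approximate
    [Q [F, a]] on [Y] therefore converge in operator norm, and the limit is compact
    ([range_commutator_compact]); density of the Lipschitz algebra gives all [a].
    This settles the kernel-degenerate case, since [Q (F^2 - 1)] vanishes on [Y] and the
    kernel of [F] is that of [D]. If the resolvent itself is compact, so is the
    projection [P = 1 - Q] onto the kernel, and [F^2 - 1 = - P] and
    [[F, a] = Q [F, a] Q + P [F, a] Q + [F, a] P] are compact on the whole space. *)

(** * Identities in modules *)

(** The trivial square-zero extension of the scalars by a module: the identities
    of the module are identities of this commutative ring. *)
Section SquareZero.
Variables (R : realType) (V : lmodType R[i]).
Local Notation K := R[i].

Definition sqz : Type := (K * V)%type.
HB.instance Definition _ := GRing.Zmodule.on sqz.

Definition sqz_mul (x y : sqz) : sqz := (x.1 * y.1, x.1 *: y.2 + y.1 *: x.2).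
Definition sqz_one : sqz := (1, 0).

Lemma sqz_mulA : associative sqz_mul.
Proof.
move=> [a u] [b v] [c w]; rewrite /sqz_mul /= mulrA; congr pair.
by rewrite !scalerDr !scalerA addrA [c * a]mulrC [c * b]mulrC -addrA [b * c]mulrC.
Qed.

Lemma sqz_mulC : commutative sqz_mul.
Proof. by move=> [a u] [b v]; rewrite /sqz_mul /= mulrC addrC. Qed.

Lemma sqz_mul1 : left_id sqz_one sqz_mul.
Proof. by move=> [a u]; rewrite /sqz_mul /= mul1r scale1r scaler0 addr0. Qed.

Lemma sqz_mulD : left_distributive sqz_mul +%R.
Proof.
move=> [a u] [b v] [c w]; rewrite /sqz_mul /=; congr pair; first by rewrite mulrDl.
by rewrite scalerDl scalerDr addrACA.
Qed.

Lemma sqz_one_neq0 : sqz_one != 0.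
Proof. by apply/eqP => -[/eqP]; rewrite oner_eq0. Qed.

HB.instance Definition _ := GRing.Zmodule_isComNzRing.Build sqz
  sqz_mulA sqz_mulC sqz_mul1 sqz_mulD sqz_one_neq0.

Definition sqz_vec (u : V) : sqz := (0, u).
Definition sqz_scal (a : K) : sqz := (a, 0).

Lemma sqz_vec_inj : injective sqz_vec.
Proof. by move=> u v []. Qed.

Lemma sqz_vecD u v : sqz_vec (u + v) = sqz_vec u + sqz_vec v.
Proof. by congr pair; rewrite /= addr0. Qed.

Lemma sqz_vecN u : sqz_vec (- u) = - sqz_vec u.
Proof. by congr pair; rewrite /= oppr0. Qed.

Lemma sqz_vec0 : sqz_vec 0 = 0.
Proof. by []. Qed.

Lemma sqz_scal_is_additive : additive sqz_scal.
Proof. by move=> u v; congr pair; rewrite /= subr0. Qed.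
HB.instance Definition _ := GRing.isAdditive.Build K sqz sqz_scal sqz_scal_is_additive.

Lemma sqz_scal_is_multiplicative : multiplicative sqz_scal.
Proof. by split => // a b; congr pair; rewrite /= !scaler0 addr0. Qed.
HB.instance Definition _ :=
  GRing.isMultiplicative.Build K sqz sqz_scal sqz_scal_is_multiplicative.

Lemma sqz_vecZ a u : sqz_vec (a *: u) = sqz_scal a * sqz_vec u.
Proof. by congr pair; rewrite /= ?mulr0 ?scaler0 ?addr0. Qed.

End SquareZero.

Ltac vring := apply: sqz_vec_inj;
  rewrite ?(sqz_vecD, sqz_vecN, sqz_vec0, sqz_vecZ); ring.

(** * The real-valued norm and convergence of sequences *)

Section RealNorm.
Variable R : realType.

Definition nrm (V : normedModType R[i]) (x : V) : R := complex.Re `|x|.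

Section NormTheory.
Variable V : normedModType R[i].
Implicit Types (x y : V) (a : R[i]) (t : R).

Lemma normE x : `|x| = (nrm x)%:C.
Proof.
have : 0 <= `|x| by [].
by rewrite lecE /= => /andP[/eqP h _]; apply/eqP; rewrite eq_complex /nrm /= h !eqxx.
Qed.

Lemma nrm_ge0 x : 0 <= nrm x.
Proof. by have : 0 <= `|x| by []; rewrite normE lecR. Qed.

Lemma nrm0 : nrm (0 : V) = 0.
Proof. by rewrite /nrm normr0. Qed.

Lemma nrm_eq0 x : nrm x = 0 -> x = 0.
Proof. by move=> h; apply/eqP; rewrite -normr_eq0 normE h. Qed.

Lemma nrmN x : nrm (- x) = nrm x.
Proof. by rewrite /nrm normrN. Qed.

Lemma nrmB x y : nrm (x - y) = nrm (y - x).
Proof. by rewrite -nrmN opprB. Qed.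

Lemma nrmD x y : nrm (x + y) <= nrm x + nrm y.
Proof. by have := ler_normD x y; rewrite !normE -rmorphD lecR. Qed.

Lemma nrmDB x y : nrm (x - y) <= nrm x + nrm y.
Proof. by rewrite -[nrm y]nrmN nrmD. Qed.

Lemma nrm_tri x y z : nrm (x - z) <= nrm (x - y) + nrm (y - z).
Proof. by rewrite -[x - z](subrKA y) nrmD. Qed.

Lemma nrmZ a x : nrm (a *: x) = normc a * nrm x.
Proof.
have : `|a *: x| = (normc a * nrm x)%:C by rewrite normrZ normE rmorphM.
by rewrite normE => /complexI.
Qed.

Lemma normcR t : normc t%:C = `|t|.
Proof. by rewrite /normc /= expr0n /= addr0 sqrtr_sqr. Qed.

Lemma nrmZR t x : nrm (t%:C *: x) = `|t| * nrm x.
Proof. by rewrite nrmZ normcR. Qed.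

Lemma nrm_sum n (F : 'I_n -> V) : nrm (\sum_(i < n) F i) <= \sum_(i < n) nrm (F i).
Proof.
elim/big_ind2 : _ => //; first by rewrite nrm0.
by move=> x1 x2 y1 y2 h1 h2; apply: (le_trans (nrmD _ _)); apply: lerD.
Qed.

Lemma nrm_small x : (forall e, 0 < e -> nrm x <= e) -> x = 0.
Proof.
move=> h; apply: nrm_eq0; apply/eqP; rewrite eq_le nrm_ge0 andbT.
by apply/ler_addgt0Pl => e e0; rewrite addr0 h.
Qed.

End NormTheory.

Lemma normcE (z : R[i]) : nrm (z : R[i]^o) = normc z.
Proof. by rewrite /nrm. Qed.

Lemma normc_ge0 (z : R[i]) : 0 <= normc z.
Proof. by rewrite -normcE nrm_ge0. Qed.

Lemma normcD (z w : R[i]) : normc (z + w) <= normc z + normc w.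
Proof. exact: le_normcD. Qed.

Lemma normcB (z w : R[i]) : normc (z - w) = normc (w - z).
Proof. exact: (@nrmB (R[i]^o)). Qed.

Lemma normcopp (z : R[i]) : normc (- z) = normc z.
Proof. exact: (@nrmN (R[i]^o)). Qed.

Lemma normcDB (z w : R[i]) : normc (z - w) <= normc z + normc w.
Proof. exact: (@nrmDB (R[i]^o)). Qed.

Lemma normc_gt0 (z : R[i]) : z != 0 -> 0 < normc z.
Proof.
move=> z0; rewrite lt_def normc_ge0 andbT.
by apply: contra z0 => /eqP/eq0_normc ->.
Qed.

Lemma normcX (z : R[i]) n : normc (z ^+ n) = normc z ^+ n.
Proof. by elim: n => [|n IH]; rewrite ?expr0 ?normc1 // !exprS normcM IH. Qed.

Definition lim_to (V : normedModType R[i]) (u : nat -> V) (l : V) : Prop :=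
  forall e : R, 0 < e -> exists N, forall n, (N <= n)%N -> nrm (u n - l) <= e.

Section Limits.
Variable V : normedModType R[i].
Implicit Types (u v : nat -> V) (l m : V).

Lemma lim_to_unique u l m : lim_to u l -> lim_to u m -> l = m.
Proof.
move=> ul um; apply/eqP; rewrite -subr_eq0; apply/eqP; apply: nrm_small => e e0.
have e2 : 0 < e / 2 by rewrite divr_gt0.
have [N1 h1] := ul _ e2; have [N2 h2] := um _ e2.
have /h1 k1 := leq_maxl N1 N2; have /h2 k2 := leq_maxr N1 N2.
apply: (le_trans (nrm_tri _ (u (maxn N1 N2)) _)).
by rewrite nrmB (splitr e) lerD.
Qed.

Lemma lim_to_cst l : lim_to (fun _ => l) l.
Proof. by move=> e e0; exists 0%N => n _; rewrite subrr nrm0 ltW. Qed.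

Lemma lim_toD u v l m : lim_to u l -> lim_to v m -> lim_to (fun n => u n + v n) (l + m).
Proof.
move=> ul vm e e0; have e2 : 0 < e / 2 by rewrite divr_gt0.
have [N1 h1] := ul _ e2; have [N2 h2] := vm _ e2.
exists (maxn N1 N2) => n; rewrite geq_max => /andP[/h1 k1 /h2 k2].
by rewrite opprD addrACA (le_trans (nrmD _ _)) // (splitr e) lerD.
Qed.

Lemma lim_to_map (W : normedModType R[i]) (T : V -> W) (C : R) u l :
  (forall x y, T (x - y) = T x - T y) -> (forall x, nrm (T x) <= C * nrm x) ->
  lim_to u l -> lim_to (fun n => T (u n)) (T l).
Proof.
move=> TB TC ul e e0; have C1 : 0 < `|C| + 1 by rewrite ltr_wpDl.
have [N h] := ul _ (divr_gt0 e0 C1).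
exists N => n /h k; rewrite -TB (le_trans (TC _)) //.
apply: (@le_trans _ _ ((`|C| + 1) * nrm (u n - l))).
  by rewrite ler_wpM2r ?nrm_ge0 // (le_trans (ler_norm C)) // lerDl.
by rewrite mulrC -ler_pdivlMr.
Qed.

Lemma lim_toZ (a : R[i]) u l : lim_to u l -> lim_to (fun n => a *: u n) (a *: l).
Proof.
apply: (@lim_to_map _ (fun x => a *: x) (normc a)) => [x y|x]; first by rewrite scalerBr.
by rewrite nrmZ.
Qed.

Lemma lim_toB u v l m : lim_to u l -> lim_to v m -> lim_to (fun n => u n - v n) (l - m).
Proof.
move=> ul vm; apply: lim_toD => //.
by move=> e /vm[N h]; exists N => n /h; rewrite -opprD nrmN.
Qed.

Lemma lim_to_le u l (C : R) : lim_to u l -> (forall n, nrm (u n) <= C) -> nrm l <= C.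
Proof.
move=> ul h; apply/ler_addgt0Pl => e e0; have [N /(_ _ (leqnn N)) k] := ul _ e0.
have -> : l = u N - (u N - l) by rewrite subKr.
by rewrite (le_trans (nrmDB _ _)) // addrC lerD.
Qed.

Lemma eq_lim_to u v l : (forall n, u n = v n) -> lim_to u l -> lim_to v l.
Proof. by move=> h ul e /ul[N k]; exists N => n /k; rewrite h. Qed.

End Limits.

Lemma cauchy_lim_to (V : completeNormedModType R[i]) (u : nat -> V) :
  (forall e : R, 0 < e -> exists N, forall n m, (N <= n)%N -> (N <= m)%N ->
    nrm (u n - u m) <= e) -> exists l, lim_to u l.
Proof.
move=> uC.
have : cauchy (u @ \oo).
  apply/cauchy_ballP => e; rewrite ltcE /= => /andP[/eqP e0 er].
  have eE : e = (complex.Re e)%:C by apply/eqP; rewrite eq_complex /= e0 !eqxx.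
  have [N h] := uC _ (divr_gt0 er (ltr0n R 2)).
  near_simpl; exists ([set n | (N <= n)%N], [set n | (N <= n)%N]) => /=.
    by split; exists N.
  move=> [n m] [/= Nn Nm]; rewrite -ball_normE /= eE normE ltcR.
  apply: (le_lt_trans (h _ _ Nn Nm)); rewrite ltr_pdivrMr // ltr_pMr //.
  by rewrite ltr1n.
move=> /cauchy_cvg /cvg_ex[l ul]; exists l => e e0.
move/cvg_ballP : ul => /(_ e%:C); rewrite ltcR => /(_ e0)[N _ h].
by exists N => n /h; rewrite -ball_normE /= normE ltcR nrmB => /ltW.
Unshelve. all: by end_near. Qed.

End RealNorm.

(** * Riemann integration through uniform primitives *)

Section Primitives.
Variable R : realType.

(** A primitive whose difference quotients converge uniformly, whatever the tag.
    Riemann sums then telescope up to a small error, so that existence, bounds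
    and additivity of integrals never involve refinements of partitions. *)
Definition uprim (V : normedModType R[i]) (G g : R -> V) (a b : R) : Prop :=
  forall e : R, 0 < e -> exists2 d : R, 0 < d & forall x t y,
    a <= x -> x <= t -> t <= y -> y <= b -> y - x < d ->
    nrm (G y - G x - (y - x)%:C *: g t) <= e * (y - x).

Definition uprimR (K k : R -> R) (a b : R) : Prop :=
  forall e : R, 0 < e -> exists2 d : R, 0 < d & forall x t y,
    a <= x -> x <= t -> t <= y -> y <= b -> y - x < d ->
    `|K y - K x - (y - x) * k t| <= e * (y - x).

Definition cont_at (V : normedModType R[i]) (g : R -> V) (t : R) : Prop :=
  forall e : R, 0 < e -> exists2 d : R, 0 < d & forall t', `|t' - t| < d ->
    nrm (g t' - g t) <= e.

Definition ucont (V : normedModType R[i]) (g : R -> V) (a b : R) : Prop :=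
  forall e : R, 0 < e -> exists2 d : R, 0 < d & forall x y,
    a <= x <= b -> a <= y <= b -> `|x - y| < d -> nrm (g x - g y) <= e.

Lemma exists_mesh (l d : R) : 0 <= l -> 0 < d -> exists n : nat, l / n.+1%:R < d.
Proof.
move=> l0 d0; exists (Num.bound (l / d)).
have := archi_boundP (divr_ge0 l0 (ltW d0)).
rewrite ltr_pdivrMr // => h; rewrite ltr_pdivrMr // mulrC (lt_trans h) //.
by rewrite ltr_pM2r // ltr_nat.
Qed.

Section Telescoping.
Variable V : normedModType R[i].
Implicit Types (G g : R -> V) (a b c : R).

(** The mean value inequality: a local bound of the increments by those of a
    real function is a global one. *)
Lemma telescope_le G (k : R -> R) a b d : a <= b -> 0 < d ->
  (forall x y, a <= x -> x <= y -> y <= b -> y - x < d ->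
     nrm (G y - G x) <= k y - k x) ->
  nrm (G b - G a) <= k b - k a.
Proof.
move=> ab d0 h; have ba0 : 0 <= b - a by rewrite subr_ge0.
have [n hn] := exists_mesh ba0 d0.
set l := (b - a) / n.+1%:R in hn.
have l0 : 0 <= l by rewrite divr_ge0.
have lE : l * n.+1%:R = b - a by rewrite divfK // pnatr_eq0.
pose p j : R := a + l * j%:R.
have pb j : (j <= n.+1)%N -> p j <= b.
  move=> jn; rewrite /p -lerBrDl -lE ler_wpM2l // ler_nat //.
have ind j : (j <= n.+1)%N -> nrm (G (p j) - G a) <= k (p j) - k a.
  elim: j => [_|j IH jn]; first by rewrite /p mulr0 addr0 !subrr nrm0.
  have pS : p j.+1 = p j + l by rewrite /p -natr1 mulrDr mulr1 addrA.
  have := IH (ltnW jn).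
  have : nrm (G (p j.+1) - G (p j)) <= k (p j.+1) - k (p j).
    have pj : a <= p j by rewrite /p lerDl mulr_ge0 ?ler0n.
    apply: h => //; first by rewrite pS lerDl.
      exact: pb.
    by rewrite pS addrAC subrr add0r.
  move=> h1 h2; apply: (le_trans (nrm_tri _ (G (p j)) _)); lra.
by have := ind _ (leqnn _); rewrite /p lE addrCA subrr addr0.
Qed.

Lemma uprim_sub G g a b a' b' : a <= a' -> b' <= b -> uprim G g a b -> uprim G g a' b'.
Proof.
move=> aa bb P e /P[d d0 h]; exists d => // x t y x1 x2 x3 x4 x5.
by apply: h => //; [exact: le_trans aa _|exact: le_trans bb].
Qed.

Lemma uprim_ext G g g' a b : (forall t, a <= t <= b -> g t = g' t) ->
  uprim G g a b -> uprim G g' a b.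
Proof.
move=> gg P e /P[d d0 h]; exists d => // x t y x1 x2 x3 x4 x5.
by rewrite -gg ?h // (le_trans x1) // (le_trans x3).
Qed.

Lemma uprimD G g G' g' a b : uprim G g a b -> uprim G' g' a b ->
  uprim (fun t => G t + G' t) (fun t => g t + g' t) a b.
Proof.
move=> P P' e e0; have e2 : 0 < e / 2 by rewrite divr_gt0.
have [d d0 h] := P _ e2; have [d' d0' h'] := P' _ e2.
exists (Num.min d d'); first by rewrite lt_min d0.
move=> x t y x1 x2 x3 x4; rewrite lt_min => /andP[x5 x6].
have -> : G y + G' y - (G x + G' x) - (y - x)%:C *: (g t + g' t) =
  (G y - G x - (y - x)%:C *: g t) + (G' y - G' x - (y - x)%:C *: g' t).
  by vring.
apply: (le_trans (nrmD _ _)); rewrite (splitr e) mulrDl.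
by apply: lerD; [exact: h|exact: h'].
Qed.

Lemma uprim_map (W : normedModType R[i]) (T : V -> W) (C : R) G g a b :
  linear T -> (forall x, nrm (T x) <= C * nrm x) ->
  uprim G g a b -> uprim (fun t => T (G t)) (fun t => T (g t)) a b.
Proof.
move=> TL TC P e e0; have C1 : 0 < `|C| + 1 by rewrite ltr_wpDl.
have [d d0 h] := P _ (divr_gt0 e0 C1); exists d => // x t y x1 x2 x3 x4 x5.
have TB u v : T (u - v) = T u - T v.
  by rewrite [u - v]addrC -scaleN1r TL scaleN1r addrC.
have TZ k u : T (k *: u) = k *: T u.
  have T0 : T 0 = 0 by have := TB 0 0; rewrite !subrr.
  by have := TL k u 0; rewrite addr0 T0 addr0.
rewrite -TZ -!TB (le_trans (TC _)) //.
have := h x t y x1 x2 x3 x4 x5; set n := nrm _ => k.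
have n0 : 0 <= n by exact: nrm_ge0.
apply: (@le_trans _ _ ((`|C| + 1) * n)).
  by rewrite ler_wpM2r // (le_trans (ler_norm C)) // lerDl.
by rewrite mulrC -ler_pdivlMr // mulrAC.
Qed.

Lemma uprimZ (k : R[i]) G g a b :
  uprim G g a b -> uprim (fun t => k *: G t) (fun t => k *: g t) a b.
Proof.
apply: (@uprim_map _ (fun x => k *: x) (normc k)) => [c x y|x].
  by rewrite scalerDr !scalerA mulrC.
by rewrite nrmZ.
Qed.

Lemma uprim_le G g K k a b : a <= b -> uprim G g a b -> uprimR K k a b ->
  (forall t, a <= t <= b -> nrm (g t) <= k t) -> nrm (G b - G a) <= K b - K a.
Proof.
move=> ab P Q gk; apply/ler_addgt0Pl => e e0.
have c0 : 0 < 2 * (b - a) + 1 by rewrite ltr_wpDl // mulr_ge0 // subr_ge0.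
set e' := e / (2 * (b - a) + 1); have e'0 : 0 < e' by rewrite divr_gt0.
have [d d0 h] := P _ e'0; have [d' d0' h'] := Q _ e'0.
have dd : 0 < Num.min d d' by rewrite lt_min d0.
have : nrm (G b - G a) <= (K b + 2 * e' * b) - (K a + 2 * e' * a).
  apply: (telescope_le (k := fun t => K t + 2 * e' * t) ab dd) => x y x1 x2 x3.
  rewrite lt_min => /andP[x4 x5].
  have := h x x y x1 (lexx _) x2 x3 x4; have := h' x x y x1 (lexx _) x2 x3 x5.
  rewrite ler_norml => /andP[h1 _] h2.
  have -> : G y - G x = (G y - G x - (y - x)%:C *: g x) + (y - x)%:C *: g x by rewrite subrK.
  apply: (le_trans (nrmD _ _)); rewrite nrmZR ger0_norm ?subr_ge0 //.
  have : (y - x) * nrm (g x) <= (y - x) * k x.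
    by rewrite ler_wpM2l ?subr_ge0 // gk // x1 (le_trans x2).
  lra.
have : e' * (2 * (b - a) + 1) = e by rewrite divfK // gt_eqF.
by move: e'0; lra.
Qed.

Lemma uprim_const_le G g (C : R) a b : a <= b -> uprim G g a b ->
  (forall t, a <= t <= b -> nrm (g t) <= C) -> nrm (G b - G a) <= C * (b - a).
Proof.
move=> ab P h; rewrite mulrBr; apply: (uprim_le (K := fun t => C * t) ab P _ h).
move=> e e0; exists 1 => // x t y _ x1 x2 _ _.
have -> : C * y - C * x - (y - x) * C = 0 by ring.
by rewrite normr0 mulr_ge0 ?subr_ge0 ?(ltW e0) // (le_trans x1).
Qed.

Lemma uprimB G g G' g' a b : uprim G g a b -> uprim G' g' a b ->
  uprim (fun t => G t - G' t) (fun t => g t - g' t) a b.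
Proof.
move=> P /(uprimZ (-1)) Q.
have := uprimD P Q.
have -> : (fun t => G t - G' t) = (fun t => G t + -1 *: G' t).
  by apply/funext => t; rewrite scaleN1r.
suff -> : (fun t => g t - g' t) = (fun t => g t + -1 *: g' t) by [].
by apply/funext => t; rewrite scaleN1r.
Qed.

Lemma uprim_unique G G' g a b : a <= b -> uprim G g a b -> uprim G' g a b ->
  G b - G a = G' b - G' a.
Proof.
move=> ab P Q; apply/eqP; rewrite -subr_eq0; apply/eqP; apply: nrm_small => e e0.
have -> : G b - G a - (G' b - G' a) = (G b - G' b) - (G a - G' a).
  by vring.
have := uprim_const_le (C := 0) ab (uprimB P Q); rewrite mul0r => h.
by apply: le_trans (ltW e0); apply: h => t _; rewrite subrr nrm0.
Qed.

Lemma uprim_Riemann G g a b : a <= b -> uprim G g a b ->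
  is_Riemann_integral g a b (G b - G a).
Proof.
move=> ab P e e0; have c0 : 0 < (b - a) + 1 by rewrite ltr_wpDl // subr_ge0.
have [d d0 h] := P _ (divr_gt0 e0 c0); set e' := _ / _ in h; exists d => // n t xi t0 tn pt.
have tm j : (j <= n)%N -> a <= t j.
  elim: j => [_|j IH jn]; first by rewrite t0.
  have [/andP[p1 p2] _] := pt j jn.
  exact: (le_trans (IH (ltnW jn))) (le_trans p1 p2).
have tM j : (j <= n)%N -> t j <= b.
  move=> jn; rewrite -(subKn jn); elim: (n - j)%N (leq_subr j n) => [|i IH] ni.
    by rewrite subn0 tn.
  have il : (n - i.+1 < n)%N by rewrite ltn_subrL (leq_ltn_trans _ ni).
  have [/andP[p1 p2] _] := pt _ il; apply: (le_trans (le_trans p1 p2)).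
  by rewrite subnSK // IH // ltnW.
have ind j : (j <= n)%N ->
    nrm (\sum_(i < j) (t i.+1 - t i)%:C *: g (xi i) - (G (t j) - G a)) <= e' * (t j - a).
  elim: j => [_|j IH jn]; first by rewrite big_ord0 t0 !subrr nrm0 mulr0.
  have [/andP[p1 p2] p3] := pt j jn; have := IH (ltnW jn).
  have := h (t j) (xi j) (t j.+1) (tm _ (ltnW jn)) p1 p2 (tM _ jn) p3.
  rewrite big_ord_recr /=; set S := \sum_(_ < _) _; set T := _ *: _ => h1 h2.
  have -> : S + T - (G (t j.+1) - G a) =
    (S - (G (t j) - G a)) - (G (t j.+1) - G (t j) - T).
    by vring.
  by apply: (le_trans (nrmDB _ _)); lra.
rewrite normE ltcR; have := ind n (leqnn _); rewrite tn => hh; apply: (le_lt_trans hh).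
have E : e' * (b - a + 1) = e by rewrite divfK // gt_eqF.
have : 0 < e' by rewrite divr_gt0.
lra.
Qed.

Lemma Riemann_unique g a b J J' : a <= b -> is_Riemann_integral g a b J ->
  is_Riemann_integral g a b J' -> J = J'.
Proof.
move=> ab P P'; apply/eqP; rewrite -subr_eq0; apply/eqP; apply: nrm_small => e e0.
have e2 : 0 < e / 2 by rewrite divr_gt0.
have [d d0 h] := P _ e2; have [d' d0' h'] := P' _ e2.
have ba0 : 0 <= b - a by rewrite subr_ge0.
have dd : 0 < Num.min d d' by rewrite lt_min d0.
have [n] := exists_mesh ba0 dd; rewrite lt_min => /andP[n1 n2].
set l := (b - a) / n.+1%:R in n1 n2.
have l0 : 0 <= l by rewrite divr_ge0.
pose p (j : nat) : R := a + l * j%:R.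
have pS j : p j.+1 = p j + l by rewrite /p -natr1 mulrDr mulr1 addrA.
have p0 : p 0%N = a by rewrite /p mulr0 addr0.
have pn : p n.+1 = b by rewrite /p divfK ?pnatr_eq0 // addrCA subrr addr0.
have pt q : l < q -> forall i, (i < n.+1)%N -> p i <= p i <= p i.+1 /\ p i.+1 - p i < q.
  by move=> lq i _; rewrite lexx pS lerDl l0 addrAC subrr add0r.
have := h _ p p p0 pn (pt _ n1); have := h' _ p p p0 pn (pt _ n2).
rewrite !normE !ltcR; set S := \sum_(_ < _) _ => k1 k2.
apply: (le_trans (nrm_tri _ S _)); rewrite (nrmB J S); lra.
Qed.

End Telescoping.

(** The length of the part of the segment between [x] and [y] in [[u, u + q]]. *)
Definition clamp (x y u q : R) : R :=
  (Num.min y (u + q) - Num.min y u) - (Num.min x (u + q) - Num.min x u).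

Lemma clamp_ge0 x y u q : 0 <= q -> x <= y -> 0 <= clamp x y u q.
Proof.
move=> q0 xy; rewrite /clamp.
by case: (leP y (u + q)); case: (leP x (u + q)); case: (leP x u); case: (leP y u); lra.
Qed.

Lemma clamp_neq0 x y u q : 0 <= q -> x <= y -> clamp x y u q != 0 -> u < y /\ x < u + q.
Proof.
move=> q0 xy /eqP nz; rewrite /clamp in nz.
split; rewrite ltNge; apply/negP => h; apply: nz.
  have h1 : y <= u + q by lra.
  have h2 : x <= u by lra.
  have h3 : x <= u + q by lra.
  by rewrite !min_l // !subrr.
have h1 : u <= x by lra.
have h2 : u <= y by lra.
have h3 : u + q <= y by lra.
by rewrite !min_r // subrr.
Qed.

(** The values at [x] of the primitives of the step functions that take on each
    cell [[p k, p k.+1]] the value of [g] at its left end. *)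
Lemma uprim_exists (V : completeNormedModType R[i]) (g : R -> V) a b :
  a <= b -> ucont g a b -> exists G, uprim G g a b.
Proof.
move=> ab gu; have ba0 : 0 <= b - a by rewrite subr_ge0.
pose p (n k : nat) : R := a + (b - a) / n.+1%:R * k%:R.
pose w n k (x : R) := Num.min x (p n k.+1) - Num.min x (p n k).
pose S (n : nat) (x : R) : V := \sum_(k < n.+1) (w n k x)%:C *: g (p n k).
have pS n k : p n k.+1 = p n k + (b - a) / n.+1%:R.
  by rewrite /p -(natr1 k) mulrDr mulr1 addrA.
have m0 n : 0 <= (b - a) / n.+1%:R by rewrite divr_ge0.
have pa n k : a <= p n k by rewrite /p lerDl mulr_ge0 ?m0 ?ler0n.
have pb n k : (k <= n.+1)%N -> p n k <= b.
  move=> kn; rewrite /p -lerBrDl mulrAC ler_pdivrMr // ler_wpM2l // ler_nat //.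
have wsum n x : a <= x <= b -> \sum_(k < n.+1) w n k x = x - a.
  move=> /andP[ax xb]; rewrite -(big_mkord xpredT (fun k => w n k x)).
  rewrite (telescope_sumr (fun k => Num.min x (p n k))) //.
  rewrite /p mulr0 addr0 divfK ?pnatr_eq0 // addrCA subrr addr0.
  by rewrite (min_idPl xb) (min_idPr ax).
have key e : 0 < e -> exists N : nat, exists2 d, 0 < d & forall n x t y, (N <= n)%N ->
    a <= x -> x <= t -> t <= y -> y <= b -> y - x < d ->
    nrm (S n y - S n x - (y - x)%:C *: g t) <= e * (y - x).
  move=> e0; have [d d0 h] := gu _ e0.
  have d2 : 0 < d / 2 by rewrite divr_gt0.
  have [N hN] := exists_mesh ba0 d2.
  exists N; exists (d / 2) => // n x t y Nn x1 x2 x3 x4 x5.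
  have mn : (b - a) / n.+1%:R < d / 2.
    by apply: le_lt_trans hN; rewrite ler_wpM2l // lef_pV2 ?posrE // ler_nat.
  have xy : x <= y by exact: le_trans x3.
  pose c k := w n k y - w n k x.
  have csum : \sum_(k < n.+1) c k = y - x.
    rewrite sumrB !wsum ?(le_trans x1 xy) ?x4 ?x1 ?(le_trans xy x4) //; lra.
  have c0 k : 0 <= c k.
    by rewrite /c /w pS; exact: clamp_ge0.
  have cn (k : 'I_n.+1) : c k * nrm (g (p n k) - g t) <= c k * e.
    have [->|ck] := eqVneq (c k) 0; first by rewrite !mul0r.
    rewrite ler_wpM2l //; apply: h.
    - by rewrite pa pb // ltnW.
    - by rewrite (le_trans x1) // (le_trans x3).
    - move: ck; rewrite /c /w pS => /(clamp_neq0 (m0 n) xy)[q1 q2].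
      move: mn q2; move: ((b - a) / _) (p n k) q1 => q u q1 mq q2.
      by rewrite ltr_norml; apply/andP; split; lra.
  have -> : S n y - S n x - (y - x)%:C *: g t =
      \sum_(k < n.+1) (c k)%:C *: (g (p n k) - g t).
    rewrite /S -sumrB -csum rmorph_sum /= scaler_suml -sumrB.
    by apply: eq_bigr => k _; rewrite scalerBr -scalerBl -rmorphB.
  apply: (le_trans (nrm_sum _)); apply: (@le_trans _ _ (\sum_(k < n.+1) c k * e)).
    by apply: ler_sum => k _; rewrite nrmZR ger0_norm // cn.
  by rewrite -mulr_suml csum mulrC.
have Sa n : S n a = 0.
  rewrite /S big1 // => k _; rewrite /w !(min_idPl (pa _ _)) subrr.
  by rewrite scale0r.
have lim x : a <= x <= b -> exists l, lim_to (S^~ x) l.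
  move=> /andP[ax xb]; apply: cauchy_lim_to => e e0.
  have c0 : 0 < 2 * (b - a) + 1 by rewrite ltr_wpDl // mulr_ge0.
  have e'0 : 0 < e / (2 * (b - a) + 1) by rewrite divr_gt0.
  have [N [d d0 h]] := key _ e'0; exists N => n m Nn Nm.
  set e' := e / _ in e'0 h.
  have : nrm ((S n x - S m x) - (S n a - S m a)) <= 2 * e' * x - 2 * e' * a.
    apply: (telescope_le (G := fun t => S n t - S m t) (k := fun t => 2 * e' * t) ax d0).
    move=> u y u1 u2 u3 u4.
    have := h n u u y Nn u1 (lexx _) u2 (le_trans u3 xb) u4.
    have := h m u u y Nm u1 (lexx _) u2 (le_trans u3 xb) u4.
    set T := _ *: _ => h1 h2.
    have -> : S n y - S m y - (S n u - S m u) = (S n y - S n u - T) - (S m y - S m u - T).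
      by vring.
    by apply: (le_trans (nrmDB _ _)); lra.
  rewrite !Sa subrr subr0 => hh; apply: (le_trans hh).
  have E : e' * (2 * (b - a) + 1) = e by rewrite divfK // gt_eqF.
  nra.
exists (fun x => xget 0 [set l | lim_to (S^~ x) l]) => e e0.
have [N [d d0 h]] := key _ e0; exists d => // x t y x1 x2 x3 x4 x5.
have xy := le_trans x2 x3.
have Gl z : a <= z <= b -> lim_to (S^~ z) (xget 0 [set l | lim_to (S^~ z) l]).
  by move=> /lim[l zl]; exact: (@xgetPex _ 0 [set l | lim_to (S^~ z) l]) (ex_intro _ l zl).
have l1 : lim_to (S^~ y) _ := Gl y _; have l2 : lim_to (S^~ x) _ := Gl x _.
have {}l1 := l1 ltac:(by rewrite (le_trans x1 xy)).
have {}l2 := l2 ltac:(by rewrite x1 (le_trans xy)).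
have l3 := lim_toB (lim_toB l1 l2) (lim_to_cst ((y - x)%:C *: g t)).
have sh (u : nat -> V) l : lim_to u l -> lim_to (fun n => u (n + N)%N) l.
  by move=> ul q /ul[M k]; exists M => n Mn; apply: k; rewrite (leq_trans Mn) ?leq_addr.
by apply: (lim_to_le (sh _ _ l3)) => n; apply: h => //; rewrite leq_addl.
Qed.

End Primitives.

Section Continuity.
Variable R : realType.

Lemma compact_seq_cluster (K : numFieldType) (T : pseudoMetricType K) (A : set T)
    (u : nat -> T) : compact A -> (forall n, A (u n)) ->
  exists2 p, A p & forall (e : K) (N : nat), 0 < e -> exists2 n, (N <= n)%N & ball p e (u n).
Proof.
move=> cA Au.
have FA : (u @ \oo) A by exists 0%N => // n _; exact: Au.
have [p [Ap cp]] := cA (u @ \oo) _ FA.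
exists p => // e N e0.
have uN : (u @ \oo) [set u n | n in [set n | (N <= n)%N]] by exists N => // n /= Nn; exists n.
have [_ [[n /= Nn <-] bn]] := cp _ _ uN (nbhsx_ballx p e e0).
by exists n.
Qed.

(** Uniform continuity for a pseudo-distance [rho], which is later the distance between
    the values of a vector-valued function. *)
Lemma Heine_Cantor (rho : R -> R -> R) (a b : R) :
  (forall x y, rho x y = rho y x) ->
  (forall x y z, rho x z <= rho x y + rho y z) ->
  (forall t, a <= t <= b -> forall e, 0 < e -> exists2 d : R, 0 < d &
     forall t', `|t' - t| < d -> rho t' t <= e) ->
  forall e, 0 < e -> exists2 d : R, 0 < d & forall x y, a <= x <= b -> a <= y <= b ->
     `|x - y| < d -> rho x y <= e.
Proof.
move=> rs rt rc e e0; apply: contrapT => nh.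
have bad (n : nat) : exists xy : R * R, [/\ a <= xy.1 <= b, a <= xy.2 <= b,
    `|xy.1 - xy.2| < n.+1%:R^-1 & e < rho xy.1 xy.2].
  apply: contrapT => nb; apply: nh; exists n.+1%:R^-1; first by rewrite invr_gt0.
  move=> x y xab yab xy; rewrite leNgt; apply/negP => er.
  by apply: nb; exists (x, y).
have [u /all_and4[u1 u2 u3 u4]] := choice bad.
have [|p] := compact_seq_cluster (u := fun n => (u n).1) (@segment_compact R a b).
  by move=> n; rewrite /= in_itv /= u1.
rewrite /= in_itv /= => pab cl; have e2 : 0 < e / 2 by rewrite divr_gt0.
have [d d0 h] := rc p pab _ e2.
have d2 : 0 < d / 2 by rewrite divr_gt0.
have [N] := @exists_mesh R 1 _ ler01 d2; rewrite div1r => hN.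
have [n Nn] := cl (d / 2) N d2; rewrite /ball /= => pn.
have un : `|(u n).1 - (u n).2| < d / 2.
  apply: (lt_le_trans (u3 n)); apply: (le_trans _ (ltW hN)).
  by rewrite lef_pV2 ?posrE // ler_nat.
have h1 : rho (u n).1 p <= e / 2 by apply: h; rewrite distrC; lra.
have h2 : rho (u n).2 p <= e / 2.
  apply: h; have := ler_distD (u n).1 (u n).2 p; rewrite (distrC (u n).2 (u n).1) (distrC (u n).1 p); lra.
by have := u4 n; have := rt (u n).1 p (u n).2; rewrite (rs p); lra.
Qed.

Lemma cont_ucont (V : normedModType R[i]) (g : R -> V) a b :
  (forall t, a <= t <= b -> cont_at g t) -> ucont g a b.
Proof.
move=> gc; apply: (@Heine_Cantor (fun x y => nrm (g x - g y))) => //.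
  by move=> x y; rewrite nrmB.
by move=> x y z; exact: nrm_tri.
Qed.

Lemma uprimR_derive (K k : R -> R) (a b : R) :
  (forall t : R, a <= t <= b -> is_derive t 1 K (k t)) ->
  (forall t : R, a <= t <= b -> {for t, continuous k}) -> uprimR K k a b.
Proof.
move=> Kd kc e e0.
have [] := @Heine_Cantor (fun x y => `|k x - k y|) a b _ _ _ e e0.
- by move=> x y; rewrite distrC.
- by move=> x y z; exact: ler_distD.
- move=> t tab e' e'0; have /(@cvgrPdist_le) /(_ e' e'0) := kc t tab.
  move=> /nbhs_ballP[d /= d0 h]; exists d => // t' t'd.
  by rewrite distrC; apply: h; rewrite /ball /= distrC.
move=> d d0 h; exists d => // x t y x1 x2 x3 x4 x5.
have := le_trans x2 x3; rewrite le_eqVlt => /orP[/eqP xy|xy].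
  by rewrite -xy !subrr mul0r subrr normr0 mulr0.
have sub z : x <= z <= y -> a <= z <= b.
  by move=> /andP[z1 z2]; rewrite (le_trans x1) // (le_trans z2).
have [||c] := @MVT R K k x y xy.
- by move=> z; rewrite in_itv /= => /andP[z1 z2]; apply: Kd; apply: sub; rewrite !ltW.
- apply: continuous_in_subspaceT => z; rewrite inE /= in_itv /= => /sub zab.
  by apply: differentiable_continuous; apply/derivable1_diffP; have [] := Kd z zab.
rewrite in_itv /= => /andP[c1 c2] ->.
have -> : k c * (y - x) - (y - x) * k t = (k c - k t) * (y - x) by ring.
rewrite normrM (gtr0_norm (x := y - x)) ?subr_gt0 // ler_wpM2r ?subr_ge0 ?(ltW xy) //.
apply: h; [by apply: sub; rewrite !ltW|by apply: sub; rewrite x2|].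
by rewrite ltr_norml; lra.
Qed.

Lemma normc_le (x y : R) : normc (x +i* y) <= `|x| + `|y|.
Proof.
have -> : x +i* y = x%:C + 'i * y%:C by rewrite [LHS]complexE.
rewrite (le_trans (normcD _ _)) // normcM !normcR.
suff -> : normc ('i : R[i]) = 1 by rewrite mul1r.
by rewrite /normc /= expr0n /= add0r expr1n sqrtr1.
Qed.

Lemma uprim_complex (K k L l : R -> R) a b : uprimR K k a b -> uprimR L l a b ->
  uprim (fun t => (K t +i* L t : R[i]^o)) (fun t => k t +i* l t) a b.
Proof.
move=> P Q e e0; have e2 : 0 < e / 2 by rewrite divr_gt0.
have [d d0 h] := P _ e2; have [d' d0' h'] := Q _ e2.
exists (Num.min d d'); first by rewrite lt_min d0.
move=> x t y x1 x2 x3 x4; rewrite lt_min => /andP[x5 x6].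
have -> : (K y +i* L y : R[i]^o) - (K x +i* L x) - (y - x)%:C *: (k t +i* l t) =
  (K y - K x - (y - x) * k t) +i* (L y - L x - (y - x) * l t).
  by apply/eqP; rewrite eq_complex /= !mul0r subr0 addr0 !eqxx.
rewrite normcE (le_trans (normc_le _ _)) //.
have := h x t y x1 x2 x3 x4 x5; have := h' x t y x1 x2 x3 x4 x6; lra.
Qed.

End Continuity.

Section SegmentIntegral.
Variables (R : realType) (V : completeNormedModType R[i]).
Implicit Types (g : R -> V) (a b c : R).

Definition intg g a b : V := xget 0 [set J | exists2 G, uprim G g a b & J = G b - G a].

Lemma intgE G g a b : a <= b -> uprim G g a b -> intg g a b = G b - G a.
Proof.
move=> ab P; rewrite /intg; case: xgetP => [J _ [G' P' ->]|/(_ (G b - G a)) []].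
  exact: uprim_unique ab P' P.
by exists G.
Qed.

Lemma cont_uprim g a b : a <= b -> (forall t, a <= t <= b -> cont_at g t) ->
  exists G, uprim G g a b.
Proof. by move=> ab gc; apply: uprim_exists => //; exact: cont_ucont. Qed.

Lemma intg_chasles g a b c : a <= b -> b <= c -> (forall t, a <= t <= c -> cont_at g t) ->
  intg g a c = intg g a b + intg g b c.
Proof.
move=> ab bc gc; have [G P] := cont_uprim (le_trans ab bc) gc.
rewrite (intgE (le_trans ab bc) P) (intgE ab (uprim_sub (lexx _) bc P)).
by rewrite (intgE bc (uprim_sub ab (lexx _) P)); vring.
Qed.

Lemma intg_le g (C : R) a b : a <= b -> (forall t, a <= t <= b -> cont_at g t) ->
  (forall t, a <= t <= b -> nrm (g t) <= C) -> nrm (intg g a b) <= C * (b - a).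
Proof.
move=> ab gc gC; have [G P] := cont_uprim ab gc.
by rewrite (intgE ab P); apply: uprim_const_le gC.
Qed.

End SegmentIntegral.

(** * Improper integrals over the half-line *)

Section Improper.
Variable R : realType.

(** Improper integrals through a primitive that vanishes at the origin. *)
Definition iint (V : normedModType R[i]) (g : R -> V) (I : V) : Prop :=
  exists G : R -> V, [/\ forall a b, 0 < a -> uprim G g a b,
    forall e, 0 < e -> exists2 d : R, 0 < d & forall t, 0 < t <= d -> nrm (G t) <= e &
    forall e, 0 < e -> exists2 d : R, 0 < d & forall t, d <= t -> nrm (G t - I) <= e].

Section Theory.
Variable V : normedModType R[i].
Implicit Types (g : R -> V) (I J : V).

Lemma iint_Riemann g I : iint g I -> is_integral_0oo g I.
Proof.
move=> [G [P G0 Goo]] e e0; have e3 : 0 < e / 3 by rewrite divr_gt0.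
have [d d0 h] := G0 _ e3; have [d' d0' h'] := Goo _ e3.
exists (Num.min d d'), d'; split; first by rewrite lt_min d0 d0' /= ge_min lexx orbT.
move=> r s; rewrite le_min => /andP[r0 /andP[rd rd']] ds.
exists (G s - G r); first by apply: uprim_Riemann; [exact: le_trans ds|exact: P].
rewrite normE ltcR; have := h' s ds; have := h r; rewrite r0 rd => /(_ isT) h1 h2.
have -> : G s - G r - I = (G s - I) - G r by vring.
by apply: (le_lt_trans (nrmDB _ _)); lra.
Qed.

Lemma is_integral_0oo_unique g I J : is_integral_0oo g I -> is_integral_0oo g J -> I = J.
Proof.
move=> P Q; apply/eqP; rewrite -subr_eq0; apply/eqP; apply: nrm_small => e e0.
have e2 : 0 < e / 2 by rewrite divr_gt0.
have [r [s [/andP[r0 rs] h]]] := P _ e2; have [r' [s' [/andP[r0' rs'] h']]] := Q _ e2.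
have m0 : 0 < Num.min r r' by rewrite lt_min r0.
have [||A A1 A2] := h (Num.min r r') (Num.max s s').
- by rewrite m0 ge_min lexx.
- by rewrite le_max lexx.
have [||B B1 B2] := h' (Num.min r r') (Num.max s s').
- by rewrite m0 ge_min lexx orbT.
- by rewrite le_max lexx orbT.
have AB : A = B.
  by apply: Riemann_unique A1 B1; rewrite ge_min le_max rs.
move: A2 B2; rewrite -AB !normE !ltcR => A2 B2.
by apply: (le_trans (nrm_tri _ A _)); rewrite (nrmB I A); lra.
Qed.

Lemma iintE g I : iint g I -> integral_0oo g = I.
Proof.
move=> /iint_Riemann P; rewrite /integral_0oo; case: xgetP => [J _ Q|/(_ I) []] //.
exact: is_integral_0oo_unique Q P.
Qed.

Lemma iint_ext g g' I : (forall t, 0 < t -> g t = g' t) -> iint g I -> iint g' I.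
Proof.
move=> gg [G [P G0 Goo]]; exists G; split => // a b a0.
apply: uprim_ext (P a b a0) => t /andP[at_ _]; apply: gg; exact: lt_le_trans at_.
Qed.

Lemma iint_map (W : normedModType R[i]) (T : V -> W) (C : R) g I :
  linear T -> (forall x, nrm (T x) <= C * nrm x) -> iint g I ->
  iint (fun t => T (g t)) (T I).
Proof.
move=> TL TC [G [P G0 Goo]]; exists (fun t => T (G t)).
have C1 : 0 < `|C| + 1 by rewrite ltr_wpDl.
have TC' x e : nrm x <= e / (`|C| + 1) -> nrm (T x) <= e.
  move=> xe; apply: (le_trans (TC x)); apply: (@le_trans _ _ ((`|C| + 1) * nrm x)).
    by rewrite ler_wpM2r ?nrm_ge0 // (le_trans (ler_norm C)) // lerDl.
  by rewrite mulrC -ler_pdivlMr.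
have TB u v : T (u - v) = T u - T v.
  by rewrite [u - v]addrC -scaleN1r TL scaleN1r addrC.
split=> [a b a0|e e0|e e0]; first exact: uprim_map TL TC (P a b a0).
  have [d d0 h] := G0 _ (divr_gt0 e0 C1); exists d => // t /h; exact: TC'.
by have [d d0 h] := Goo _ (divr_gt0 e0 C1); exists d => // t /h; rewrite -TB; exact: TC'.
Qed.

Lemma iintD g g' I J : iint g I -> iint g' J -> iint (fun t => g t + g' t) (I + J).
Proof.
move=> [G [P G0 Goo]] [G' [P' G0' Goo']]; exists (fun t => G t + G' t).
split=> [a b a0|e e0|e e0]; first by apply: uprimD; [exact: P|exact: P'].
  have e2 : 0 < e / 2 by rewrite divr_gt0.
  have [d d0 h] := G0 _ e2; have [d' d0' h'] := G0' _ e2.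
  exists (Num.min d d'); first by rewrite lt_min d0.
  move=> t; rewrite le_min => /andP[t0 /andP[t1 t2]].
  have := h t; have := h' t; rewrite t0 t1 t2 => /(_ isT) k1 /(_ isT) k2.
  by apply: (le_trans (nrmD _ _)); lra.
have e2 : 0 < e / 2 by rewrite divr_gt0.
have [d d0 h] := Goo _ e2; have [d' d0' h'] := Goo' _ e2.
exists (Num.max d d'); first by rewrite lt_max d0.
move=> t; rewrite ge_max => /andP[/h k1 /h' k2].
have -> : G t + G' t - (I + J) = (G t - I) + (G' t - J) by vring.
by apply: (le_trans (nrmD _ _)); lra.
Qed.

Lemma iintZ (k : R[i]) g I : iint g I -> iint (fun t => k *: g t) (k *: I).
Proof.
apply: (@iint_map _ (fun x => k *: x) (normc k)) => [c x y|x]; last by rewrite nrmZ.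
by vring.
Qed.

Lemma iintB g g' I J : iint g I -> iint g' J -> iint (fun t => g t - g' t) (I - J).
Proof.
move=> P /(iintZ (-1)) Q; have := iintD P Q; rewrite scaleN1r.
by apply: iint_ext => t _; rewrite scaleN1r.
Qed.

End Theory.

(** The decay in the definition of the class of admissible functions. *)
Definition weight (s t : R) : R := Num.min (t `^ s) (t `^ (- s)).

Lemma weight_ge0 s t : 0 <= weight s t.
Proof. by rewrite le_min !powR_ge0. Qed.

Lemma uprimR_powR (s a b : R) : s != 0 -> 0 < a ->
  uprimR (fun t => s^-1 * t `^ s) (fun t => t `^ s / t) a b.
Proof.
move=> s0 a0; apply: uprimR_derive => t /andP[at_ _]; have t0 := lt_le_trans a0 at_.
  have D : is_derive t 1 (@powR R ^~ s) (s * t `^ (s - 1)) := is_derive1_powR s t0.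
  apply: is_derive_eq; rewrite /GRing.scale /= mulrA mulVf // mul1r.
  by rewrite powRB ?(gt_eqF t0) ?implybT // powRr1 // ltW.
have D : is_derive t 1 (@powR R ^~ s) (s * t `^ (s - 1)) := is_derive1_powR s t0.
have [D1 _] := D.
have c1 : {for t, continuous (fun x : R => x `^ s)}.
  by apply: differentiable_continuous; apply/derivable1_diffP.
have c2 : {for t, continuous (fun x : R => x^-1)} by apply: inv_continuous; rewrite gt_eqF.
by apply: cvgM; [exact: c1|exact: c2].
Qed.

Lemma powR_small (s e : R) : 0 < s -> 0 < e ->
  exists2 d : R, 0 < d & forall t, 0 <= t <= d -> t `^ s <= e.
Proof.
move=> s0 e0; exists (e `^ s^-1); first by rewrite powR_gt0.
move=> t /andP[t0 td].
have -> : e = (e `^ s^-1) `^ s by rewrite -powRrM mulVf ?gt_eqF // powRr1 // ltW.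
by apply: ge0_ler_powR; rewrite ?nnegrE ?powR_ge0 // ltW.
Qed.

Lemma powRN_inv (s t : R) : 0 < t -> t `^ (- s) = t^-1 `^ s.
Proof. by move=> t0; rewrite -powR_inv1 ?(ltW t0) // -powRrM mulN1r. Qed.

Lemma iint_exists (V : completeNormedModType R[i]) (g : R -> V) (C s : R) :
  0 <= C -> 0 < s -> (forall t, 0 < t -> cont_at g t) ->
  (forall t, 0 < t -> nrm (g t) <= C * weight s t / t) ->
  exists2 I, iint g I & nrm I <= 2 * C / s.
Proof.
move=> C0 s0 gc gb.
(* primitives on the intervals [1/(n+1), n+1], all vanishing at 1, agree *)
have ex (n : nat) : exists G, uprim G g n.+1%:R^-1 n.+1%:R /\ G 1 = 0.
  have [||G P] := @cont_uprim _ _ g n.+1%:R^-1 n.+1%:R.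
  - by rewrite (@le_trans _ _ 1) ?invf_le1 ?ler1n.
  - by move=> t /andP[t1 _]; apply: gc; apply: lt_le_trans t1; rewrite invr_gt0.
  exists (fun t => G t - G 1); rewrite subrr; split=> // e /P[d d0 h]; exists d => // x t y *.
  have -> : G y - G 1 - (G x - G 1) = G y - G x by vring.
  exact: h.
have [Gn /all_and2[Gn1 Gn2]] := choice ex.
pose J (n : nat) (x : R) := n.+1%:R^-1 <= x <= n.+1%:R.
have J1 n : J n 1 by rewrite /J invf_le1 ?ler1n.
have agree n m x : J n x -> J m x -> Gn n x = Gn m x.
  move=> /andP[n1 n2] /andP[m1 m2].
  have /andP[n3 n4] := J1 n; have /andP[m3 m4] := J1 m.
  have [x1|x1] := leP x 1.
    have := uprim_unique x1 (uprim_sub n1 n4 (Gn1 n)) (uprim_sub m1 m4 (Gn1 m)).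
    by rewrite !Gn2 !sub0r => /oppr_inj.
  have := uprim_unique (ltW x1) (uprim_sub n3 n2 (Gn1 n)) (uprim_sub m3 m2 (Gn1 m)).
  by rewrite !Gn2 !subr0.
pose N (x : R) := Num.bound (x + x^-1).
have NJ n x y : 0 < y -> y <= x -> (N y <= n)%N -> (N x <= n)%N -> J n x.
  move=> y0 yx Ny Nx; have x0 := lt_le_trans y0 yx.
  have hx : x + x^-1 < n.+1%:R.
    apply: (@lt_trans _ _ (N x)%:R); last by rewrite ltr_nat ltnS.
    by apply: archi_boundP; rewrite addr_ge0 ?invr_ge0 ?ltW.
  have xi : 0 < x^-1 by rewrite invr_gt0.
  apply/andP; split; last by lra.
  by rewrite -[leRHS]invrK lef_pV2 ?posrE ?invr_gt0 //; lra.
pose G x := Gn (N x) x.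
have P a b : 0 < a -> uprim G g a b.
  move=> a0 e e0; have [ba|ab] := ltP b a.
    by exists 1 => // x t y x1 x2 x3 x4; exfalso; lra.
  pose n := maxn (N a) (N b).
  have Ja : J n a by apply: (NJ n a a) (leq_maxl _ _) (leq_maxl _ _).
  have Jb : J n b by apply: (NJ n b a) (leq_maxl _ _) (leq_maxr _ _).
  have /andP[Ja1 _] := Ja; have /andP[_ Jb2] := Jb.
  have [d d0 h] := uprim_sub Ja1 Jb2 (Gn1 n) e0; exists d => // x t y x1 x2 x3 x4 x5.
  have xy := le_trans x2 x3.
  have GJ z : a <= z -> z <= b -> G z = Gn n z.
    move=> az zb; apply: agree; first by apply: (NJ _ z z) => //; exact: lt_le_trans az.
    by rewrite /J (le_trans Ja1) // (le_trans zb).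
  have -> : G y = Gn n y by apply: GJ; first exact: le_trans x1 xy.
  have -> : G x = Gn n x by apply: GJ; last exact: le_trans xy x4.
  exact: h.
have B1 a b : 0 < a -> a <= b -> nrm (G b - G a) <= C / s * b `^ s.
  move=> a0 ab.
  have Q : uprimR (fun t => C * (s^-1 * t `^ s)) (fun t => C * (t `^ s / t)) a b.
    move=> e e0; have C1 : 0 < C + 1 by rewrite ltr_wpDl.
    have [d d0 h] := @uprimR_powR s a b (lt0r_neq0 s0) a0 _ (divr_gt0 e0 C1).
    exists d => // x t y x1 x2 x3 x4 x5; have := h x t y x1 x2 x3 x4 x5.
    set A := _ - _ - _ => hA.
    have -> : C * (s^-1 * y `^ s) - C * (s^-1 * x `^ s) - (y - x) * (C * (t `^ s / t)) = C * A.
      by rewrite /A; ring.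
    rewrite normrM ger0_norm //; apply: (@le_trans _ _ ((C + 1) * `|A|)).
      by rewrite ler_wpM2r // lerDl.
    by rewrite mulrC -ler_pdivlMr // mulrAC.
  have := uprim_le ab (P a b a0) Q; set q := nrm _ => h.
  apply: (@le_trans _ _ (C * (s^-1 * b `^ s) - C * (s^-1 * a `^ s))).
    apply: h => t /andP[t1 _]; have t0 := lt_le_trans a0 t1.
    by rewrite (le_trans (gb t t0)) // mulrA ler_pdivrMr // divfK ?gt_eqF //
      ler_wpM2l // ge_min lexx.
  by rewrite mulrA lerBlDr lerDl !mulr_ge0 ?invr_ge0 ?powR_ge0 // ltW.
have B2 a b : 0 < a -> a <= b -> nrm (G b - G a) <= C / s * a `^ (- s).
  move=> a0 ab.
  have Q : uprimR (fun t => C * ((- s)^-1 * t `^ (- s))) (fun t => C * (t `^ (- s) / t)) a b.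
    move=> e e0; have C1 : 0 < C + 1 by rewrite ltr_wpDl.
    have sN : - s != 0 by rewrite oppr_eq0 gt_eqF.
    have [d d0 h] := @uprimR_powR (- s) a b sN a0 _ (divr_gt0 e0 C1).
    exists d => // x t y x1 x2 x3 x4 x5; have := h x t y x1 x2 x3 x4 x5.
    set A := _ - _ - _ => hA.
    have -> : C * ((- s)^-1 * y `^ (- s)) - C * ((- s)^-1 * x `^ (- s)) -
      (y - x) * (C * (t `^ (- s) / t)) = C * A by rewrite /A; ring.
    rewrite normrM ger0_norm //; apply: (@le_trans _ _ ((C + 1) * `|A|)).
      by rewrite ler_wpM2r // lerDl.
    by rewrite mulrC -ler_pdivlMr // mulrAC.
  have := uprim_le ab (P a b a0) Q; set q := nrm _ => h.
  apply: (@le_trans _ _ (C * ((- s)^-1 * b `^ (- s)) - C * ((- s)^-1 * a `^ (- s)))).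
    apply: h => t /andP[t1 _]; have t0 := lt_le_trans a0 t1.
    by rewrite (le_trans (gb t t0)) // mulrA ler_pdivrMr // divfK ?gt_eqF //
      ler_wpM2l // ge_min lexx orbT.
  rewrite invrN !mulNr !mulrN opprK addrC mulrA lerBlDr lerDl.
  by rewrite !mulr_ge0 ?invr_ge0 ?powR_ge0 // ltW.
have D0 : 0 <= C / s by rewrite divr_ge0 // ltW.
have D1 : 0 < C / s + 1 by rewrite ltr_wpDl.
have small e : 0 < e -> exists2 d : R, 0 < d & forall t, 0 < t <= d -> C / s * t `^ s <= e.
  move=> e0; have [d d0 h] := powR_small s0 (divr_gt0 e0 D1); exists d => // t /andP[t0 td].
  apply: (@le_trans _ _ ((C / s + 1) * t `^ s)); first by rewrite ler_wpM2r ?powR_ge0 // lerDl.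
  by rewrite mulrC -ler_pdivlMr // h // ltW.
have large e : 0 < e -> exists2 d : R, 0 < d & forall t, d <= t -> C / s * t `^ (- s) <= e.
  move=> /small[d d0 h]; exists d^-1; first by rewrite invr_gt0.
  move=> t dt; have t0 : 0 < t by apply: lt_le_trans dt; rewrite invr_gt0.
  rewrite powRN_inv //; apply: h; rewrite invr_gt0 t0 /=.
  by rewrite -[leRHS]invrK lef_pV2 ?posrE ?invr_gt0.
have natb (d : R) : exists M : nat, forall n, (M <= n)%N -> d <= n.+1%:R.
  exists (Num.bound `|d|) => n Mn; apply: (le_trans (ler_norm d)).
  apply: (@le_trans _ _ (Num.bound `|d|)%:R); first by rewrite ltW // archi_boundP.
  by rewrite ler_nat (leq_trans Mn).
have Goo a b e d : 0 < d -> (forall t, d <= t -> C / s * t `^ (- s) <= e) ->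
    d <= a -> d <= b -> nrm (G a - G b) <= e.
  move=> d0 h da db; have [ab|ba] := leP a b.
    by rewrite nrmB (le_trans (B2 a b _ ab)) ?h // (lt_le_trans d0).
  by rewrite (le_trans (B2 b a _ (ltW ba))) ?h // (lt_le_trans d0).
have G00 a b e d : (forall t, 0 < t <= d -> C / s * t `^ s <= e) ->
    0 < a <= d -> 0 < b <= d -> nrm (G a - G b) <= e.
  move=> h ad bd; have /andP[a0 _] := ad; have /andP[b0 _] := bd.
  have [ab|ba] := leP a b.
    by rewrite nrmB (le_trans (B1 a b a0 ab)) ?h.
  by rewrite (le_trans (B1 b a b0 (ltW ba))) ?h.
have [l1 L1] : exists l, lim_to (fun n => G n.+1%:R) l.
  apply: cauchy_lim_to => e /large[d d0 h]; have [M hM] := natb d.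
  by exists M => n m /hM n1 /hM m1; exact: Goo h n1 m1.
have [l0 L0] : exists l, lim_to (fun n => G n.+1%:R^-1) l.
  apply: cauchy_lim_to => e /small[d d0 h]; have [M hM] := natb d^-1.
  have q n : (M <= n)%N -> 0 < n.+1%:R^-1 :> R /\ n.+1%:R^-1 <= d.
    move=> /hM n1; split; first by rewrite invr_gt0.
    by rewrite -[leRHS]invrK lef_pV2 ?posrE ?invr_gt0.
  by exists M => n m /q[n1 n2] /q[m1 m2]; apply: G00 h _ _; rewrite ?n1 ?m1.
exists (l1 - l0).
  exists (fun t => G t - l0); split.
  - move=> a b a0 e /(P a b a0)[d d0 h]; exists d => // x t y *.
    have -> : G y - l0 - (G x - l0) = G y - G x by vring.
    exact: h.
  - move=> e e0; have [d d0 h] := small _ e0; exists d => // t td.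
    have [M hM] := natb d^-1.
    have := lim_toB (lim_to_cst (G t)) (fun e e0 => L0 e e0).
    move=> L; apply: (@lim_to_le _ _ (fun n => G t - G (n + M).+1%:R^-1)).
      move=> e' /L[N' hN']; exists N' => n Nn.
      by apply: hN'; rewrite (leq_trans Nn) ?leq_addr.
    move=> n; apply: G00 h td _; rewrite invr_gt0 ltr0n /=.
    by rewrite -[leRHS]invrK lef_pV2 ?posrE ?invr_gt0 // hM // leq_addl.
  - move=> e e0; have [d d0 h] := large _ e0; exists d => // t td.
    have [M hM] := natb d.
    have -> : G t - l0 - (l1 - l0) = G t - l1 by vring.
    have L := lim_toB (lim_to_cst (G t)) L1.
    apply: (@lim_to_le _ _ (fun n => G t - G (n + M).+1%:R)).
      move=> e' /L[N' hN']; exists N' => n Nn.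
      by apply: hN'; rewrite (leq_trans Nn) ?leq_addr.
    by move=> n; apply: Goo h td _ => //; rewrite hM // leq_addl.
have -> : 2 * C / s = C / s + C / s by ring.
apply: (lim_to_le (lim_toB L1 L0)) => n.
apply: (le_trans (nrm_tri _ (G 1) _)); apply: lerD.
  have := B2 1 n.+1%:R ltr01; rewrite powR1 mulr1; apply.
  by rewrite ler1n.
have := B1 n.+1%:R^-1 1; rewrite powR1 mulr1; apply; first by rewrite invr_gt0.
by rewrite invf_le1 // ler1n.
Qed.

End Improper.

(** * Cauchy's theorem in polar coordinates *)

Section ComplexDerivative.
Variable R : realType.

(** Complex differentiability as a first-order estimate, in the form in which
    Goursat's argument consumes it. *)
Definition cdiff (V : normedModType R[i]) (G : R[i] -> V) (z : R[i]) : Prop :=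
  exists d : V, forall e : R, 0 < e -> exists2 r : R, 0 < r & forall w, normc (w - z) < r ->
    nrm (G w - G z - (w - z) *: d) <= e * normc (w - z).

Definition ccont (V : normedModType R[i]) (G : R[i] -> V) (z : R[i]) : Prop :=
  forall e : R, 0 < e -> exists2 r : R, 0 < r & forall w, normc (w - z) < r ->
    nrm (G w - G z) <= e.

Lemma cdiff_ccont (V : normedModType R[i]) (G : R[i] -> V) z : cdiff G z -> ccont G z.
Proof.
move=> [d h] e e0; have [r r0 hr] := h _ ltr01.
have c0 : 0 < 1 + nrm d by rewrite ltr_pwDl // nrm_ge0.
exists (Num.min r (e / (1 + nrm d))); first by rewrite lt_min r0 divr_gt0.
move=> w; rewrite lt_min => /andP[w1]; rewrite ltr_pdivlMr // => w2.
have -> : G w - G z = (G w - G z - (w - z) *: d) + (w - z) *: d by rewrite subrK.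
apply: (le_trans (nrmD _ _)); rewrite nrmZ; have := hr w w1; lra.
Qed.

(** Curves with a Lipschitz derivative [c'], quantitatively. *)
Definition curve (c c' : R -> R[i]) (L : R) : Prop :=
  [/\ forall x t y, x <= t -> t <= y ->
        normc (c y - c x - (y - x)%:C * c' t) <= L * (y - x) ^+ 2,
      forall x y, x <= y -> normc (c y - c x) <= L * (y - x),
      forall t, normc (c' t) <= L &
      forall t, cont_at (c' : R -> R[i]^o) t].

Lemma cont_atZ (V : normedModType R[i]) (f : R -> R[i]^o) (g : R -> V) t :
  cont_at f t -> cont_at g t -> cont_at (fun x => f x *: g x) t.
Proof.
move=> fc gc e e0; set F := nrm (f t); set K := nrm (g t).
have F0 : 0 <= F by exact: nrm_ge0.
have K0 : 0 <= K by exact: nrm_ge0.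
pose q := Num.min 1 (e / (1 + F + K)).
have D0 : 0 < 1 + F + K by rewrite -addrA ltr_pwDl // addr_ge0.
have q0 : 0 < q by rewrite lt_min ltr01 divr_gt0.
have [d d0 h] := fc _ q0; have [d' d0' h'] := gc _ q0.
exists (Num.min d d'); first by rewrite lt_min d0.
move=> x; rewrite lt_min => /andP[/h k1 /h' k2].
have -> : f x *: g x - f t *: g t =
  (f x - f t) *: (g x - g t) + ((f x - f t) *: g t + f t *: (g x - g t)) by vring.
have q1 : q <= 1 by rewrite ge_min lexx.
have q2 : q * (1 + F + K) <= e by rewrite -ler_pdivlMr // ge_min lexx orbT.
move: k1 k2; set A := nrm _; set B := nrm _ => k1 k2.
have A0 : 0 <= A by exact: nrm_ge0.
have B0 : 0 <= B by exact: nrm_ge0.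
apply: (@le_trans _ _ (A * B + (A * K + F * B))); last by nra.
apply: (le_trans (nrmD _ _)); apply: lerD; first by rewrite nrmZ.
by apply: (le_trans (nrmD _ _)); rewrite !nrmZ.
Qed.

Lemma cont_at_comp (V : normedModType R[i]) (G : R[i] -> V) (c c' : R -> R[i]) L t :
  curve c c' L -> ccont G (c t) -> cont_at (fun x => G (c x)) t.
Proof.
move=> [_ cl _ _] gc e /gc[r r0 h].
have L1 : 0 < `|L| + 1 by rewrite ltr_wpDl.
exists (r / (`|L| + 1)); first by rewrite divr_gt0.
move=> x; rewrite ltr_pdivlMr // => xt; apply: h; apply: le_lt_trans xt.
have LL y : 0 <= y -> L * y <= y * (`|L| + 1).
  move=> y0; rewrite mulrDr mulr1 mulrC; have := ler_norm L; nra.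
have [tx|xt] := leP t x.
  by rewrite ger0_norm ?subr_ge0 // (le_trans (cl _ _ tx)) // LL // subr_ge0.
rewrite ltr0_norm ?subr_lt0 // opprB normcB (le_trans (cl _ _ (ltW xt))) // LL //.
by rewrite subr_ge0 ltW.
Qed.

Section Lines.
Variables (V : completeNormedModType R[i]) (G : R[i] -> V).

Lemma cont_at_line (c c' : R -> R[i]) L t : curve c c' L -> ccont G (c t) ->
  cont_at (fun x => c' x *: G (c x)) t.
Proof.
move=> cc gc; have [_ _ _ c'c] := cc.
by apply: (@cont_atZ _ (c' : R -> R[i]^o)); [exact: c'c|exact: cont_at_comp cc gc].
Qed.

Definition lint (c c' : R -> R[i]) (a b : R) : V := intg (fun t => c' t *: G (c t)) a b.

(** A primitive of the affine function [fun z => g0 + (z - p) *: d]. *)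
Definition affine_prim (p : R[i]) (g0 d : V) (z : R[i]) : V :=
  (z - p) *: g0 + ((z - p) ^+ 2 / 2) *: d.

(** The integral of [G] along a curve differs from the increment of a primitive
    of an affine function by the integral of the remainder. *)
Lemma lint_affine (c c' : R -> R[i]) (L a b m : R) (p : R[i]) (g0 d : V) :
  curve c c' L -> 0 <= L -> a <= b ->
  (forall t, a <= t <= b -> ccont G (c t)) ->
  (forall t, a <= t <= b -> nrm (G (c t) - (g0 + (c t - p) *: d)) <= m) ->
  nrm (lint c c' a b - (affine_prim p g0 d (c b) - affine_prim p g0 d (c a))) <=
    L * m * (b - a).
Proof.
set P := affine_prim p g0 d.
move=> cc L0 ab Gc Gm; have [c1 c2 c3 _] := cc.
pose B := normc (c a - p) + L * (b - a).
have cB t : a <= t <= b -> normc (c t - p) <= B.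
  move=> /andP[t1 t2]; have -> : c t - p = (c a - p) + (c t - c a) by ring.
  apply: (le_trans (normcD _ _)); apply: lerD => //; apply: (le_trans (c2 _ _ t1)).
  by rewrite ler_wpM2l // lerD2r.
have n2 : normc (2^-1 : R[i]) = 2^-1.
  by rewrite normcV -(ger0_norm (x := 2 : R)) // -normcR rmorph_nat.
pose K := L * (nrm g0 + B * nrm d) + L * L * nrm d.
have B0 : 0 <= B by rewrite addr_ge0 ?normc_ge0 // mulr_ge0 // subr_ge0.
have K0 : 0 <= K by rewrite addr_ge0 ?mulr_ge0 ?addr_ge0 ?mulr_ge0 ?nrm_ge0.
have UP : uprim (fun t => P (c t)) (fun t => c' t *: (g0 + (c t - p) *: d)) a b.
  move=> e e0; have K1 : 0 < K + 1 by rewrite ltr_wpDl.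
  exists (e / (K + 1)); first by rewrite divr_gt0.
  move=> x t y x1 x2 x3 x4; rewrite ltr_pdivlMr // => x5; have xy := le_trans x2 x3.
  have -> : P (c y) - P (c x) - (y - x)%:C *: (c' t *: (g0 + (c t - p) *: d)) =
    (c y - c x - (y - x)%:C * c' t) *: (g0 + (((c y - p) + (c x - p)) * 2^-1) *: d) +
    ((y - x)%:C * c' t * (((c y - p) + (c x - p)) * 2^-1 - (c t - p))) *: d.
    by rewrite /P /affine_prim; vring.
  have -> : ((c y - p) + (c x - p)) * 2^-1 - (c t - p) =
    ((c y - c t) - (c t - c x)) * 2^-1 by field.
  have yx0 : 0 <= y - x by rewrite subr_ge0.
  apply: (@le_trans _ _ (K * (y - x) ^+ 2)); last first.
    have : (y - x) * (y - x) * (K + 1) <= (y - x) * e.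
      by rewrite -mulrA ler_wpM2l // ltW.
    have : 0 <= (y - x) * (y - x) by rewrite mulr_ge0.
    rewrite expr2; lra.
  rewrite /K [leRHS]mulrDl; apply: (le_trans (nrmD _ _)); apply: lerD; rewrite nrmZ.
    rewrite mulrAC; apply: ler_pM; rewrite ?normc_ge0 ?nrm_ge0 //; first exact: c1.
    apply: (le_trans (nrmD _ _)); rewrite lerD2l nrmZ ler_wpM2r ?nrm_ge0 //.
    rewrite normcM n2; have := normcD (c y - p) (c x - p).
    have := cB y; have := cB x.
    rewrite x1 (le_trans x1 xy) x4 (le_trans xy x4) => /(_ isT) h1 /(_ isT) h2; lra.
  rewrite [leRHS]mulrAC ler_wpM2r ?nrm_ge0 // !normcM normcR ger0_norm // n2.
  have -> : L * L * (y - x) ^+ 2 = (y - x) * L * (L * (y - x)) by ring.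
  apply: ler_pM; rewrite ?mulr_ge0 ?normc_ge0 //; first by rewrite ler_wpM2l.
  have := normcDB (c y - c t) (c t - c x); have := c2 _ _ x2; have := c2 _ _ x3.
  have : 0 <= L * (y - x) by rewrite mulr_ge0.
  lra.
have [G' PG] := cont_uprim ab (fun t tab => cont_at_line cc (Gc t tab)).
rewrite /lint (intgE ab PG).
have -> : G' b - G' a - (P (c b) - P (c a)) = (G' b - P (c b)) - (G' a - P (c a)) by vring.
apply: (uprim_const_le ab (uprimB PG UP)) => t tab; rewrite -scalerBr nrmZ.
by apply: ler_pM; rewrite ?normc_ge0 ?nrm_ge0 // Gm.
Qed.

End Lines.

Lemma normc_cis (t : R) : normc (cis t) = 1.
Proof. by rewrite /normc /= cos2Dsin2 sqrtr1. Qed.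

(** First-order Taylor bounds: they make circular arcs curves in the sense of [curve]. *)
Lemma sin_cos_diff (x y : R) : x <= y ->
  [/\ `|sin y - sin x| <= y - x, `|cos y - cos x| <= y - x &
   forall t, x <= t -> t <= y -> `|sin y - sin x - (y - x) * cos t| <= (y - x) ^+ 2 /\
     `|cos y - cos x + (y - x) * sin t| <= (y - x) ^+ 2].
Proof.
have lip (a b : R) : a <= b -> `|sin b - sin a| <= b - a /\ `|cos b - cos a| <= b - a.
  move=> ab; split.
    have [|c _ ->] := @MVT_segment R sin cos a b ab.
      by apply: continuous_subspaceT => z; exact: continuous_sin.
    rewrite normrM (ger0_norm (x := b - a)) ?subr_ge0 // ler_piMl ?subr_ge0 //.
    by rewrite ler_norml cos_geN1 cos_le1.
  have [|c _ ->] := @MVT_segment R cos (fun z => - sin z) a b ab.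
    by apply: continuous_subspaceT => z; exact: continuous_cos.
  rewrite normrM normrN (ger0_norm (x := b - a)) ?subr_ge0 // ler_piMl ?subr_ge0 //.
  by rewrite ler_norml sin_geN1 sin_le1.
have lip2 (a b : R) : `|sin b - sin a| <= `|b - a| /\ `|cos b - cos a| <= `|b - a|.
  have [ab|/ltW ba] := leP a b; first by rewrite (ger0_norm (x := b - a)) ?subr_ge0 //; exact: lip.
  rewrite (distrC (sin b)) (distrC (cos b)) (distrC b).
  by rewrite (ger0_norm (x := a - b)) ?subr_ge0 //; exact: lip.
move=> xy; have [l1 l2] := lip _ _ xy; split => // t xt ty.
have yx0 : 0 <= y - x by rewrite subr_ge0.
split.
  have [|c] := @MVT_segment R sin cos x y xy.
    by apply: continuous_subspaceT => z; exact: continuous_sin.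
  rewrite in_itv /= => /andP[c1 c2] ->.
  have -> : cos c * (y - x) - (y - x) * cos t = (cos c - cos t) * (y - x) by ring.
  rewrite normrM (ger0_norm (x := y - x)) // expr2 ler_wpM2r //.
  have [_ h] := lip2 t c; apply: (le_trans h); rewrite ler_norml; lra.
have [|c] := @MVT_segment R cos (fun z => - sin z) x y xy.
  by apply: continuous_subspaceT => z; exact: continuous_cos.
rewrite in_itv /= => /andP[c1 c2] ->.
have -> : - sin c * (y - x) + (y - x) * sin t = - (sin c - sin t) * (y - x) by ring.
rewrite normrM normrN (ger0_norm (x := y - x)) // expr2 ler_wpM2r //.
have [h _] := lip2 t c; apply: (le_trans h); rewrite ler_norml; lra.
Qed.

Lemma curve_ray (u : R[i]) : normc u <= 1 -> curve (fun t => t%:C * u) (fun _ => u) 1.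
Proof.
move=> u1; split => //.
- move=> x t y xt ty; have -> : y%:C * u - x%:C * u - (y - x)%:C * u = 0 by ring.
  by rewrite normc0 mul1r sqr_ge0.
- move=> x y xy; have -> : y%:C * u - x%:C * u = (y - x)%:C * u by ring.
  by rewrite normcM normcR ger0_norm ?subr_ge0 // mulrC ler_wpM2r // subr_ge0.
- by move=> t e e0; exists 1 => // t' _; rewrite subrr nrm0 ltW.
Qed.

Lemma curve_arc (r : R) : 0 <= r ->
  curve (fun t => r%:C * cis t) (fun t => r%:C * ('i * cis t)) (2 * r).
Proof.
move=> r0.
have rr (z : R[i]) k : normc z <= 2 * k -> normc (r%:C * z) <= 2 * r * k.
  move=> zk; rewrite normcM normcR ger0_norm //.
  have -> : 2 * r * k = r * (2 * k) by ring.
  by rewrite ler_wpM2l.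
have lip x y : x <= y -> normc (r%:C * cis y - r%:C * cis x) <= 2 * r * (y - x).
  move=> xy; have -> : r%:C * cis y - r%:C * cis x = r%:C * (cis y - cis x) by ring.
  have [l1 l2 _] := sin_cos_diff xy; apply: rr.
  by apply: (le_trans (normc_le _ _)) => /=; lra.
have iE (z : R[i]) : normc ('i * z) = normc z.
  by rewrite normcM /normc /= expr0n /= add0r expr1n sqrtr1 mul1r.
split => //.
- move=> x t y xt ty; have xy := le_trans xt ty.
  have -> : r%:C * cis y - r%:C * cis x - (y - x)%:C * (r%:C * ('i * cis t)) =
     r%:C * (cis y - cis x - (y - x)%:C * ('i * cis t)) by ring.
  apply: rr; have [_ _ /(_ t xt ty)[h1 h2]] := sin_cos_diff xy.
  have -> : cis y - cis x - (y - x)%:C * ('i * cis t) =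
    (cos y - cos x + (y - x) * sin t) +i* (sin y - sin x - (y - x) * cos t).
    by apply/eqP; rewrite eq_complex /=; apply/andP; split; apply/eqP; ring.
  by apply: (le_trans (normc_le _ _)); lra.
- by move=> t; rewrite normcM normcR ger0_norm // iE normc_cis mulr1; lra.
- move=> t e e0; have c0 : 0 < 2 * r + 1 by lra.
  exists (e / (2 * r + 1)); first by rewrite divr_gt0.
  move=> t'; rewrite ltr_pdivlMr // => h; rewrite normcE.
  have -> : r%:C * ('i * cis t') - r%:C * ('i * cis t) = 'i * (r%:C * cis t' - r%:C * cis t).
    by ring.
  rewrite iE; have [tt|/ltW tt] := leP t t'.
    apply: (le_trans (lip _ _ tt)); move: h; rewrite ger0_norm ?subr_ge0 //.
    by move: tt; nra.
  rewrite normcB; apply: (le_trans (lip _ _ tt)); move: h; rewrite distrC ger0_norm ?subr_ge0 //.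
  by move: tt; nra.
Qed.

Section Goursat.
Variables (V : completeNormedModType R[i]) (G : R[i] -> V).

Definition radial (phi t1 t2 : R) : V :=
  lint G (fun t => t%:C * cis phi) (fun _ => cis phi) t1 t2.
Definition arc (t phi1 phi2 : R) : V :=
  lint G (fun phi => t%:C * cis phi) (fun phi => t%:C * ('i * cis phi)) phi1 phi2.
Definition loop (t1 t2 phi1 phi2 : R) : V :=
  radial phi1 t1 t2 + arc t2 phi1 phi2 - radial phi2 t1 t2 - arc t1 phi1 phi2.

Lemma nrm_quarter (x y z t : V) : nrm (x + y + (z + t)) <= 4 * nrm x \/
  nrm (x + y + (z + t)) <= 4 * nrm y \/ nrm (x + y + (z + t)) <= 4 * nrm z \/
  nrm (x + y + (z + t)) <= 4 * nrm t.
Proof.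
have := nrmD (x + y) (z + t); have := nrmD x y; have := nrmD z t; set S := nrm (_ + (_ + _)).
have [|h1] := leP S (4 * nrm x); first by left.
have [|h2] := leP S (4 * nrm y); first by right; left.
have [|h3] := leP S (4 * nrm z); first by right; right; left.
have [|h4] := leP S (4 * nrm t); first by right; right; right.
by move=> k1 k2 k3; exfalso; lra.
Qed.

(** Goursat's argument: quartering keeps a polar rectangle whose boundary
    integral is at least a quarter of the previous one; at the limit point the
    remainder of the affine approximation makes it too small. *)
Lemma Goursat (r s a b : R) : 0 < r -> r <= s -> a <= b ->
  (forall t phi, r <= t <= s -> a <= phi <= b -> cdiff G (t%:C * cis phi)) ->
  loop r s a b = 0.
Proof.
move=> r0 rs ab Gd.
have Gc t phi : r <= t <= s -> a <= phi <= b -> ccont G (t%:C * cis phi).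
  by move=> *; apply: cdiff_ccont; exact: Gd.
have ray phi : curve (fun t => t%:C * cis phi) (fun _ => cis phi) 1.
  by apply: curve_ray; rewrite normc_cis.
pose l := s - r; pose m := b - a.
have l0 : 0 <= l by rewrite subr_ge0.
have m0 : 0 <= m by rewrite subr_ge0.
have rl : r + l = s by rewrite /l addrC subrK.
have am : a + m = b by rewrite /m addrC subrK.
pose h n : R := 2^-1 ^+ n.
have h0 n : 0 < h n by rewrite exprn_gt0 // invr_gt0.
have hS n : h n = h n.+1 + h n.+1 by rewrite /h exprS; field.
pose mu n (p : R * R) := loop p.1 (p.1 + l * h n) p.2 (p.2 + m * h n).
pose inside n (p : R * R) :=
  [/\ r <= p.1, p.1 + l * h n <= s, a <= p.2 & p.2 + m * h n <= b].
have radD phi t1 t2 t3 : a <= phi <= b -> r <= t1 -> t1 <= t2 -> t2 <= t3 -> t3 <= s ->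
    radial phi t1 t3 = radial phi t1 t2 + radial phi t2 t3.
  move=> pab rt1 t12 t23 t3s; apply: intg_chasles => // t /andP[u1 u2].
  by apply: cont_at_line (ray phi) _; apply: Gc => //; rewrite (le_trans rt1) // (le_trans u2).
have arcD t p1 p2 p3 : r <= t <= s -> a <= p1 -> p1 <= p2 -> p2 <= p3 -> p3 <= b ->
    arc t p1 p3 = arc t p1 p2 + arc t p2 p3.
  move=> trs ap1 p12 p23 p3b; apply: intg_chasles => // p /andP[u1 u2].
  have t0 : 0 <= t by case/andP: trs => /(le_trans (ltW r0)).
  by apply: cont_at_line (curve_arc t0) _; apply: Gc => //; rewrite (le_trans ap1) // (le_trans u2).
have step n p : exists q, inside n p -> [/\ inside n.+1 q,
    p.1 <= q.1 /\ q.1 + l * h n.+1 <= p.1 + l * h n,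
    p.2 <= q.2 /\ q.2 + m * h n.+1 <= p.2 + m * h n &
    nrm (mu n p) <= 4 * nrm (mu n.+1 q)].
  have [ins|nin] := pselect (inside n p); last by exists p.
  case: ins => i1 i2 i3 i4.
  have lh : 0 <= l * h n.+1 by rewrite mulr_ge0 // ltW.
  have mh : 0 <= m * h n.+1 by rewrite mulr_ge0 // ltW.
  move: i2 i4; rewrite (hS n) !mulrDr !addrA.
  set L := l * _ in lh *; set M := m * _ in mh * => i2 i4.
  have quarters : mu n p = mu n.+1 (p.1, p.2) + mu n.+1 (p.1 + L, p.2) +
      (mu n.+1 (p.1, p.2 + M) + mu n.+1 (p.1 + L, p.2 + M)).
    have e1 : radial p.2 p.1 (p.1 + L + L) = radial p.2 p.1 (p.1 + L) + radial p.2 (p.1 + L) (p.1 + L + L).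
      by apply: radD; lra.
    have e2 : radial (p.2 + M + M) p.1 (p.1 + L + L) =
        radial (p.2 + M + M) p.1 (p.1 + L) + radial (p.2 + M + M) (p.1 + L) (p.1 + L + L).
      by apply: radD; lra.
    have e3 : arc p.1 p.2 (p.2 + M + M) = arc p.1 p.2 (p.2 + M) + arc p.1 (p.2 + M) (p.2 + M + M).
      by apply: arcD; lra.
    have e4 : arc (p.1 + L + L) p.2 (p.2 + M + M) =
        arc (p.1 + L + L) p.2 (p.2 + M) + arc (p.1 + L + L) (p.2 + M) (p.2 + M + M).
      by apply: arcD; lra.
    by rewrite /mu /loop (hS n) !mulrDr !addrA -/L -/M /= e1 e2 e3 e4; vring.
  have [q qE qm] : exists2 q, [/\ q.1 = p.1 \/ q.1 = p.1 + L & q.2 = p.2 \/ q.2 = p.2 + M] &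
      nrm (mu n p) <= 4 * nrm (mu n.+1 q).
    rewrite quarters; set A := mu n.+1 _; set B := mu n.+1 _; set C := mu n.+1 _; set D := mu n.+1 _.
    have [k1|[k1|[k1|k1]]] := nrm_quarter A B C D; [exists (p.1, p.2) => //|exists (p.1 + L, p.2) => //|
        exists (p.1, p.2 + M) => //|exists (p.1 + L, p.2 + M) => //].
    + by split; left.
    + by split; [right|left].
    + by split; [left|right].
    + by split; right.
  exists q => _; rewrite /inside -/L -/M; split => //.
  - by clear -i1 i2 i3 i4 lh mh qE; case: qE => -[->|->] [->|->]; split; lra.
  - by case: qE => -[->|->] _; lra.
  - by case: qE => _ [->|->]; lra.
have [f Hf] := choice (fun np : nat * (R * R) => step np.1 np.2).
pose Q := fix Q n := if n is k.+1 then f (k, Q k) else (r, a).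
have Qin n : inside n (Q n).
  elim: n => [|n IH]; last by have [] := Hf (n, Q n) IH.
  by rewrite /inside /h expr0 !mulr1 rl am /= !lexx.
have QS n := Hf (n, Q n) (Qin n).
have Qmu n : nrm (loop r s a b) <= 4 ^+ n * nrm (mu n (Q n)).
  elim: n => [|n IH].
    by rewrite expr0 mul1r /mu /h expr0 !mulr1 /= rl am.
  apply: (le_trans IH); rewrite exprSr -mulrA ler_wpM2l ?exprn_ge0 //.
  by have [] := QS n.
have nest (u : nat -> R) (k : R) : 0 <= k -> (forall n, u n <= u n.+1 /\ u n.+1 + k * h n.+1 <= u n + k * h n) ->
    exists x, forall n, u n <= x <= u n + k * h n.
  move=> k0 us; have mon i j : u i <= u (j + i)%N.
    by elim: j => [//|j IH]; apply: (le_trans IH); rewrite addSn; have [] := us (j + i)%N.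
  have amon i j : u (j + i)%N + k * h (j + i)%N <= u i + k * h i.
    elim: j => [//|j IH]; apply: le_trans IH; rewrite addSn; by have [] := us (j + i)%N.
  have kh n : 0 <= k * h n by rewrite mulr_ge0 // ltW.
  have bd i j : u i <= u j + k * h j.
    have [ji|/ltnW ij] := leqP j i.
      by apply: (@le_trans _ _ (u i + k * h i)); rewrite ?lerDl // -{1 2}(subnK ji).
    apply: (@le_trans _ _ (u j)); last by rewrite lerDl.
    by rewrite -(subnK ij).
  have hs : has_sup (range u).
    by split; [exists (u 0%N), 0%N|exists (u 0%N + k * h 0%N) => _ [n _ <-]].
  exists (sup (range u)) => n; apply/andP; split.
    by apply: ub_le_sup; [case: hs|exists n].
  by apply: ge_sup; [case: hs|move=> _ [j _ <-]].
have [t0 Ht] : exists x, forall n, (Q n).1 <= x <= (Q n).1 + l * h n.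
  by apply: nest => // n; have [] := QS n.
have [p0 Hp] : exists x, forall n, (Q n).2 <= x <= (Q n).2 + m * h n.
  by apply: nest => // n; have [] := QS n.
have t0rs : r <= t0 <= s.
  by have := Ht 0%N; have [i1 i2 _ _] := Qin 0%N; lra.
have p0ab : a <= p0 <= b.
  by have := Hp 0%N; have [_ _ i1 i2] := Qin 0%N; lra.
have [d Hd] := Gd _ _ t0rs p0ab; set z0 := t0%:C * cis p0 in Hd.
pose K := l + 2 * s * m.
have s0 : 0 <= s by rewrite (le_trans (ltW r0)).
have K0 : 0 <= K by rewrite addr_ge0 ?mulr_ge0.
apply: nrm_small => e e0.
have D0 : 0 < 2 * K ^+ 2 + 1 by rewrite ltr_wpDl // mulr_ge0 // sqr_ge0.
have [dl dl0 Hdl] := Hd _ (divr_gt0 e0 D0); set e' := e / _ in Hdl.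
have e'0 : 0 < e' by rewrite divr_gt0.
have [n hn] : exists n, K * h n < dl.
  have [N hN] := exists_mesh K0 dl0; exists N.+1; apply: le_lt_trans hN.
  rewrite ler_wpM2l // /h exprVn lef_pV2 ?posrE ?exprn_gt0 // -natrX ler_nat.
  by rewrite ltnW // ltn_expl.
apply: (le_trans (Qmu n)).
have [i1 i2 i3 i4] := Qin n; have := Ht n; have := Hp n.
rewrite /mu /loop; set t1 := (Q n).1 in i1 i2 *; set p1 := (Q n).2 in i3 i4 *.
set L := l * h n in i2 *; set M := m * h n in i4 * => /andP[p2 p3] /andP[t2 t3].
have L0 : 0 <= L by rewrite mulr_ge0 // ltW.
have M0 : 0 <= M by rewrite mulr_ge0 // ltW.
have err t p : t1 <= t <= t1 + L -> p1 <= p <= p1 + M ->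
    nrm (G (t%:C * cis p) - (G z0 + (t%:C * cis p - z0) *: d)) <= e' * (K * h n).
  move=> /andP[u1 u2] /andP[v1 v2].
  have dz : normc (t%:C * cis p - z0) <= K * h n.
    have -> : t%:C * cis p - z0 = (t%:C * cis p - t%:C * cis p0) + (t - t0)%:C * cis p0.
      by rewrite /z0; ring.
    have tpos : 0 <= t by lra.
    have [_ ca _ _] := curve_arc tpos.
    have A1 : normc (t%:C * cis p - t%:C * cis p0) <= 2 * t * M.
      have [h1|/ltW h1] := leP p0 p.
        by apply: (le_trans (ca _ _ h1)); rewrite ler_wpM2l ?mulr_ge0 //; lra.
      by rewrite normcB; apply: (le_trans (ca _ _ h1)); rewrite ler_wpM2l ?mulr_ge0 //; lra.
    apply: (le_trans (normcD _ _)); rewrite normcM normcR normc_cis mulr1.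
    have A2 : `|t - t0| <= L by rewrite ler_norml; lra.
    have A3 : 2 * t * M <= 2 * s * M by rewrite ler_wpM2r // ler_wpM2l //; lra.
    have -> : K * h n = L + 2 * s * M by rewrite /K /L /M; ring.
    lra.
  have := Hdl (t%:C * cis p) (le_lt_trans dz hn); rewrite opprD addrA => k.
  by apply: (le_trans k); rewrite ler_wpM2l // ltW.
have inab p : p1 <= p <= p1 + M -> a <= p <= b by move=> /andP[u1 u2]; lra.
have inrs t : t1 <= t <= t1 + L -> r <= t <= s by move=> /andP[u1 u2]; lra.
have t1L : t1 <= t1 + L by lra.
have p1M : p1 <= p1 + M by lra.
pose P := affine_prim z0 (G z0) d.
have RD p : p1 <= p <= p1 + M ->
    nrm (radial p t1 (t1 + L) - (P ((t1 + L)%:C * cis p) - P (t1%:C * cis p))) <=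
    e' * (K * h n) * L.
  move=> pp.
  have -> : e' * (K * h n) * L = 1 * (e' * (K * h n)) * (t1 + L - t1) by ring.
  apply: (lint_affine (ray p)) => //; first by move=> t /inrs tt; apply: Gc => //; exact: inab.
  by move=> t tt; exact: err.
have AD t : t1 <= t <= t1 + L ->
    nrm (arc t p1 (p1 + M) - (P (t%:C * cis (p1 + M)) - P (t%:C * cis p1))) <=
    e' * (K * h n) * (2 * s * M).
  move=> tt; have /andP[_ ts] := inrs t tt; have tpos : 0 <= t by move: tt => /andP[]; lra.
  apply: (@le_trans _ _ (2 * t * (e' * (K * h n)) * (p1 + M - p1))).
    apply: (lint_affine (curve_arc tpos) _ p1M) => [|p pp|p pp].
    + by rewrite mulr_ge0.
    + by apply: Gc; [exact: inrs|exact: inab].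
    + exact: err.
  have Kh0 : 0 <= K * h n by rewrite mulr_ge0 // ltW.
  have E0 : 0 <= e' * (K * h n) * M by exact: mulr_ge0 (mulr_ge0 (ltW e'0) Kh0) M0.
  have := ler_wpM2r E0 ts; lra.
have pp1 : p1 <= p1 <= p1 + M by rewrite lexx.
have pp2 : p1 <= p1 + M <= p1 + M by rewrite lexx p1M.
have tt1 : t1 <= t1 <= t1 + L by rewrite lexx.
have tt2 : t1 <= t1 + L <= t1 + L by rewrite lexx t1L.
have := RD _ pp1; have := RD _ pp2; have := AD _ tt1; have := AD _ tt2.
set R1 := radial p1 _ _; set R2 := radial (p1 + M) _ _.
set A1 := arc (t1 + L) _ _; set A2 := arc t1 _ _.
set P1 := P _; set P2 := P _; set P3 := P _; set P4 := P _ => b1 b2 b3 b4.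
have -> : R1 + A1 - R2 - A2 = (R1 - (P2 - P4)) + (A1 - (P1 - P2)) - (R2 - (P1 - P3)) - (A2 - (P3 - P4)).
  by clearbody R1 R2 A1 A2 P1 P2 P3 P4; clear; vring.
apply: (@le_trans _ _ (4 ^+ n * (2 * (e' * (K * h n) * (K * h n))))).
  rewrite ler_wpM2l ?exprn_ge0 //.
  have -> : 2 * (e' * (K * h n) * (K * h n)) = e' * (K * h n) * L + e' * (K * h n) * (2 * s * M) +
     e' * (K * h n) * L + e' * (K * h n) * (2 * s * M) by rewrite /K /L /M; ring.
  apply: (le_trans (nrmDB _ _)); apply: lerD => //.
  apply: (le_trans (nrmDB _ _)); apply: lerD => //.
  by apply: (le_trans (nrmD _ _)); apply: lerD.
have -> : 4 ^+ n * (2 * (e' * (K * h n) * (K * h n))) = e' * (2 * K ^+ 2) * (4 ^+ n * (h n * h n)).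
  by ring.
have -> : 4 ^+ n * (h n * h n) = 1.
  rewrite /h -!exprMn; have -> : (4 * (2^-1 * 2^-1) : R) = 1 by field.
  by rewrite expr1n.
have E : e' * (2 * K ^+ 2 + 1) = e by rewrite divfK // gt_eqF.
by rewrite mulr1 -E mulrDr mulr1 lerDl ltW.
Qed.

Lemma weight_small (s e : R) : 0 < s -> 0 < e ->
  exists2 d : R, 0 < d & forall t, 0 < t <= d -> weight s t <= e /\ weight s t^-1 <= e.
Proof.
move=> s0 /(powR_small s0)[d d0 h]; exists d => // t /andP[t0 td].
have := h t; rewrite td (ltW t0) => /(_ isT) k; split; rewrite ge_min; first by rewrite k.
by rewrite powRN_inv ?invr_gt0 // invrK k orbT.
Qed.

(** The integrals along two rays differ by the limits of the integrals along the
    arcs that join them, which vanish by decay. *)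
Lemma sector_Cauchy (a b C s : R) (I J : V) : a <= b -> 0 <= C -> 0 < s ->
  (forall t phi, 0 < t -> a <= phi <= b -> cdiff G (t%:C * cis phi)) ->
  (forall t phi, 0 < t -> a <= phi <= b -> nrm (G (t%:C * cis phi)) <= C * weight s t / t) ->
  iint (fun t => cis a *: G (t%:C * cis a)) I ->
  iint (fun t => cis b *: G (t%:C * cis b)) J -> I = J.
Proof.
move=> ab C0 s0 Gd Gb [GI [PI I0 Ioo]] [GJ [PJ J0 Joo]].
have arc_small t : 0 < t -> nrm (arc t a b) <= C * weight s t * (b - a).
  move=> t0; apply: intg_le => // p pab.
    by apply: cont_at_line (curve_arc (ltW t0)) _; apply: cdiff_ccont; exact: Gd.
  rewrite nrmZ !normcM normc_cis mulr1 normcR ger0_norm ?(ltW t0) //.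
  have -> : normc ('i : R[i]) = 1 by rewrite /normc /= expr0n /= add0r expr1n sqrtr1.
  by rewrite mulr1 mulrC -ler_pdivlMr // Gb.
apply/eqP; rewrite -subr_eq0; apply/eqP; apply: nrm_small => e e0.
pose k := 2 * (C * (b - a)) + 4.
have k0 : 0 < k by rewrite ltr_wpDl // mulr_ge0 // mulr_ge0 // subr_ge0.
have e'0 : 0 < e / k by rewrite divr_gt0.
have [d1 d10 h1] := I0 _ e'0; have [d2 d20 h2] := Ioo _ e'0.
have [d3 d30 h3] := J0 _ e'0; have [d4 d40 h4] := Joo _ e'0.
have [d5 d50 h5] := weight_small s0 e'0.
pose r := Num.min (Num.min d1 d3) (Num.min d5 (Num.min 1 (Num.min d2^-1 d4^-1))).
have r0 : 0 < r by rewrite !lt_min d10 d30 d50 ltr01 !invr_gt0 d20.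
have : r <= r by []; rewrite {2}/r !le_min => /andP[/andP[r1 r3] /andP[r5 /andP[r6 /andP[r2 r4]]]].
have T0 : 0 < r^-1 by rewrite invr_gt0.
have rT : r <= r^-1 by rewrite (le_trans r6) // invf_ge1.
have T2 : d2 <= r^-1 by rewrite -[d2]invrK lef_pV2 ?posrE ?invr_gt0.
have T4 : d4 <= r^-1 by rewrite -[d4]invrK lef_pV2 ?posrE ?invr_gt0.
have L : loop r r^-1 a b = 0.
  by apply: Goursat => // t p /andP[rt _] pab; apply: Gd => //; exact: lt_le_trans rt.
have RA : radial a r r^-1 = GI r^-1 - GI r by apply: intgE => //; exact: PI.
have RB : radial b r r^-1 = GJ r^-1 - GJ r by apply: intgE => //; exact: PJ.
move: L; rewrite /loop RA RB => L.
have -> : I - J = (GI r - GJ r) - (GI r^-1 - I) + (GJ r^-1 - J) + (arc r a b - arc r^-1 a b).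
  rewrite -[LHS]addr0 -[X in _ + X = _]oppr0 -L; vring.
have rr1 : 0 < r <= d1 by rewrite r0.
have rr3 : 0 < r <= d3 by rewrite r0.
have [w1 w2] : weight s r <= e / k /\ weight s r^-1 <= e / k by apply: h5; rewrite r0.
have q1 := h1 _ rr1; have q3 := h3 _ rr3; have q2 := h2 _ T2; have q4 := h4 _ T4.
have ba0 : 0 <= C * (b - a) by rewrite mulr_ge0 // subr_ge0.
have a1 : nrm (arc r a b) <= C * (b - a) * (e / k).
  by apply: (le_trans (arc_small _ r0)); rewrite mulrAC ler_wpM2l.
have a2 : nrm (arc r^-1 a b) <= C * (b - a) * (e / k).
  by apply: (le_trans (arc_small _ T0)); rewrite mulrAC ler_wpM2l.
have E : k * (e / k) = e by rewrite mulrC divfK // gt_eqF.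
have b1 := nrmDB (GI r) (GJ r).
have b2 := nrmDB (GI r - GJ r) (GI r^-1 - I).
have b3 := nrmD (GI r - GJ r - (GI r^-1 - I)) (GJ r^-1 - J).
have b4 := nrmD (GI r - GJ r - (GI r^-1 - I) + (GJ r^-1 - J)) (arc r a b - arc r^-1 a b).
have b5 := nrmDB (arc r a b) (arc r^-1 a b).
move: E; rewrite {1}/k; lra.
Qed.

End Goursat.
End ComplexDerivative.

(** * Sectors, bisectors and holomorphy *)

Section Geometry.
Variable R : realType.
Implicit Types (z w : R[i]) (t th r : R).
Notation Re := complex.Re.
Notation Im := complex.Im.

Lemma normc_sqr z : normc z ^+ 2 = Re z ^+ 2 + Im z ^+ 2.
Proof. by case: z => x y; rewrite /normc sqr_sqrtr // addr_ge0 // sqr_ge0. Qed.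

Lemma normc_ge_ReIm z : `|Re z| <= normc z /\ `|Im z| <= normc z.
Proof.
case: z => x y; rewrite /normc /=; split.
  by rewrite -sqrtr_sqr ler_wsqrtr // lerDl sqr_ge0.
by rewrite -sqrtr_sqr ler_wsqrtr // lerDr sqr_ge0.
Qed.

Lemma trig_pos th : 0 < th < pi / 2 -> 0 < cos th /\ 0 < sin th.
Proof.
move=> /andP[t0 t1]; split; first by apply: cos_gt0_pihalf; rewrite t1 andbT; have := pi_gt0 R; lra.
by apply: sin_gt0_pi; rewrite t0 /=; have := pi_gt0 R; lra.
Qed.

(** Sectors are cut out by linear inequalities; this avoids arguments. *)
Lemma sectorP th z : 0 < th < pi / 2 ->
  sector th z <-> `|Im z| * cos th < Re z * sin th.
Proof.
move=> tb; have [c0 s0] := trig_pos tb; have /andP[t0 t1] := tb; split.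
  move=> [r [t [r0 tth ->]]] /=; rewrite !mul0r !subr0 addr0.
  have -> : `|r * sin t| = r * `|sin t| by rewrite normrM gtr0_norm.
  rewrite -!mulrA ltr_pM2l //.
  have tpi : `|t| < pi by have := pi_gt0 R; lra.
  have sa : `|sin t| = sin `|t|.
    case: (ler0P t) tpi tth => [t'|t' tpi _]; last first.
      by rewrite ger0_norm // sin_ge0_pi // (ltW t') /= ltW.
    rewrite sinN; move: t'; rewrite le_eqVlt => /orP[/eqP-> *|t' tpi _].
      by rewrite sin0 oppr0 normr0.
    by rewrite -sinN -normrN -sinN ger0_norm // sin_ge0_pi // oppr_ge0 (ltW t') /= ltW.
  have ca : cos t = cos `|t| by case: (ler0P t) => // _; rewrite cosN.
  rewrite sa ca -subr_gt0.
  have -> : cos `|t| * sin th - sin `|t| * cos th = sin (th - `|t|) by rewrite sinB; ring.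
  apply: sin_gt0_pi; rewrite subr_gt0 tth /=.
  by have := normr_ge0 t; have := pi_gt0 R; lra.
case: z => x y /= h.
have x0 : 0 < x.
  by rewrite -(pmulr_lgt0 _ s0); apply: le_lt_trans h; rewrite mulr_ge0 // ltW.
pose t := atan (y / x); pose r := Num.sqrt (x ^+ 2 + y ^+ 2).
have ct : 0 < cos t by apply: cos_gt0_pihalf; rewrite atan_gtNpi2 atan_ltpi2.
have tt : sin t = y / x * cos t.
  have := atanK (y / x); rewrite -/t /tan => /(congr1 (fun q => q * cos t)).
  by rewrite divfK // gt_eqF.
have r2 : r ^+ 2 = x ^+ 2 + y ^+ 2 by rewrite sqr_sqrtr // addr_ge0 // sqr_ge0.
have r0 : 0 < r by rewrite sqrtr_gt0 ltr_pwDl ?exprn_gt0 // sqr_ge0.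
have rc : r * cos t = x.
  apply/eqP; rewrite -(@eqrXn2 _ 2) ?mulr_ge0 // ?(ltW r0) ?(ltW ct) ?(ltW x0) //.
  have := cos2Dsin2 t; rewrite tt => e; rewrite exprMn r2; apply/eqP.
  transitivity (x ^+ 2 * (cos t ^+ 2 + (y / x * cos t) ^+ 2)); last by rewrite e mulr1.
  by field; rewrite gt_eqF.
exists r, t; split => //.
  rewrite ltNge; apply/negP => tht.
  have tpi : `|t| < pi / 2 by rewrite ltr_norml atan_gtNpi2 atan_ltpi2.
  have : sin (`|t| - th) >= 0.
    by apply: sin_ge0_pi; rewrite subr_ge0 tht /=; have := pi_gt0 R; lra.
  rewrite sinB.
  have sa : r * sin `|t| = `|y|.
    have ry : r * sin t = y by rewrite tt mulrCA rc divfK // gt_eqF.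
    case: (ler0P t) tpi tht => [t' tpi _|t' tpi _].
      rewrite sinN mulrN ry ler0_norm // -ry pmulr_rle0 //.
      rewrite -oppr_ge0 -sinN sin_ge0_pi // oppr_ge0 t' /=; have := pi_gt0 R; lra.
    rewrite ry ger0_norm // -ry mulr_ge0 ?(ltW r0) // sin_ge0_pi // (ltW t') /=.
    by have := pi_gt0 R; lra.
  have ca : r * cos `|t| = x by rewrite -rc; case: (ler0P t) => // _; rewrite cosN.
  move=> /(mulr_ge0 (ltW r0)); rewrite mulrBr !mulrA sa ca; lra.
apply/eqP; rewrite eq_complex /= !mul0r subr0 addr0 rc eqxx /=.
by apply/eqP; rewrite tt mulrCA rc divfK // gt_eqF.
Qed.

Lemma opp_sectorP th z : 0 < th < pi / 2 ->
  opp_sector th z <-> `|Im z| * cos th < - Re z * sin th.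
Proof.
move=> tb; split.
  by move=> [w /(sectorP _ tb) h <-]; case: w h => x y /=; rewrite normrN opprK.
move=> h; exists (- z); last by rewrite opprK.
by apply/(sectorP _ tb); case: z h => x y /=; rewrite normrN.
Qed.

Lemma bisectorP th z : 0 < th < pi / 2 ->
  bisector th z <-> `|Im z| * cos th < `|Re z| * sin th.
Proof.
move=> tb; have [c0 s0] := trig_pos tb; split.
  move=> [/(sectorP _ tb)|/(opp_sectorP _ tb)] h; apply: (lt_le_trans h).
    by rewrite ler_wpM2r ?ler_norm // ltW.
  by rewrite ler_wpM2r ?(ltW s0) // -normrN ler_norm.
have [x0|x0] := ler0P (Re z) => h; first by right; apply/(opp_sectorP _ tb).
by left; apply/(sectorP _ tb).
Qed.

Lemma bisector_Re th z : 0 < th < pi / 2 -> bisector th z -> Re z != 0.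
Proof.
move=> tb /(bisectorP _ tb); have [c0 _] := trig_pos tb; apply: contraTneq => ->.
by rewrite normr0 mul0r -leNgt mulr_ge0 // ltW.
Qed.

Lemma bisector_neq0 th z : 0 < th < pi / 2 -> bisector th z -> z != 0.
Proof. by move=> tb /(bisector_Re tb); apply: contraNneq => ->. Qed.

Lemma sgn_bisectorE th z : 0 < th < pi / 2 -> bisector th z ->
  sgn_bisector th z = if 0 < Re z then 1 else -1.
Proof.
move=> tb bz; have [c0 s0] := trig_pos tb; rewrite /sgn_bisector !indicE.
have IM0 : 0 <= `|Im z| * cos th by rewrite mulr_ge0 // ltW.
case: bz => bz.
  have /(sectorP _ tb) h := bz.
  have x0 : 0 < Re z by rewrite -(pmulr_lgt0 _ s0) (le_lt_trans IM0).
  rewrite x0 (mem_set bz) memNset ?subr0 // => /(opp_sectorP _ tb) h2.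
  by have := le_lt_trans IM0 h2; rewrite mulNr oppr_gt0 pmulr_llt0 // ltNge ltW.
have /(opp_sectorP _ tb) h := bz.
have x0 : Re z < 0.
  by have := le_lt_trans IM0 h; rewrite mulNr oppr_gt0 pmulr_llt0.
rewrite ltNge (ltW x0) /= (mem_set bz) memNset ?sub0r // => /(sectorP _ tb) h2.
by have := le_lt_trans IM0 h2; rewrite pmulr_lgt0 // ltNge ltW.
Qed.

Lemma bisectorN th z : 0 < th < pi / 2 -> bisector th (- z) <-> bisector th z.
Proof.
by move=> tb; split=> /(bisectorP _ tb) h; apply/(bisectorP _ tb); case: z h => x y /=; rewrite !normrN.
Qed.

(** The bisector is open, and the sign of the real part is locally constant on it. *)
Lemma bisector_open th z : 0 < th < pi / 2 -> bisector th z ->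
  exists2 r : R, 0 < r & forall w, normc (w - z) < r -> bisector th w /\ (0 < Re w) = (0 < Re z).
Proof.
move=> tb bz; have [c0 s0] := trig_pos tb.
have xz := bisector_Re tb bz; have /(bisectorP _ tb) h := bz.
pose q := `|Re z| * sin th - `|Im z| * cos th.
have q0 : 0 < q by rewrite subr_gt0.
have x0 : 0 < `|Re z| by rewrite normr_gt0.
exists (Num.min `|Re z| (q / 2)); first by rewrite lt_min x0 divr_gt0.
move=> w; rewrite lt_min => /andP[w1 w2].
have [] := normc_ge_ReIm (w - z); rewrite !raddfB /= => h1 h2; split.
  apply/(bisectorP _ tb).
  have b1 : `|Re z| - normc (w - z) <= `|Re w|.
    by have := ler_distD (Re w) (Re z) 0; rewrite !subr0 distrC; lra.
  have b2 : `|Im w| <= `|Im z| + normc (w - z).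
    by have := ler_distD (Im z) (Im w) 0; rewrite !subr0; lra.
  have c1 : cos th <= 1 := cos_le1 th; have s1 : sin th <= 1 := sin_le1 th.
  have := ler_wpM2r (ltW s0) b1; have := ler_wpM2r (ltW c0) b2.
  have := normc_ge0 (w - z); move: w2; rewrite /q; nra.
have := le_lt_trans h1 w1; rewrite ltr_distl.
have [z0|z0] := ler0P (Re z); rewrite -?ltrNge => /andP[k1 k2].
  by apply/idP/idP; lra.
by apply/idP/idP; lra.
Qed.

Lemma ray_sector th t phi : 0 < th < pi / 2 -> 0 < t -> `|phi| < th ->
  sector th (t%:C * cis phi).
Proof. by move=> tb t0 ph; exists t, phi. Qed.

(** The open set complementary to the closed bisector. *)
Definition outer (w : R) z : Prop := `|Re z| * sin w < `|Im z| * cos w.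

Lemma outer_open (w : R) z : 0 < w < pi / 2 -> outer w z ->
  exists2 r : R, 0 < r & forall z', normc (z' - z) < r -> outer w z'.
Proof.
move=> tb; rewrite /outer => h; have [c0 s0] := trig_pos tb.
pose q := `|Im z| * cos w - `|Re z| * sin w.
have q0 : 0 < q by rewrite subr_gt0.
exists (q / 2); first by rewrite divr_gt0.
move=> z' w2; have [] := normc_ge_ReIm (z' - z); rewrite !raddfB /= => h1 h2.
have b1 : `|Im z| - normc (z' - z) <= `|Im z'|.
  by have := ler_distD (Im z') (Im z) 0; rewrite !subr0 distrC; lra.
have b2 : `|Re z'| <= `|Re z| + normc (z' - z).
  by have := ler_distD (Re z) (Re z') 0; rewrite !subr0; lra.
have c1 : cos w <= 1 := cos_le1 w; have s1 : sin w <= 1 := sin_le1 w.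
have := ler_wpM2r (ltW c0) b1; have := ler_wpM2r (ltW s0) b2.
have := normc_ge0 (z' - z); move: w2; rewrite /q; nra.
Qed.

Lemma outer_closure (w : R) z : 0 < w < pi / 2 -> outer w z ->
  ~ closure (bisector w : set R[i]^o) z.
Proof.
move=> tb oz; have [r r0 h] := outer_open tb oz.
move=> /(_ (ball (z : R[i]^o) r%:C)) [].
  by apply: nbhsx_ballx; rewrite ltcR.
move=> z' [/(bisectorP _ tb) bz]; rewrite -ball_normE /= normE ltcR nrmB normcE => /h.
by rewrite /outer ltNge (ltW bz).
Qed.

Lemma outer_neq0 (w : R) z : outer w z -> z != 0.
Proof. by rewrite /outer; apply: contraTneq => -> /=; rewrite normr0 !mul0r ltxx. Qed.

Lemma ray_outer (w t phi : R) : 0 < w < pi / 2 -> 0 < t -> w < `|phi| -> `|phi| < pi - w ->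
  outer w (t%:C * cis phi).
Proof.
move=> tb t0 p1 p2; have [c0 s0] := trig_pos tb; have /andP[w0 w1] := tb.
have -> : outer w (t%:C * cis phi) = (`|t * cos phi| * sin w < `|t * sin phi| * cos w) :> Prop.
  by rewrite /outer /= !mul0r subr0 addr0.
rewrite !normrM (gtr0_norm t0) -!mulrA ltr_pM2l //.
have sa : `|sin phi| = sin `|phi|.
  have ppi : `|phi| <= pi by lra.
  have h : 0 <= sin `|phi| by apply: sin_ge0_pi; rewrite normr_ge0.
  by move: h; case: (ler0P phi) => [_|_ h]; [rewrite sinN => h; rewrite -normrN ger0_norm|rewrite ger0_norm].
have ca : `|cos phi| = `|cos `|phi| | by case: (ler0P phi) => // _; rewrite cosN.
rewrite sa ca -subr_gt0.
have [hc|hc] := ler0P (cos `|phi|).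
  have -> : sin `|phi| * cos w - - cos `|phi| * sin w = sin (`|phi| + w) by rewrite sinD; ring.
  by apply: sin_gt0_pi; have := normr_ge0 phi; lra.
have -> : sin `|phi| * cos w - cos `|phi| * sin w = sin (`|phi| - w) by rewrite sinB; ring.
by apply: sin_gt0_pi; lra.
Qed.

Lemma outer_imaginary (w t : R) : 0 < w < pi / 2 -> t != 0 -> outer w (t%:C * 'i).
Proof.
move=> tb t0; have [c0 s0] := trig_pos tb; rewrite /outer /= !mul0r mulr0 subrr normr0 mul0r.
by rewrite mulr1 addr0 mulr_gt0 // normr_gt0.
Qed.

End Geometry.

Section Holomorphy.
Variable R : realType.
Implicit Types (z w : R[i]).

(** Holomorphy as a limit of difference quotients and as a first-order estimate agree. *)
Lemma derivable_cdiff (f : R[i] -> R[i]) z :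
  derivable (f : R[i]^o -> R[i]^o) z 1 <-> cdiff (f : R[i] -> R[i]^o) z.
Proof.
split.
  move=> /cvg_ex[d /= df]; exists d => e e0.
  have e0' : 0 < e%:C :> R[i] by rewrite ltcR.
  move: df => /cvgrPdist_le /(_ _ e0').
  move=> /nbhs_ballP[r]; rewrite /= ltcE /= => /andP[/eqP rI rR] h.
  exists (complex.Re r) => // w wr.
  have [->|wz] := eqVneq w z; first by rewrite !subrr scale0r subrr nrm0 normc0 mulr0.
  have wz0 : w - z != 0 by rewrite subr_eq0.
  have rE : r = (complex.Re r)%:C by apply/eqP; rewrite eq_complex /= rI !eqxx.
  have := h (w - z); rewrite -ball_normE /= sub0r normrN rE normE ltcR normcE.
  move=> /(_ wr wz0); rewrite normE lecR /GRing.scale /= mulr1 subrK => k.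
  have -> : f w - f z - (w - z) * d = - ((w - z) * (d - (w - z)^-1 * (f w - f z))).
    by rewrite mulrBr mulrA mulfV // mul1r opprB.
  rewrite ?normcE normcopp normcM mulrC ler_wpM2r ?normc_ge0 //.
move=> [d h]; apply/cvg_ex; exists d => /=.
apply/cvgrPdist_le => e; rewrite ltcE /= => /andP[/eqP eI eR].
have eE : e = (complex.Re e)%:C by apply/eqP; rewrite eq_complex /= eI !eqxx.
have [r r0 hr] := h _ eR; apply/nbhs_ballP; exists r%:C => /=; first by rewrite ltcR.
move=> x; rewrite -ball_normE /= sub0r normrN normE ltcR normcE => xr x0.
have := hr (x + z); rewrite addrK => /(_ xr) k.
rewrite eE normE lecR /GRing.scale /= mulr1.
have -> : d - x^-1 * (f (x + z) - f z) = - (x^-1 * (f (x + z) - f z - x * d)).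
  have quot (a b c : R[i]) : b != 0 -> a - b^-1 * c = - (b^-1 * (c - b * a)).
    by move=> b0; rewrite mulrBr mulrA mulVf // mul1r opprB.
  exact: quot.
rewrite ?normcE normcopp normcM normcV mulrC ler_pdivrMr ?normc_gt0 //.
Qed.

Section Algebra.
Variable V : normedModType R[i].
Implicit Types (G H : R[i] -> V).

Lemma cdiff_near G H z (r : R) : 0 < r -> (forall w, normc (w - z) < r -> G w = H w) ->
  cdiff G z -> cdiff H z.
Proof.
move=> r0 GH [d h]; exists d => e /h[r' r0' k]; exists (Num.min r r').
  by rewrite lt_min r0.
move=> w; rewrite lt_min => /andP[w1 w2].
by rewrite -GH // -GH ?k // subrr normc0.
Qed.

Lemma cdiff_ext G H z : (forall w, G w = H w) -> cdiff G z -> cdiff H z.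
Proof. by move=> GH; apply: (@cdiff_near G H z 1) => // w _; exact: GH. Qed.

Lemma cdiff_cst (v : V) z : cdiff (fun _ => v) z.
Proof.
exists 0 => e e0; exists 1 => // w _; rewrite subrr scaler0 subrr nrm0.
by rewrite mulr_ge0 ?normc_ge0 // ltW.
Qed.

Lemma cdiffD G H z : cdiff G z -> cdiff H z -> cdiff (fun w => G w + H w) z.
Proof.
move=> [d h] [d' h']; exists (d + d') => e e0; have e2 : 0 < e / 2 by rewrite divr_gt0.
have [r r0 k] := h _ e2; have [r' r0' k'] := h' _ e2.
exists (Num.min r r'); first by rewrite lt_min r0.
move=> w; rewrite lt_min => /andP[/k k1 /k' k2].
have -> : G w + H w - (G z + H z) - (w - z) *: (d + d') =
  (G w - G z - (w - z) *: d) + (H w - H z - (w - z) *: d') by vring.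
by apply: (le_trans (nrmD _ _)); lra.
Qed.

Lemma cdiffZ (f : R[i] -> R[i]) G z : cdiff (f : R[i] -> R[i]^o) z -> cdiff G z ->
  cdiff (fun w => f w *: G w) z.
Proof.
move=> fd Gd; have fc := cdiff_ccont fd; case: fd => f' hf; case: Gd => d hG.
exists (f' *: G z + f z *: d) => e e0.
set A := normc (f z); set B := nrm (G z); set E := nrm d.
have A0 : 0 <= A := normc_ge0 _; have B0 : 0 <= B := nrm_ge0 _; have E0 : 0 <= E := nrm_ge0 _.
have D0 : 0 < A + B + E + 1 by lra.
pose q := Num.min 1 (e / (A + B + E + 1)).
have q0 : 0 < q by rewrite lt_min ltr01 divr_gt0.
have [r1 r10 k1] := hf _ q0; have [r2 r20 k2] := hG _ q0; have [r3 r30 k3] := fc _ q0.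
exists (Num.min r1 (Num.min r2 r3)); first by rewrite !lt_min r10 r20.
move=> w; rewrite !lt_min => /andP[/k1 {}k1 /andP[/k2 {}k2 /k3 {}k3]].
have -> : f w *: G w - f z *: G z - (w - z) *: (f' *: G z + f z *: d) =
  (f w - f z - (w - z) * f') *: G z + (f z *: (G w - G z - (w - z) *: d) +
   ((f w - f z) *: (G w - G z - (w - z) *: d) + (f w - f z) *: ((w - z) *: d))) by vring.
have q1 : q <= 1 by rewrite ge_min lexx.
have q2 : q * (A + B + E + 1) <= e by rewrite -ler_pdivlMr // ge_min lexx orbT.
move: k1 k2 k3; rewrite !normcE; set X := normc (_ - _ - _); set Y := nrm (_ - _ - _).
set Z := normc (f w - f z); set N := normc (w - z) => k1 k2 k3.
have N0 : 0 <= N := normc_ge0 _; have X0 : 0 <= X := normc_ge0 _.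
have Y0 : 0 <= Y := nrm_ge0 _; have Z0 : 0 <= Z := normc_ge0 _.
apply: (@le_trans _ _ (X * B + (A * Y + (Z * Y + Z * (N * E))))).
  apply: (le_trans (nrmD _ _)); apply: lerD; first by rewrite nrmZ.
  apply: (le_trans (nrmD _ _)); apply: lerD; first by rewrite nrmZ.
  by apply: (le_trans (nrmD _ _)); rewrite !nrmZ.
apply: (@le_trans _ _ ((q * N) * B + (A * (q * N) + (1 * (q * N) + q * (N * E))))).
  apply: lerD; first by rewrite ler_wpM2r.
  apply: lerD; first by rewrite ler_wpM2l.
  apply: lerD; last by rewrite ler_wpM2r // mulr_ge0.
  by apply: ler_pM => //; exact: le_trans q1.
have -> : q * N * B + (A * (q * N) + (1 * (q * N) + q * (N * E))) = q * (A + B + E + 1) * N by ring.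
by rewrite ler_wpM2r.
Qed.

Lemma cdiff_opp G z : cdiff G (- z) -> cdiff (fun w => G (- w)) z.
Proof.
move=> [d h]; exists (- d) => e /h[r r0 k]; exists r => // w wr.
have E : normc (- w - - z) = normc (w - z) by rewrite opprK addrC normcB.
have := k (- w); rewrite E => /(_ wr).
suff -> : G (- w) - G (- z) - (- w - - z) *: d = G (- w) - G (- z) - (w - z) *: - d by [].
by vring.
Qed.

End Algebra.

Lemma cdiff_id z : cdiff (fun w => w : R[i]^o) z.
Proof.
exists 1 => e e0; exists 1 => // w _.
have -> : (w : R[i]^o) - z - (w - z) *: (1 : R[i]^o) = 0 by rewrite /GRing.scale /= mulr1 subrr.
by rewrite nrm0 mulr_ge0 ?normc_ge0 // ltW.
Qed.

Lemma cdiff_inv (f : R[i] -> R[i]) z : f z != 0 -> cdiff (f : R[i] -> R[i]^o) z ->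
  cdiff (fun w => (f w)^-1 : R[i]^o) z.
Proof.
move=> fz0 fd; have fc := cdiff_ccont fd.
have A0 := normc_gt0 fz0; set A := normc (f z) in A0.
case: fd => f' hf; exists (- f' / (f z) ^+ 2) => e e0.
set F := normc f'; have F0 : 0 <= F := normc_ge0 _.
pose q := Num.min (A / 2) (e * A ^+ 3 / (4 * (A + F))).
have AF : 0 < A + F by lra.
have q0 : 0 < q by rewrite lt_min !divr_gt0 // ?mulr_gt0 // exprn_gt0.
have [r1 r10 k1] := hf _ q0; have [r2 r20 k2] := fc _ q0.
exists (Num.min r1 r2); first by rewrite lt_min r10.
move=> w; rewrite lt_min => /andP[/k1 {}k1 /k2 {}k2].
have q1 : q <= A / 2 by rewrite ge_min lexx.
have q2 : q * (4 * (A + F)) <= e * A ^+ 3.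
  by rewrite -ler_pdivlMr ?mulr_gt0 // ge_min lexx orbT.
move: k1 k2; rewrite !normcE => k1 k2.
have Aw : A / 2 <= normc (f w).
  by have := normcDB (f w) (f w - f z); rewrite subKr -/A; lra.
have fw0 : f w != 0 by apply: contraTneq Aw => ->; rewrite normc0 -ltNge divr_gt0.
have -> : (f w)^-1 - (f z)^-1 - (w - z) *: (- f' / f z ^+ 2) =
  (- f z * (f w - f z - (w - z) * f') + (w - z) * f' * (f w - f z)) / (f w * f z ^+ 2).
  by rewrite /GRing.scale /=; field; rewrite fw0 fz0.
rewrite normcM normcV normcM normcX -/A.
have D0 : 0 < normc (f w) * A ^+ 2 by rewrite mulr_gt0 ?exprn_gt0 // normc_gt0.
rewrite ler_pdivrMr //; set N := normc (w - z); have N0 : 0 <= N := normc_ge0 _.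
apply: (@le_trans _ _ (A * (q * N) + N * F * q)).
  apply: (le_trans (normcD _ _)); rewrite !normcM; apply: lerD.
    by rewrite normcopp ler_wpM2l // ltW.
  by rewrite ler_wpM2l // mulr_ge0.
have -> : A * (q * N) + N * F * q = q * (A + F) * N by ring.
rewrite (mulrAC e N); apply: ler_wpM2r => //.
apply: (@le_trans _ _ (e * A ^+ 3 / 4)); first by rewrite ler_pdivlMr //; lra.
have -> : e * A ^+ 3 / 4 = e * A ^+ 2 * (A / 4) by field.
have -> : e * (normc (f w) * A ^+ 2) = e * A ^+ 2 * normc (f w) by ring.
rewrite ler_wpM2l ?mulr_ge0 ?exprn_ge0 ?(ltW e0) ?(ltW A0) //; lra.
Qed.

End Holomorphy.

(** * The rational functions [z / (t^2 + z^2)] and their integral in [t] *)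

Section RealPrimitives.
Variable R : realType.
Implicit Types (a b c x t : R) (K k L l : R -> R).

Lemma uprimRD K k L l a b : uprimR K k a b -> uprimR L l a b ->
  uprimR (fun t => K t + L t) (fun t => k t + l t) a b.
Proof.
move=> P Q e e0; have e2 : 0 < e / 2 by rewrite divr_gt0.
have [d d0 h] := P _ e2; have [d' d0' h'] := Q _ e2.
exists (Num.min d d'); first by rewrite lt_min d0.
move=> x t y x1 x2 x3 x4; rewrite lt_min => /andP[x5 x6].
have := h x t y x1 x2 x3 x4 x5; have := h' x t y x1 x2 x3 x4 x6.
have -> : K y + L y - (K x + L x) - (y - x) * (k t + l t) =
  (K y - K x - (y - x) * k t) + (L y - L x - (y - x) * l t) by ring.
by have := ler_normD (K y - K x - (y - x) * k t) (L y - L x - (y - x) * l t); lra.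
Qed.

Lemma uprimRZ c K k a b : uprimR K k a b -> uprimR (fun t => c * K t) (fun t => c * k t) a b.
Proof.
move=> P e e0; have C1 : 0 < `|c| + 1 by rewrite ltr_wpDl.
have [d d0 h] := P _ (divr_gt0 e0 C1); exists d => // x t y x1 x2 x3 x4 x5.
have := h x t y x1 x2 x3 x4 x5; set A := _ - _ - _ => hA.
have -> : c * K y - c * K x - (y - x) * (c * k t) = c * A by rewrite /A; ring.
rewrite normrM; apply: (@le_trans _ _ ((`|c| + 1) * `|A|)); first by rewrite ler_wpM2r // lerDl.
by rewrite mulrC -ler_pdivlMr // mulrAC.
Qed.

Lemma uprimR_ext K k L l a b : (forall t, a <= t <= b -> K t = L t) ->
  (forall t, a <= t <= b -> k t = l t) -> uprimR K k a b -> uprimR L l a b.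
Proof.
move=> KL kl P e /P[d d0 h]; exists d => // x t y x1 x2 x3 x4 x5; have xy := le_trans x2 x3.
by rewrite -!KL -?kl ?h //; apply/andP; split; lra.
Qed.

Let den_derive x c t : is_derive t 1 (fun s : R => x ^+ 2 + (s + c) ^+ 2) (2 * (t + c)).
Proof.
have D : is_derive t 1 (fun s : R => s + c) 1.
  by apply: is_derive_eq; rewrite addr0.
have -> : (fun s : R => x ^+ 2 + (s + c) ^+ 2) = cst (x ^+ 2) + (fun s : R => s + c) ^+ 2.
  by [].
apply: is_derive_eq; rewrite add0r /GRing.scale /= expr1 mulr1 -mulr_natr; ring.
Qed.

Let den_gt0 x c t : 0 < x -> 0 < x ^+ 2 + (t + c) ^+ 2.
Proof. by move=> x0; rewrite ltr_pwDl ?exprn_gt0 // sqr_ge0. Qed.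

Let den_inv_continuous x c t : 0 < x ->
  {for t, continuous (fun s : R => (x ^+ 2 + (s + c) ^+ 2)^-1)}.
Proof.
move=> x0; have c1 : {for t, continuous (fun s : R => x ^+ 2 + (s + c) ^+ 2)}.
  by apply: differentiable_continuous; apply/derivable1_diffP; have [] := den_derive x c t.
by apply: cvgV => //; rewrite gt_eqF // den_gt0.
Qed.

Lemma uprimR_atan x c a b : 0 < x ->
  uprimR (fun t => atan ((t + c) / x)) (fun t => x / (x ^+ 2 + (t + c) ^+ 2)) a b.
Proof.
move=> x0; apply: uprimR_derive => t _.
  have D : is_derive t 1 (fun s : R => (s + c) / x) x^-1.
    have -> : (fun s : R => (s + c) / x) = x^-1 *: (id + cst c : R -> R).
      by apply/funext => s /=; rewrite /GRing.scale /= mulrC.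
    by apply: is_derive_eq; rewrite addr0 /GRing.scale /= mulr1.
  have := @is_derive1_comp R atan (fun s => (s + c) / x) t _ _ (is_derive1_atan _) D.
  rewrite /comp => H; apply: is_derive_eq; field.
  by rewrite !gt_eqF // ?den_gt0 // mulf_neq0.
apply: cvgM; first exact: cvg_cst.
exact: den_inv_continuous.
Qed.

Lemma uprimR_ln x c a b : 0 < x ->
  uprimR (fun t => ln (x ^+ 2 + (t + c) ^+ 2)) (fun t => 2 * (t + c) / (x ^+ 2 + (t + c) ^+ 2)) a b.
Proof.
move=> x0; apply: uprimR_derive => t _.
  have := @is_derive1_comp R (@ln R) (fun s => x ^+ 2 + (s + c) ^+ 2) t _ _
    (is_derive1_ln (den_gt0 c t x0)) (den_derive x c t).
  by rewrite /comp mulrC.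
apply: cvgM; last exact: den_inv_continuous.
apply: cvgM; first exact: cvg_cst.
by apply: cvgD; [exact: cvg_id|exact: cvg_cst].
Qed.

Lemma uprimR_inv a b : 0 < a -> uprimR (fun t => - t^-1) (fun t => (t ^+ 2)^-1) a b.
Proof.
move=> a0; have sN : (-1 : R) != 0 by rewrite oppr_eq0 oner_eq0.
apply: uprimR_ext (uprimR_powR b sN a0) => t /andP[at_ _]; have t0 := lt_le_trans a0 at_.
  by rewrite powR_inv1 ?(ltW t0) // invrN invr1 mulN1r.
by rewrite powR_inv1 ?(ltW t0) // expr2 invfM.
Qed.

Lemma atan_limit e : 0 < e -> exists M : R, forall u, M <= u -> `|atan u - pi / 2| <= e.
Proof.
move=> e0; pose q := Num.min e (pi / 4).
have p0 := pi_gt0 R.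
have q0 : 0 < q by rewrite lt_min e0 divr_gt0.
have q1 : q <= e by rewrite ge_min lexx.
have q2 : q <= pi / 4 by rewrite ge_min lexx orbT.
have inI : pi / 2 - q \in `](- (pi / 2)), (pi / 2)[ by rewrite in_itv /=; apply/andP; split; lra.
exists (tan (pi / 2 - q)) => u uM.
have h1 : pi / 2 - q <= atan u.
  rewrite -(tanK inI); move: uM; rewrite le_eqVlt => /orP[/eqP -> //|/lt_atan/ltW //].
by have := atan_ltpi2 u; rewrite ler_norml; lra.
Qed.

End RealPrimitives.

Section Kernel.
Variable R : realType.
Implicit Types (z : R[i]) (t a b : R).
Notation Re := complex.Re.
Notation Im := complex.Im.

Definition rker t z : R[i] := z / (t%:C ^+ 2 + z ^+ 2).

Lemma den_factor t z : t%:C ^+ 2 + z ^+ 2 = (z - t%:C * 'i) * (z + t%:C * 'i).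
Proof.
have i2 : 'i * 'i = -1 :> R[i] by rewrite -expr2 sqr_i.
rewrite -subr_sqr [(t%:C * 'i) ^+ 2]expr2 mulrACA i2; ring.
Qed.

Lemma normc_den t z :
  normc (t%:C ^+ 2 + z ^+ 2) ^+ 2 = (t ^+ 2 + normc z ^+ 2) ^+ 2 - 4 * t ^+ 2 * Im z ^+ 2.
Proof.
rewrite normc_sqr (normc_sqr z); case: z => x y /=; rewrite !expr2 /= !mul0r !mulr0; ring.
Qed.

Lemma normc_pole t z : normc (z - t%:C * 'i) ^+ 2 = normc z ^+ 2 - 2 * t * Im z + t ^+ 2.
Proof.
by rewrite normc_sqr (normc_sqr z); case: z => x y /=; rewrite !mul0r !mulr0 !mulr1 /=; ring.
Qed.

Section Bisector.
Variable th : R.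
Hypothesis thb : 0 < th < pi / 2.
Let c0 : 0 < cos th. Proof. by have [] := trig_pos thb. Qed.
Let s0 : 0 < sin th. Proof. by have [] := trig_pos thb. Qed.

Lemma bisector_Im z : bisector th z -> Im z ^+ 2 <= sin th ^+ 2 * normc z ^+ 2.
Proof.
move=> /(bisectorP _ thb) /ltW h; rewrite normc_sqr.
have : (`|Im z| * cos th) ^+ 2 <= (`|Re z| * sin th) ^+ 2.
  by rewrite ler_sqr // nnegrE mulr_ge0 // ltW.
rewrite !exprMn !real_normK ?num_real //.
have := cos2Dsin2 th; nra.
Qed.

(** On a bisector the two terms of [t^2 + z^2] cannot cancel, since
    [|t^2 + z^2|^2 = (t^2 + |z|^2)^2 - 4 t^2 (Im z)^2]. *)
Lemma den_ge t z : bisector th z ->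
  cos th * (t ^+ 2 + normc z ^+ 2) <= normc (t%:C ^+ 2 + z ^+ 2).
Proof.
move=> bz; have P0 : 0 <= t ^+ 2 + normc z ^+ 2 by rewrite addr_ge0 // sqr_ge0.
rewrite -ler_sqr ?nnegrE ?normc_ge0 ?mulr_ge0 // ?(ltW c0) //.
rewrite normc_den exprMn; have := bisector_Im bz; have := cos2Dsin2 th.
set y := Im z; set r := normc z; set c := cos th; set s := sin th => cs yr.
have : 4 * t ^+ 2 * y ^+ 2 <= 4 * t ^+ 2 * (s ^+ 2 * r ^+ 2).
  by rewrite ler_wpM2l // mulr_ge0 // sqr_ge0.
have -> : c ^+ 2 = 1 - s ^+ 2 by rewrite -cs; ring.
have : 0 <= s ^+ 2 * (t ^+ 2 - r ^+ 2) ^+ 2 by rewrite mulr_ge0 // sqr_ge0.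
lra.
Qed.

Lemma pole_ge t z : bisector th z ->
  cos th * normc z <= normc (z - t%:C * 'i) /\ cos th * `|t| <= normc (z - t%:C * 'i).
Proof.
move=> bz; have := bisector_Im bz; have := cos2Dsin2 th; have E := normc_pole t z.
set y := Im z; set r := normc z; set c := cos th; set s := sin th => cs yr.
have r0 : 0 <= r := normc_ge0 z.
have ys : `|y| <= s * r.
  by rewrite -ler_sqr ?nnegrE ?mulr_ge0 ?(ltW s0) // exprMn real_normK ?num_real.
have yt : t * y <= `|t| * (s * r).
  by apply: le_trans (ler_norm _) _; rewrite normrM ler_wpM2l.
have tt : `|t| ^+ 2 = t ^+ 2 by rewrite real_normK ?num_real.
split; rewrite -ler_sqr ?nnegrE ?normc_ge0 ?mulr_ge0 ?(ltW c0) // E exprMn -/y -/r.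
  have : 0 <= (`|t| - s * r) ^+ 2 by exact: sqr_ge0.
  have -> : c ^+ 2 = 1 - s ^+ 2 by rewrite -cs; ring.
  rewrite -tt; lra.
have : 0 <= (r - s * `|t|) ^+ 2 by exact: sqr_ge0.
have -> : c ^+ 2 = 1 - s ^+ 2 by rewrite -cs; ring.
rewrite -tt; lra.
Qed.

Lemma den_neq0 t z : bisector th z -> t%:C ^+ 2 + z ^+ 2 != 0.
Proof.
move=> bz; have z0 := normc_gt0 (bisector_neq0 thb bz).
apply: contraTneq (den_ge t bz) => ->; rewrite normc0 -ltNge mulr_gt0 //.
by rewrite ltr_wpDl ?sqr_ge0 // exprn_gt0.
Qed.

Lemma rker_le t z : bisector th z ->
  normc (rker t z) <= (cos th)^-1 * (normc z / (t ^+ 2 + normc z ^+ 2)).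
Proof.
move=> bz; have z0 := normc_gt0 (bisector_neq0 thb bz).
have P0 : 0 < t ^+ 2 + normc z ^+ 2 by rewrite ltr_wpDl ?sqr_ge0 // exprn_gt0.
rewrite normcM normcV mulrCA ler_wpM2l ?normc_ge0 // -invfM lef_pV2 ?posrE ?mulr_gt0 //.
  exact: den_ge.
by apply: lt_le_trans (den_ge t bz); rewrite mulr_gt0.
Qed.

Lemma rkerB t u z : bisector th z -> normc (rker t z - rker u z) <=
  (cos th)^-1 ^+ 2 * (`|u ^+ 2 - t ^+ 2| * normc z / ((t ^+ 2 + normc z ^+ 2) * (u ^+ 2 + normc z ^+ 2))).
Proof.
move=> bz; have z0 := normc_gt0 (bisector_neq0 thb bz).
have P0 q : 0 < q ^+ 2 + normc z ^+ 2 by rewrite ltr_wpDl ?sqr_ge0 // exprn_gt0.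
have N0 q : 0 < normc (q%:C ^+ 2 + z ^+ 2) by rewrite normc_gt0 // den_neq0.
have -> : rker t z - rker u z =
    (u ^+ 2 - t ^+ 2)%:C * z / ((t%:C ^+ 2 + z ^+ 2) * (u%:C ^+ 2 + z ^+ 2)).
  by rewrite /rker rmorphB !rmorphXn /=; field; rewrite !den_neq0.
rewrite normcM normcV !normcM normcR mulrCA; apply: ler_wpM2l.
  by rewrite mulr_ge0 ?normc_ge0.
rewrite exprVn -invfM lef_pV2 ?posrE ?mulr_gt0 // ?exprn_gt0 //.
rewrite expr2 mulrACA; apply: ler_pM; rewrite ?mulr_ge0 ?den_ge ?(ltW c0) ?ltW //.
Qed.

End Bisector.

Lemma rkerN t z : rker t (- z) = - rker t z.
Proof. by rewrite /rker sqrrN mulNr. Qed.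

(** The primitive in [t] of [rker t z], for [z] in the right half-plane; this is
    the arctangent of [t / z]. *)
Definition Theta z t : R[i] :=
  let x := Re z in let y := Im z in
  (2^-1 * (atan ((t + y) / x) + atan ((t + - y) / x))) +i*
  ((- 4^-1) * (ln (x ^+ 2 + (t + y) ^+ 2) + (-1) * ln (x ^+ 2 + (t + - y) ^+ 2))).

Lemma Theta_uprim z a b : 0 < Re z ->
  uprim (Theta z : R -> R[i]^o) (fun t => rker t z) a b.
Proof.
move=> x0; have P := uprim_complex (a := a) (b := b)
  (uprimRZ 2^-1 (uprimRD (uprimR_atan (Im z) a b x0) (uprimR_atan (- Im z) a b x0)))
  (uprimRZ (- 4^-1) (uprimRD (uprimR_ln (Im z) a b x0) (uprimRZ (-1) (uprimR_ln (- Im z) a b x0)))).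
apply: uprim_ext P => t _.
case: z x0 => x y /= x0.
set A := x ^+ 2 + (t + y) ^+ 2; set B := x ^+ 2 + (t - y) ^+ 2.
have A0 : 0 < A by rewrite ltr_pwDl ?exprn_gt0 // sqr_ge0.
have B0 : 0 < B by rewrite ltr_pwDl ?exprn_gt0 // sqr_ge0.
have D0 : t%:C ^+ 2 + (x +i* y) ^+ 2 != 0.
  apply/negP => /eqP h; have := normc_den t (x +i* y); rewrite h normc0 normc_sqr /=.
  have : 0 < A * B by rewrite mulr_gt0.
  rewrite /A /B expr0n /=; lra.
apply: (mulIf D0); rewrite /rker divfK //.
have -> : t%:C ^+ 2 + (x +i* y) ^+ 2 = (t ^+ 2 + x ^+ 2 - y ^+ 2) +i* (2 * x * y).
  by rewrite !expr2; apply/eqP; rewrite eq_complex /=; apply/andP; split; apply/eqP; ring.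
apply/eqP; rewrite eq_complex /=; apply/andP; split; apply/eqP.
  by rewrite /A /B; field; rewrite -/A -/B !gt_eqF.
by rewrite /A /B; field; rewrite -/A -/B !gt_eqF.
Qed.

Lemma Theta0 z : 0 < Re z -> Theta z 0 = 0.
Proof.
by move=> x0; rewrite /Theta !add0r [- _ / _]mulNr atanN subrr sqrrN mulN1r subrr !mulr0.
Qed.

Lemma Theta_limit z : 0 < Re z -> forall e, 0 < e -> exists T : R, forall t, T <= t ->
  normc (Theta z t - (pi / 2)%:C) <= e.
Proof.
move=> x0 e e0; rewrite /Theta; set x := Re z in x0 *; set y := Im z.
have e2 : 0 < e / 2 by rewrite divr_gt0.
have [M hM] := atan_limit e2.
exists (Num.max (M * x + `|y|) (Num.max (2 * `|y| + 1) (16 * `|y| / e))) => t.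
rewrite !ge_max => /andP[t1 /andP[t2 t3]].
have y0 := normr_ge0 y; have yl := ler_norm y; have yl' : - y <= `|y| by rewrite -normrN ler_norm.
have t0 : 0 < t by lra.
have big c : `|c| <= `|y| -> M <= (t + c) / x.
  move=> cy; rewrite ler_pdivlMr //; have := ler_norm (- c); rewrite normrN; lra.
have h1 := hM _ (big y (lexx _)).
have h2 : `|atan ((t + - y) / x) - pi / 2| <= e / 2 by apply: hM; apply: big; rewrite normrN.
set A := x ^+ 2 + (t + y) ^+ 2; set B := x ^+ 2 + (t + - y) ^+ 2.
have low c : `|c| <= `|y| -> t ^+ 2 / 4 <= x ^+ 2 + (t + c) ^+ 2.
  move=> cy; have := ler_norm (- c); rewrite normrN => cc.
  have : (t / 2) ^+ 2 <= (t + c) ^+ 2.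
    rewrite ler_sqr ?nnegrE; lra.
  have : 0 <= x ^+ 2 by exact: sqr_ge0.
  have -> : (t / 2) ^+ 2 = t ^+ 2 / 4 by field.
  lra.
have A4 : t ^+ 2 / 4 <= A by exact: low.
have B4 : t ^+ 2 / 4 <= B by apply: low; rewrite normrN.
have T4 : 0 < t ^+ 2 / 4 by rewrite divr_gt0 // exprn_gt0.
have lnb P Q : t ^+ 2 / 4 <= P -> t ^+ 2 / 4 <= Q -> P - Q <= 4 * t * `|y| -> ln P - ln Q <= e.
  move=> P4 Q4 PQ; have P0 := lt_le_trans T4 P4; have Q0 := lt_le_trans T4 Q4.
  rewrite -ln_div ?posrE //.
  have -> : P / Q = 1 + (P - Q) / Q by field; rewrite gt_eqF.
  apply: (le_trans (le_ln1Dx _)).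
    by rewrite mulrBl divff ?gt_eqF // ltrBrDr addNr divr_gt0.
  rewrite ler_pdivrMr //; apply: (le_trans PQ).
  have h : 16 * `|y| <= e * t by rewrite [e * t]mulrC -ler_pdivrMr.
  apply: (@le_trans _ _ (e * (t ^+ 2 / 4))); last by rewrite ler_wpM2l // ltW.
  have : 16 * `|y| * t <= e * t * t by rewrite ler_wpM2r // ltW.
  rewrite expr2; lra.
have AB : A - B = 4 * t * y by rewrite /A /B; ring.
have l1 : ln A - ln B <= e by apply: lnb => //; rewrite AB ler_wpM2l //; lra.
have l2 : ln B - ln A <= e.
  apply: lnb => //; have -> : B - A = 4 * t * - y by rewrite -opprB AB; ring.
  by rewrite ler_wpM2l //; lra.
set a1 := atan _ in h1 *; set a2 := atan _ in h2 *.
have -> : (2^-1 * (a1 + a2) +i* (- 4^-1 * (ln A + -1 * ln B))) - (pi / 2)%:C =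
   (2^-1 * ((a1 - pi / 2) + (a2 - pi / 2))) +i* (- 4^-1 * (ln A - ln B)).
  by apply/eqP; rewrite eq_complex /=; apply/andP; split; apply/eqP; field.
apply: (le_trans (normc_le _ _)); rewrite !normrM normrN.
have l3 : `|ln A - ln B| <= e by rewrite ler_norml; lra.
have := ler_normD (a1 - pi / 2) (a2 - pi / 2).
rewrite (ger0_norm (x := 2^-1)) ?invr_ge0 // (ger0_norm (x := 4^-1)) ?invr_ge0 //; lra.
Qed.

End Kernel.

(** * Rational approximations of the sign function *)

Section SignApproximation.
Variable R : realType.
Implicit Types (z : R[i]) (s t a b h r th : R).
Notation Re := complex.Re.
Notation Im := complex.Im.

Lemma weight_max s r : 0 < r -> 0 < s -> weight s r = Num.max r r^-1 `^ (- s).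
Proof.
move=> r0 s0; have mono u v : 0 < u -> u <= v -> v `^ (- s) <= u `^ (- s).
  move=> u0 uv; have v0 := lt_le_trans u0 uv.
  rewrite !powRN lef_pV2 ?posrE ?powR_gt0 //; apply: ge0_ler_powR => //; rewrite ?nnegrE; lra.
rewrite /weight; have E : r `^ s = r^-1 `^ (- s) by rewrite powRN_inv ?invr_gt0 // invrK.
rewrite E; have [h|/ltW h] := leP r^-1 r.
  rewrite (min_idPr _) //; apply: mono => //; by rewrite invr_gt0.
by rewrite (min_idPl _) //; apply: mono.
Qed.

Lemma max_inv_ge1 r : 0 < r -> 1 <= Num.max r r^-1.
Proof.
by move=> r0; rewrite le_max; have [//|/ltW r1] := leP 1 r; rewrite invf_ge1 // r1 ?orbT.
Qed.

Lemma weight_mono s s' r : 0 < r -> 0 < s' -> s' <= s -> weight s r <= weight s' r.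
Proof.
move=> r0 s0 ss; have s1 := lt_le_trans s0 ss; rewrite !weight_max //.
by apply: ler_powR; rewrite ?max_inv_ge1 // lerN2.
Qed.

Lemma weight_le1 s r : 0 < r -> 0 < s -> weight s r <= 1.
Proof.
move=> r0 s0; rewrite weight_max // -(powRr0 (Num.max r r^-1)).
by apply: ler_powR; rewrite ?max_inv_ge1 // oppr_le0 ltW.
Qed.

Lemma weight1 r : 0 < r -> weight 1 r = Num.min r r^-1.
Proof. by move=> r0; rewrite /weight powRr1 ?powR_inv1 // ltW. Qed.

(** The sum is at most the telescoping sum of [2 / (1 + j a) - 2 / (1 + (j + 1) a)]. *)
Lemma sum_inv_sqr a N : 0 < a -> \sum_(j < N) a / (1 + (j.+1%:R * a) ^+ 2) <= 2.
Proof.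
move=> a0; apply: (@le_trans _ _ (2 - 2 / (1 + N%:R * a))); last first.
  by rewrite lerBlDr lerDl divr_ge0 // addr_ge0 // mulr_ge0 // ltW.
elim: N => [|N IH]; first by rewrite big_ord0 mul0r addr0 divr1 subrr.
rewrite big_ord_recr /=; apply: (le_trans (lerD IH (lexx _))).
have -> : N.+1%:R * a = N%:R * a + a by rewrite -natr1 mulrDl mul1r.
have b0 : 0 <= N%:R * a by rewrite mulr_ge0 // ltW.
move: (N%:R * a) b0 => b b0.
have D1 : 0 < 1 + b by lra.
have D2 : 0 < 1 + (b + a) by lra.
have D3 : 0 < 1 + (b + a) ^+ 2 by rewrite ltr_pwDl // sqr_ge0.
suff : a / (1 + (b + a) ^+ 2) <= 2 / (1 + b) - 2 / (1 + (b + a)) by lra.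
have -> : 2 / (1 + b) - 2 / (1 + (b + a)) = a * (2 / ((1 + b) * (1 + (b + a)))).
  by field; rewrite !gt_eqF.
rewrite ler_wpM2l ?(ltW a0) // ler_pdivlMr ?mulr_gt0 // mulrC ler_pdivrMr //.
have : 0 <= (1 - (b + a)) ^+ 2 by exact: sqr_ge0.
have : (1 + b) * (1 + (b + a)) <= (1 + (b + a)) * (1 + (b + a)).
  by rewrite ler_wpM2r ?(ltW D2) // lerD2l lerDl ltW.
rewrite !expr2; lra.
Qed.

Lemma sum_poisson h r N : 0 < h -> 0 < r ->
  \sum_(j < N) h * (r / ((j.+1%:R * h) ^+ 2 + r ^+ 2)) <= 2.
Proof.
move=> h0 r0; have := @sum_inv_sqr (h / r) N; rewrite divr_gt0 // => /(_ isT).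
rewrite (eq_bigr (fun j : 'I_N => h * (r / ((j.+1%:R * h) ^+ 2 + r ^+ 2)))) // => j _.
have p : 0 <= (j.+1%:R * h) ^+ 2 := sqr_ge0 _; have q : 0 < r ^+ 2 by rewrite exprn_gt0.
have e : 1 + (j.+1%:R * (h / r)) ^+ 2 = ((j.+1%:R * h) ^+ 2 + r ^+ 2) / r ^+ 2.
  by field; rewrite gt_eqF.
by rewrite e; field; rewrite !gt_eqF //; lra.
Qed.

Definition mesh (k : nat) : R := 2^-1 ^+ k.
Definition node (k j : nat) : R := j.+1%:R * mesh k.

Lemma mesh_gt0 k : 0 < mesh k.
Proof. by rewrite exprn_gt0 // invr_gt0. Qed.

Lemma node_gt0 k j : 0 < node k j.
Proof. by rewrite mulr_gt0 // mesh_gt0. Qed.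

Lemma mesh_count k : (4 ^ k)%:R * mesh k = (mesh k)^-1.
Proof.
by rewrite /mesh natrX -exprMn -exprVn; congr (_ ^+ k); field.
Qed.

Lemma mesh_small (e : R) : 0 < e -> exists N, forall k, (N <= k)%N -> mesh k <= e.
Proof.
move=> e0; have [N hN] := @exists_mesh R 1 e ler01 e0; exists N.+1 => k Nk.
apply: le_trans (ltW hN); rewrite div1r /mesh exprVn lef_pV2 ?posrE ?exprn_gt0 //.
by rewrite -natrX ler_nat (leq_trans Nk) // ltnW // ltn_expl.
Qed.

(** A Riemann sum of [2 / pi * rker t z] over [0 < t <= 2 ^ k] with mesh [2 ^- k]:
    a rational function of [z], close to the sign of [Re z]. *)
Definition sgn_approx (k : nat) z : R[i] :=
  (2 / pi)%:C * \sum_(j < 4 ^ k) (mesh k)%:C * rker (node k j) z.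

Lemma sgn_approxN k z : sgn_approx k (- z) = - sgn_approx k z.
Proof.
rewrite /sgn_approx -mulrN -sumrN; congr (_ * _); apply: eq_bigr => j _.
by rewrite rkerN mulrN.
Qed.

Section Bounds.
Variable th : R.
Hypothesis thb : 0 < th < pi / 2.
Let c0 : 0 < cos th. Proof. by have [] := trig_pos thb. Qed.
Let c : R := (cos th)^-1.
Let cp : 0 < c. Proof. by rewrite invr_gt0. Qed.
Let p0 : 0 < 2 / pi :> R. Proof. by rewrite divr_gt0 // pi_gt0. Qed.

Definition sgn_approx_bound : R := 2 / pi * ((cos th)^-1 * 2).

Lemma sgn_approx_le k z : bisector th z -> normc (sgn_approx k z) <= sgn_approx_bound.
Proof.
move=> bz; have r0 := normc_gt0 (bisector_neq0 thb bz).
rewrite normcM normcR gtr0_norm // ler_wpM2l ?(ltW p0) //.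
have := @nrm_sum R (R[i]^o) _ (fun j : 'I_(4 ^ k) => (mesh k)%:C * rker (node k j) z).
rewrite !normcE => h; apply: (le_trans h).
have := sum_poisson (4 ^ k) (mesh_gt0 k) r0 => /(ler_wpM2l (ltW cp)); apply: le_trans.
rewrite mulr_sumr; apply: ler_sum => j _.
rewrite normcE normcM normcR gtr0_norm ?mesh_gt0 // mulrCA ler_wpM2l ?(ltW (mesh_gt0 k)) //.
exact: rker_le.
Qed.

(** Each cell contributes an error of the order of [h] times a term of a Poisson sum,
    which [sum_poisson] adds up. *)
Lemma Riemann_sum_Theta h N z : 0 < h -> bisector th z -> 0 < Re z ->
  normc (\sum_(j < N) h%:C * rker (j.+1%:R * h) z - Theta z (N%:R * h)) <=
  c ^+ 2 * h / normc z * (h / normc z + 2).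
Proof.
move=> h0 bz x0; have r0 := normc_gt0 (bisector_neq0 thb bz); set r := normc z in r0 *.
have C0 : 0 <= c ^+ 2 by exact: sqr_ge0.
have P0 q : 0 < q ^+ 2 + r ^+ 2 by rewrite ltr_wpDl ?sqr_ge0 // exprn_gt0.
have cell j : normc (h%:C * rker (j.+1%:R * h) z - (Theta z (j.+1%:R * h) - Theta z (j%:R * h))) <=
    c ^+ 2 * h / r * (h * (r / ((j%:R * h) ^+ 2 + r ^+ 2))).
  set a := j%:R * h; set u := j.+1%:R * h.
  have ua : u - a = h by rewrite /u /a -natr1; ring.
  have a0 : 0 <= a by rewrite mulr_ge0 // ltW.
  have au : a <= u by lra.
  have U : uprim (fun t => t%:C *: (rker u z : R[i]^o)) (fun _ => rker u z) a u.
    move=> e e0; exists 1 => // x t y x1 x2 x3 x4 _.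
    have -> : y%:C *: (rker u z : R[i]^o) - x%:C *: rker u z - (y - x)%:C *: rker u z = 0.
      by rewrite rmorphB /GRing.scale /=; ring.
    by rewrite nrm0 mulr_ge0 ?(ltW e0) //; lra.
  have := uprim_const_le au (uprimB (Theta_uprim a u x0) U).
  move=> /(_ (c ^+ 2 * h / ((a ^+ 2 + r ^+ 2)))) H.
  have -> : h%:C * rker u z - (Theta z u - Theta z a) =
     - ((Theta z u - u%:C * rker u z) - (Theta z a - a%:C * rker u z)).
    by rewrite -ua rmorphB /=; ring.
  rewrite normcopp -normcE; apply: le_trans (H _) _; last first.
    by rewrite ua le_eqVlt; apply/orP; left; apply/eqP; field; rewrite !gt_eqF.
  move=> t /andP[at_ tu]; rewrite normcE.
  apply: (le_trans (rkerB thb t u bz)); rewrite -/r -/c -[leRHS]mulrA ler_wpM2l //.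
  have t0 : 0 <= t := le_trans a0 at_.
  have -> : `|u ^+ 2 - t ^+ 2| = (u - t) * (u + t).
    by rewrite ger0_norm; [ring|rewrite subr_ge0 ler_sqr ?nnegrE //; exact: le_trans tu].
  have X : (u - t) * ((u + t) * r) <= h * (u ^+ 2 + r ^+ 2).
    apply: ler_pM => //; first lra.
    - by rewrite mulr_ge0 ?(ltW r0) //; lra.
    - lra.
    - have : 0 <= (u - r) ^+ 2 by exact: sqr_ge0.
      have : t * r <= u * r by rewrite ler_wpM2r // ltW.
      rewrite !expr2; lra.
  apply: (@le_trans _ _ (h / (t ^+ 2 + r ^+ 2))).
    rewrite ler_pdivrMr ?mulr_gt0 // -mulrA; apply: (le_trans X).
    by rewrite le_eqVlt; apply/orP; left; apply/eqP; field; rewrite gt_eqF.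
  rewrite ler_wpM2l ?(ltW h0) // lef_pV2 ?posrE // lerD2r ler_sqr ?nnegrE //.
have D0 : 0 <= c ^+ 2 * h / r by rewrite divr_ge0 ?(ltW r0) // mulr_ge0 // ltW.
apply: (@le_trans _ _ (c ^+ 2 * h / r * \sum_(j < N) h * (r / ((j%:R * h) ^+ 2 + r ^+ 2)))).
  elim: N => [|N IH].
    by rewrite !big_ord0 mul0r (Theta0 x0) subrr normc0 mulr0.
  rewrite !big_ord_recr /= mulrDr.
  set S := \sum_(_ < N) _ in IH *; set S' := \sum_(_ < N) _ in IH *.
  have -> : S + h%:C * rker (N.+1%:R * h) z - Theta z (N.+1%:R * h) =
    (S - Theta z (N%:R * h)) + (h%:C * rker (N.+1%:R * h) z - (Theta z (N.+1%:R * h) - Theta z (N%:R * h))).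
    by ring.
  by apply: (le_trans (normcD _ _)); apply: lerD.
rewrite ler_wpM2l //; case: N => [|N].
  by rewrite big_ord0 addr_ge0 // divr_ge0 // ltW.
rewrite big_ord_recl mul0r expr0n add0r /=; apply: lerD.
  by rewrite le_eqVlt; apply/orP; left; apply/eqP; field; rewrite gt_eqF.
exact: sum_poisson.
Qed.

(** Bound the tail of the integral by that of [t ^- 2]. *)
Lemma Theta_rate z t : bisector th z -> 0 < Re z -> 0 < t ->
  normc (Theta z t - (pi / 2)%:C) <= c * normc z / t.
Proof.
move=> bz x0 t0; apply/ler_addgt0Pl => e e0.
have r0 := normc_gt0 (bisector_neq0 thb bz).
have [T hT] := Theta_limit x0 e0.
pose u := Num.max t T; have tu : t <= u by rewrite le_max lexx.
have u0 := lt_le_trans t0 tu.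
have := uprim_le tu (Theta_uprim t u x0) (uprimRZ (c * normc z) (uprimR_inv u t0)).
have bd s : t <= s <= u -> normc (rker s z) <= c * normc z * (s ^+ 2)^-1.
  move=> /andP[ts _]; have s0 := lt_le_trans t0 ts.
  apply: (le_trans (rker_le thb s bz)); rewrite -/c -mulrA.
  rewrite ler_wpM2l ?(ltW cp) // ler_wpM2l ?(ltW r0) //.
  by rewrite lef_pV2 ?posrE ?exprn_gt0 ?ltr_wpDl ?sqr_ge0 ?exprn_gt0 // lerDl sqr_ge0.
move=> /(_ bd); rewrite normcE => h1.
have := hT u; rewrite le_max lexx orbT => /(_ isT) h2.
have -> : Theta z t - (pi / 2)%:C = (Theta z u - (pi / 2)%:C) - (Theta z u - Theta z t) by ring.
apply: (le_trans (normcDB _ _)).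
have : 0 <= c * normc z * u^-1 by rewrite !mulr_ge0 ?invr_ge0 // ltW.
by move: h1 h2; rewrite !mulrN -[_ / t]/(_ * t^-1); lra.
Qed.

Definition sgn_rate_const : R :=
  2 / pi * (3 * (cos th)^-1 ^+ 2 + (cos th)^-1) + (sgn_approx_bound + 1).

(** The first term is the discretization error; the second one comes from cutting the
    integral at [t = 2 ^ k]. *)
Lemma sgn_approx_rate k z : bisector th z -> 0 < Re z ->
  normc (sgn_approx k z - 1) <= sgn_rate_const * (mesh k / normc z + mesh k * normc z).
Proof.
move=> bz x0; have r0 := normc_gt0 (bisector_neq0 thb bz); set r := normc z in r0 *.
have h0 := mesh_gt0 k; set h := mesh k in h0 *.
have B0 : 0 <= sgn_approx_bound by rewrite !mulr_ge0 ?invr_ge0 ?(ltW c0) // ltW // pi_gt0.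
have hr0 : 0 < h / r by rewrite divr_gt0.
have hr1 : 0 < h * r by rewrite mulr_gt0.
have A0 : 0 <= 2 / pi * (3 * c ^+ 2 + c) :> R.
  by rewrite mulr_ge0 ?(ltW p0) // addr_ge0 ?(ltW cp) // mulr_ge0 // sqr_ge0.
have [hr|rh] := leP h r; last first.
  apply: (@le_trans _ _ (sgn_approx_bound + 1)).
    apply: (le_trans (normcDB _ _)); rewrite normc1 lerD2r; exact: sgn_approx_le.
  have h1 : 1 <= h / r by rewrite ler_pdivlMr // mul1r ltW.
  rewrite /sgn_rate_const -/c; set q := 2 / pi * _ in A0 *; nra.
have e1 := Riemann_sum_Theta (4 ^ k) h0 bz x0.
rewrite mesh_count -/h -/r in e1.
have e2 : normc (Theta z h^-1 - (pi / 2)%:C) <= c * r * h.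
  by have := Theta_rate bz x0 (t := h^-1); rewrite invr_gt0 invrK; apply.
rewrite /sgn_approx -/h; rewrite /node -/h; set S := \sum_(_ < _) _ in e1 *.
have p1 : (2 / pi)%:C * (pi / 2)%:C = 1 :> R[i].
  rewrite -rmorphM; rewrite mulrA divfK ?divff ?rmorph1 // ?pnatr_eq0 //.
  by rewrite gt_eqF // pi_gt0.
have -> : (2 / pi)%:C * S - 1 = (2 / pi)%:C * ((S - Theta z h^-1) + (Theta z h^-1 - (pi / 2)%:C)).
  by rewrite -[in LHS]p1; ring.
rewrite normcM normcR (gtr0_norm p0).
have hr' : h / r <= 1 by rewrite ler_pdivrMr // mul1r.
have e3 := normcD (S - Theta z h^-1) (Theta z h^-1 - (pi / 2)%:C).
have e4 : c ^+ 2 * h / r * (h / r + 2) <= 3 * c ^+ 2 * (h / r).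
  have -> : 3 * c ^+ 2 * (h / r) = c ^+ 2 * h / r * 3 by ring.
  rewrite ler_wpM2l //; last lra.
  by rewrite -mulrA mulr_ge0 ?sqr_ge0 // ltW.
apply: (@le_trans _ _ (2 / pi * ((3 * c ^+ 2) * (h / r) + c * (h * r)))).
  rewrite ler_wpM2l ?(ltW p0) //; lra.
apply: (@le_trans _ _ (2 / pi * (3 * c ^+ 2 + c) * (h / r + h * r))).
  rewrite -[leRHS]mulrA ler_wpM2l ?(ltW p0) //.
  have : 0 <= 3 * c ^+ 2 * (h * r) by rewrite !mulr_ge0 ?sqr_ge0 // ltW.
  have : 0 <= c * (h / r) by rewrite mulr_ge0 // ltW.
  lra.
rewrite /sgn_rate_const -/c ler_wpM2r //; lra.
Qed.

Lemma sgn_approx_sgn k z : bisector th z ->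
  normc (sgn_approx k z - sgn_bisector th z) <=
    sgn_rate_const * (mesh k / normc z + mesh k * normc z).
Proof.
move=> bz; have := bisector_Re thb bz; have := sgn_bisectorE thb bz.
case: (ltrgt0P (Re z)) => // x0 -> _; first exact: sgn_approx_rate.
have bN : bisector th (- z) by apply/bisectorN.
have xN : 0 < Re (- z) by case: z x0 {bz bN} => x y /=; rewrite oppr_gt0.
have := sgn_approx_rate k bN xN; rewrite normcopp sgn_approxN.
have -> : - sgn_approx k z - 1 = - (sgn_approx k z - -1) by ring.
by rewrite normcopp.
Qed.

Lemma sgn_norm z : bisector th z -> normc (sgn_bisector th z) = 1.
Proof.
by move=> bz; rewrite sgn_bisectorE //; case: ifP; rewrite ?normcopp normc1.
Qed.

(** Interpolating the rate with the uniform bound trades a power of the decay of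
    [g] for convergence uniform with respect to an integrable weight. *)
Lemma sgn_approx_weighted s : 0 < s -> exists sg C : R, [/\ 0 < sg, 0 <= C &
  forall k z (w : R[i]) (B : R), bisector th z -> 0 <= B -> normc w <= B * weight s (normc z) ->
    normc ((sgn_approx k z - sgn_bisector th z) * w) <= B * (C * mesh k `^ sg) * weight sg (normc z)].
Proof.
move=> s0; pose sg := Num.min s 1 / 2.
have m0 : 0 < Num.min s 1 by rewrite lt_min s0 ltr01.
have sg0 : 0 < sg by rewrite divr_gt0.
have sgs : sg <= s - sg by rewrite /sg; have : Num.min s 1 <= s by [rewrite ge_min lexx]; lra.
have sg1 : sg <= 1 by rewrite /sg; have : Num.min s 1 <= 1 by [rewrite ge_min lexx orbT]; lra.
pose C1 := sgn_approx_bound + 1; pose C := C1 + 2 * sgn_rate_const.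
have B0 : 0 <= sgn_approx_bound by rewrite !mulr_ge0 ?invr_ge0 ?(ltW c0) // ltW // pi_gt0.
have S0 : 0 <= sgn_rate_const.
  rewrite /sgn_rate_const -/c addr_ge0 // ?addr_ge0 // mulr_ge0 ?(ltW p0) // addr_ge0 ?(ltW cp) //.
  by rewrite mulr_ge0 // sqr_ge0.
have S2 : 0 <= 2 * sgn_rate_const by rewrite mulr_ge0.
have C10 : 0 <= C1 by rewrite /C1 addr_ge0.
have C1C : C1 <= C by rewrite /C lerDl.
have SC : 2 * sgn_rate_const <= C by rewrite /C lerDr.
have C0 : 0 <= C := le_trans C10 C1C.
exists sg, C; split => // k z w B bz Bp wB.
have r0 := normc_gt0 (bisector_neq0 thb bz); set r := normc z in r0 wB *.
have h0 := mesh_gt0 k; set h := mesh k in h0 *.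
pose m := Num.max r r^-1; have m1 : 1 <= m := max_inv_ge1 r0.
have mp : 0 < m := lt_le_trans ltr01 m1.
have hm0 : 0 < h * m by rewrite mulr_gt0.
have D : normc (sgn_approx k z - sgn_bisector th z) <= C * (h * m) `^ sg.
  have [hm|hm] := leP 1 (h * m).
    apply: (@le_trans _ _ (C1 * 1)).
      rewrite mulr1; apply: (le_trans (normcDB _ _)); rewrite sgn_norm // lerD2r.
      exact: sgn_approx_le.
    apply: ler_pM => //.
    rewrite -(powRr0 (h * m)); apply: ler_powR => //; exact: ltW.
  apply: (@le_trans _ _ (2 * sgn_rate_const * (h * m))).
    apply: (le_trans (sgn_approx_sgn k bz)); rewrite -/h -/r [2 * _]mulrC -mulrA ler_wpM2l //.
    have a1 : h / r <= h * m by rewrite ler_wpM2l ?(ltW h0) // le_max lexx orbT.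
    have a2 : h * r <= h * m by rewrite ler_wpM2l ?(ltW h0) // le_max lexx.
    lra.
  apply: ler_pM => //; first exact: ltW.
  by apply: ger1_powR => //; rewrite hm0 ltW.
rewrite normcM.
apply: (@le_trans _ _ (C * (h * m) `^ sg * (B * weight s r))).
  by apply: ler_pM; rewrite ?normc_ge0.
rewrite powRM ?(ltW h0) ?(ltW mp) // weight_max // (weight_max r0 sg0) -/m.
have -> : C * (h `^ sg * m `^ sg) * (B * m `^ (- s)) = B * (C * h `^ sg) * (m `^ sg * m `^ (- s)) by ring.
apply: ler_wpM2l; first by rewrite !mulr_ge0 ?powR_ge0.
rewrite -powRD; last by rewrite (gt_eqF mp) implybT.
apply: ler_powR => //; lra.
Qed.

End Bounds.
End SignApproximation.

Section DecayClasses.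
Variable R : realType.
Implicit Types (f g : R[i] -> R[i]) (th t : R) (z : R[i]).

Lemma Hoo0P th f : 0 < th < pi / 2 -> Hoo0 th f <->
  (forall z, bisector th z -> cdiff (f : R[i] -> R[i]^o) z) /\
  exists C s : R, [/\ 0 < C, 0 < s &
    forall z, bisector th z -> normc (f z) <= C * weight s (normc z)].
Proof.
move=> tb; split=> [[[fd _] fb]|[fd fb]].
  by split=> // z /fd /derivable_cdiff.
split=> //; split=> [z /fd /derivable_cdiff //|].
case: fb => C [s [C0 s0 h]]; exists C => z bz; apply: (le_trans (h z bz)).
by rewrite ler_piMr ?(ltW C0) // weight_le1 // (normc_gt0 (bisector_neq0 tb bz)).
Qed.

Lemma Hoo0_mul th f g (M : R) : 0 < th < pi / 2 ->
  (forall z, bisector th z -> cdiff (f : R[i] -> R[i]^o) z) ->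
  (forall z, bisector th z -> normc (f z) <= M) -> Hoo0 th g -> Hoo0 th (fun z => f z * g z).
Proof.
move=> tb fd fM /(Hoo0P _ tb)[gd [C [s [C0 s0 gb]]]]; apply/(Hoo0P _ tb); split.
  by move=> z bz; apply: (@cdiffZ _ (R[i]^o)); [exact: fd|exact: gd].
exists ((`|M| + 1) * C), s; split => //; first by rewrite mulr_gt0 // ltr_wpDl.
move=> z bz; rewrite normcM -mulrA; apply: ler_pM; rewrite ?normc_ge0 ?gb //.
by apply: (le_trans (fM z bz)); apply: (le_trans (ler_norm M)); rewrite lerDl.
Qed.

Lemma Hoo0D th f g : 0 < th < pi / 2 -> Hoo0 th f -> Hoo0 th g -> Hoo0 th (fun z => f z + g z).
Proof.
move=> tb /(Hoo0P _ tb)[fd [C [s [C0 s0 fb]]]] /(Hoo0P _ tb)[gd [C' [s' [C0' s0' gb]]]].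
apply/(Hoo0P _ tb); split=> [z bz|]; first by apply: cdiffD; [exact: fd|exact: gd].
have m0 : 0 < Num.min s s' by rewrite lt_min s0.
exists (C + C'), (Num.min s s'); split; rewrite ?addr_gt0 //.
move=> z bz; have r0 := normc_gt0 (bisector_neq0 tb bz).
apply: (le_trans (normcD _ _)); rewrite mulrDl; apply: lerD.
  by apply: (le_trans (fb z bz)); rewrite ler_wpM2l ?(ltW C0) // weight_mono // ge_min lexx.
by apply: (le_trans (gb z bz)); rewrite ler_wpM2l ?(ltW C0') // weight_mono // ge_min lexx orbT.
Qed.

Lemma Hoo0Z th (a : R[i]) f : 0 < th < pi / 2 -> Hoo0 th f -> Hoo0 th (fun z => a * f z).
Proof.
move=> tb; apply: (@Hoo0_mul th (fun _ => a) f (normc a)) => // z _.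
exact: cdiff_cst.
Qed.

Lemma Hoo0_0 th : 0 < th < pi / 2 -> Hoo0 th (fun _ => 0).
Proof.
move=> tb; apply/(Hoo0P _ tb); split=> [z _|]; first exact: cdiff_cst.
by exists 1, 1; split => // z _; rewrite normc0 mul1r weight_ge0.
Qed.

Lemma Hoo0_sum th n (F : nat -> R[i] -> R[i]) : 0 < th < pi / 2 ->
  (forall j, Hoo0 th (F j)) -> Hoo0 th (fun z => \sum_(j < n) F j z).
Proof.
move=> tb h; elim: n => [|n IH].
  by have := Hoo0_0 tb; rewrite (_ : (fun _ => 0) = (fun z => \sum_(j < 0) F j z)) //;
     apply/funext => z; rewrite big_ord0.
rewrite (_ : (fun z => _) = (fun z => \sum_(j < n) F j z + F n z)); first exact: Hoo0D.
by apply/funext => z; rewrite big_ord_recr.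
Qed.

Lemma cdiff_pole (a z : R[i]) : z - a != 0 -> cdiff (fun w => (w - a)^-1 : R[i]^o) z.
Proof.
move=> za; apply: (@cdiff_inv _ (fun w => w - a)) => //.
by apply: cdiffD; [exact: cdiff_id|exact: cdiff_cst].
Qed.

Lemma cdiff_rker t z : t%:C ^+ 2 + z ^+ 2 != 0 -> cdiff (fun w => rker t w : R[i]^o) z.
Proof.
move=> dz; apply: (@cdiffZ _ (R[i]^o) (fun w => w) (fun w => (t%:C ^+ 2 + w ^+ 2)^-1)).
  exact: cdiff_id.
apply: (@cdiff_inv _ (fun w => t%:C ^+ 2 + w ^+ 2)) => //.
apply: cdiffD; first exact: cdiff_cst.
by apply: (@cdiffZ _ (R[i]^o) (fun w => w) (fun w => w)); exact: cdiff_id.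
Qed.

Lemma Hoo0_rker th t : 0 < th < pi / 2 -> t != 0 -> Hoo0 th (rker t).
Proof.
move=> tb t0; have [c0 _] := trig_pos tb; apply/(Hoo0P _ tb); split=> [z bz|].
  exact: cdiff_rker (den_neq0 tb t bz).
have t2 : 0 < t ^+ 2 by rewrite exprn_even_gt0.
exists ((cos th)^-1 * (1 + (t ^+ 2)^-1)), 1; split => //.
  by rewrite mulr_gt0 ?invr_gt0 // ltr_pwDl // invr_ge0 ltW.
move=> z bz; have r0 := normc_gt0 (bisector_neq0 tb bz); apply: (le_trans (rker_le tb t bz)).
rewrite -mulrA ler_wpM2l ?invr_ge0 ?(ltW c0) // weight1 //; set r := normc z in r0 *.
have r2 : 0 < r ^+ 2 by rewrite exprn_gt0.
have i0 : 0 < (t ^+ 2)^-1 by rewrite invr_gt0.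
have ri : 0 < r^-1 by rewrite invr_gt0.
have b1 : r / (t ^+ 2 + r ^+ 2) <= (t ^+ 2)^-1 * r.
  by rewrite mulrC ler_wpM2r ?(ltW r0) // lef_pV2 ?posrE ?addr_gt0 // lerDl ltW.
have b2 : r / (t ^+ 2 + r ^+ 2) <= r^-1.
  rewrite ler_pdivrMr ?addr_gt0 //.
  have -> : r^-1 * (t ^+ 2 + r ^+ 2) = r^-1 * t ^+ 2 + r by field; rewrite gt_eqF.
  by rewrite lerDr mulr_ge0 // ltW.
by case: (leP r r^-1) => _; nra.
Qed.

Lemma Hoo0_sgn_approx th k : 0 < th < pi / 2 -> Hoo0 th (sgn_approx k).
Proof.
move=> tb; apply: Hoo0Z => //.
apply: (@Hoo0_sum th _ (fun j z => (mesh R k)%:C * rker (node R k j) z)) => // j.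
by apply: Hoo0Z => //; apply: Hoo0_rker => //; rewrite gt_eqF // node_gt0.
Qed.

Lemma Hoo0_sgn th g : 0 < th < pi / 2 -> Hoo0 th g -> Hoo0 th (fun z => sgn_bisector th z * g z).
Proof.
move=> tb; apply: (@Hoo0_mul th _ g 1) => // z bz; last by rewrite sgn_norm.
have [r r0 h] := bisector_open tb bz.
apply: (@cdiff_near _ (R[i]^o) (fun _ => sgn_bisector th z) _ z r r0); last exact: cdiff_cst.
move=> w /h[bw sw].
by rewrite !(sgn_bisectorE tb) // sw.
Qed.

End DecayClasses.

(** * Resolvents of bisectorial operators *)

Section OperatorBasics.
Variables (R : realType).

Lemma linB (V W : lmodType R[i]) (T : V -> W) : linear T -> forall x y, T (x - y) = T x - T y.
Proof. by move=> TL x y; rewrite [x - y]addrC -scaleN1r TL scaleN1r addrC. Qed.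

Lemma lin0 (V W : lmodType R[i]) (T : V -> W) : linear T -> T 0 = 0.
Proof. by move=> /linB TB; have := TB 0 0; rewrite !subrr. Qed.

Lemma linZ (V W : lmodType R[i]) (T : V -> W) : linear T -> forall a x, T (a *: x) = a *: T x.
Proof. by move=> TL a x; have := TL a x 0; rewrite addr0 (lin0 TL) addr0. Qed.

Lemma linD (V W : lmodType R[i]) (T : V -> W) : linear T -> forall x y, T (x + y) = T x + T y.
Proof. by move=> TL x y; have := TL 1 x y; rewrite !scale1r. Qed.

Lemma bounded_linearP (V W : normedModType R[i]) (T : V -> W) :
  bounded_linear T <-> linear T /\ exists2 C : R, 0 <= C & forall x, nrm (T x) <= C * nrm x.
Proof.
split=> [[TL [M h]]|[TL [C C0 h]]]; split=> //; last first.
  by exists C => x; rewrite !normE -rmorphM lecR.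
exists `|M| => // x; have := h x; rewrite !normE -rmorphM lecR => k.
by apply: (le_trans k); rewrite ler_wpM2r ?nrm_ge0 // ler_norm.
Qed.

Lemma closureP (X : normedModType R[i]) (A : set X) x :
  closure A x <-> forall e : R, 0 < e -> exists2 a, A a & nrm (a - x) <= e.
Proof.
split=> [cx e e0|h].
  have [|a [Aa]] := cx (ball x e%:C); first by apply: nbhsx_ballx; rewrite ltcR.
  by rewrite -ball_normE /= normE ltcR nrmB => /ltW ae; exists a.
move=> B /nbhs_ballP[e]; rewrite /= ltcE /= => /andP[/eqP eI eR] eB.
have eE : e = (complex.Re e)%:C by apply/eqP; rewrite eq_complex /= eI !eqxx.
have e2 : 0 < complex.Re e / 2 by rewrite divr_gt0.
have [a Aa ax] := h _ e2; exists a; split => //; apply: eB.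
by rewrite -ball_normE /= eE normE ltcR nrmB; lra.
Qed.

Lemma closure_lim (X : normedModType R[i]) (A : set X) (u : nat -> X) x :
  (forall n, closure A (u n)) -> lim_to u x -> closure A x.
Proof.
move=> Au ux; apply/closureP => e e0; have e2 : 0 < e / 2 by rewrite divr_gt0.
have [N /(_ N (leqnn N)) h] := ux _ e2; have /closureP/(_ _ e2)[a Aa k] := Au N.
by exists a => //; apply: (le_trans (nrm_tri _ (u N) _)); lra.
Qed.

End OperatorBasics.

Section Resolvent.
Variables (R : realType) (X : completeNormedModType R[i]) (D : unbounded_operator X).
Implicit Types (x y : X) (z : R[i]).
Notation dom := (dom D).
Notation res := (resolvent D).

Lemma domZ a x : dom x -> dom (a *: x).
Proof. by move=> dx; rewrite -[a *: x]addr0; apply: dom_linear => //; exact: dom0. Qed.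

Lemma domB x y : dom x -> dom y -> dom (x - y).
Proof. by move=> dx dy; have := dom_linear (-1) dy dx; rewrite scaleN1r addrC. Qed.

Lemma opD x y : dom x -> dom y -> D (x + y) = D x + D y.
Proof. by move=> dx dy; have := opval_linear 1 dx dy; rewrite !scale1r. Qed.

Lemma op0 : D 0 = 0.
Proof. by have := opD (dom0 D) (dom0 D); rewrite addr0 => /(congr1 (fun q => q - D 0)); rewrite addrK subrr. Qed.

Lemma opZ a x : dom x -> D (a *: x) = a *: D x.
Proof. by move=> dx; have := opval_linear a dx (dom0 D); rewrite !addr0 op0 addr0. Qed.

Lemma opB x y : dom x -> dom y -> D (x - y) = D x - D y.
Proof.
by move=> dx dy; have := opval_linear (-1) dy dx; rewrite !scaleN1r [- y + _]addrC [- D y + _]addrC.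
Qed.

Lemma resolvent_uniq z x y : resolvent_set D z -> dom y -> z *: y - D y = x -> res z x = y.
Proof.
move=> [T [_ T1 T2]] dy yx; rewrite /resolvent; case: xgetP => [y' _ [dy' y'x]|/(_ y) []] //.
by rewrite -[y']T2 // y'x -yx T2.
Qed.

Section Bisectorial.
Variable w : R.
Hypothesis bw : bisectorial_type D w.

Lemma type_range : 0 < w < pi / 2.
Proof. by case: bw. Qed.

Lemma outer_resolvent z : outer w z -> resolvent_set D z.
Proof.
move=> oz; apply: contrapT => nz; case: bw => _ _ wb sp _.
exact: (outer_closure wb oz) (sp z nz).
Qed.

Lemma res_bound : exists2 M : R, 0 <= M &
  forall z x, outer w z -> nrm (res z x) <= M / normc z * nrm x.
Proof.
case: bw => _ _ wb _ [M h]; exists `|M| => // z x oz.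
have z0 := normc_gt0 (outer_neq0 oz).
have := h z (outer_closure wb oz) x; rewrite !normE -rmorphM lecR nrmZ => k.
rewrite mulrAC ler_pdivlMr // mulrC; apply: (le_trans k).
by rewrite ler_wpM2r ?nrm_ge0 // ler_norm.
Qed.

Lemma res_spec z x : resolvent_set D z -> dom (res z x) /\ z *: res z x - D (res z x) = x.
Proof.
move=> rz; have [T [_ T1 _]] := rz; have [d e] := T1 x.
by rewrite (resolvent_uniq rz d e).
Qed.

Lemma res_inv z y : resolvent_set D z -> dom y -> res z (z *: y - D y) = y.
Proof. by move=> rz dy; exact: resolvent_uniq. Qed.

Lemma D_res z x : resolvent_set D z -> D (res z x) = z *: res z x - x.
Proof.
move=> /(res_spec x)[_ e]; transitivity (z *: res z x - (z *: res z x - D (res z x))).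
  by vring.
by rewrite e.
Qed.

Lemma res_D z x : resolvent_set D z -> dom x -> res z (D x) = z *: res z x - x.
Proof.
move=> rz dx; have [T [[TL _] _ T2]] := rz.
have E u : res z u = T u.
  by have [d e] := res_spec u rz; rewrite -{2}e T2.
rewrite !E; have := T2 x dx; rewrite (linB TL) (linZ TL) => e.
transitivity (z *: T x - (z *: T x - T (D x))); first by vring.
by rewrite e.
Qed.

Lemma res_bounded z : resolvent_set D z -> bounded_linear (res z).
Proof.
move=> rz; have [T [TB _ T2]] := rz; suff -> : res z = T by [].
by apply/funext => u; have [d e] := res_spec u rz; rewrite -{2}e T2.
Qed.

Lemma res_linear z : resolvent_set D z -> linear (res z).
Proof. by move=> /res_bounded[]. Qed.

Lemma res_identity z z' x : resolvent_set D z -> resolvent_set D z' ->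
  res z x - res z' x = (z' - z) *: res z (res z' x).
Proof.
move=> rz rz'; set y := res z' x; have [dy e] := res_spec x rz'.
have -> : x = (z *: y - D y) + (z' - z) *: y by rewrite -[LHS]e /y; vring.
have rL := res_linear rz.
by rewrite (linD rL) (linZ rL) res_inv // addrAC subrr add0r.
Qed.

Lemma res_comm z z' x : resolvent_set D z -> resolvent_set D z' ->
  res z (res z' x) = res z' (res z x).
Proof.
move=> rz rz'; have [->//|zz] := eqVneq z z'.
have zz0 : z' - z != 0 by rewrite subr_eq0 eq_sym.
apply: (scalerI zz0); rewrite -res_identity //.
by rewrite -opprB (res_identity x rz' rz) -scaleNr opprB.
Qed.

Lemma res_cdiff z x : outer w z -> cdiff (fun z' => res z' x) z.
Proof.
move=> oz; have [M M0 Mb] := res_bound; have z0 := normc_gt0 (outer_neq0 oz).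
have rz := outer_resolvent oz; set n := normc z in z0.
exists (- res z (res z x)) => e e0.
have [r r0 h] := outer_open type_range oz.
pose K := M / n * (M / (n / 2) * (M / n * nrm x)).
have K0 : 0 <= K by rewrite !mulr_ge0 ?invr_ge0 ?divr_ge0 ?nrm_ge0 // ltW.
have K1 : 0 < K + 1 by rewrite ltr_wpDl.
exists (Num.min r (Num.min (n / 2) (e / (K + 1)))); first by rewrite !lt_min r0 !divr_gt0.
move=> z'; rewrite !lt_min => /andP[/h oz' /andP[z'n]]; rewrite ltr_pdivlMr // => z'e.
have rz' := outer_resolvent oz'.
have nz' : n / 2 <= normc z'.
  by have := normcDB z' (z' - z); rewrite subKr -/n; lra.
have -> : res z' x - res z x - (z' - z) *: - res z (res z x) =
   (z' - z) *: ((z' - z) *: res z (res z' (res z x))).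
  rewrite -res_identity // res_identity //; vring.
rewrite !nrmZ mulrC; apply: ler_wpM2r; first exact: normc_ge0.
apply: (@le_trans _ _ (normc (z' - z) * K)).
  rewrite ler_wpM2l ?normc_ge0 //; apply: (le_trans (Mb _ _ oz)).
  rewrite ler_wpM2l ?divr_ge0 ?(ltW z0) //; apply: (le_trans (Mb _ _ oz')).
  have n2 : 0 < n / 2 by rewrite divr_gt0.
  apply: ler_pM; rewrite ?nrm_ge0 ?divr_ge0 ?normc_ge0 //; last exact: Mb.
  by rewrite ler_wpM2l // lef_pV2 ?posrE // (lt_le_trans n2).
have := normc_ge0 (z' - z); nra.
Qed.

End Bisectorial.
End Resolvent.

(** * Contour integrals *)

Section Contour.
Variables (R : realType).

Definition along (V : normedModType R[i]) (h : R[i] -> V) (u : R[i]) (t : R) : V :=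
  u *: h (t%:C * u).

Definition has_cint (V : normedModType R[i]) (nu : R) (h : R[i] -> V) (I : V) : Prop :=
  exists I1 I2 I3 I4, [/\ iint (along h (cis (- nu))) I1, iint (along h (cis nu)) I2,
    iint (along h (- cis (- nu))) I3, iint (along h (- cis nu)) I4 &
    I = (I1 - I2) + (I3 - I4)].

Definition on_contour (nu : R) (z : R[i]) : Prop := exists2 t : R, 0 < t &
  [\/ z = t%:C * cis (- nu), z = t%:C * cis nu, z = t%:C * - cis (- nu) | z = t%:C * - cis nu].

Section Theory.
Variable V : normedModType R[i].
Implicit Types (h : R[i] -> V) (nu : R).

Lemma has_cintE nu h I : has_cint nu h I -> contour_integral nu h = I.
Proof.
move=> [I1 [I2 [I3 [I4 [h1 h2 h3 h4 ->]]]]]; rewrite /contour_integral /ray_integral.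
by rewrite (iintE h1) (iintE h2) (iintE h3) (iintE h4).
Qed.

Lemma has_cint_unique nu h I J : has_cint nu h I -> has_cint nu h J -> I = J.
Proof. by move=> /has_cintE <- /has_cintE <-. Qed.

Lemma has_cint_ext nu h h' I : (forall z, on_contour nu z -> h z = h' z) ->
  has_cint nu h I -> has_cint nu h' I.
Proof.
move=> hh [I1 [I2 [I3 [I4 [h1 h2 h3 h4 ->]]]]]; exists I1, I2, I3, I4.
by split=> //; [apply: iint_ext h1|apply: iint_ext h2|apply: iint_ext h3|apply: iint_ext h4];
  move=> t t0; rewrite /along hh //; exists t => //; [exact: Or41|exact: Or42|exact: Or43|exact: Or44].
Qed.

Lemma has_cintD nu h h' I J : has_cint nu h I -> has_cint nu h' J ->
  has_cint nu (fun z => h z + h' z) (I + J).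
Proof.
move=> [I1 [I2 [I3 [I4 [h1 h2 h3 h4 ->]]]]] [J1 [J2 [J3 [J4 [k1 k2 k3 k4 ->]]]]].
exists (I1 + J1), (I2 + J2), (I3 + J3), (I4 + J4); split; last vring.
- by apply: iint_ext (iintD h1 k1) => t _; rewrite /along scalerDr.
- by apply: iint_ext (iintD h2 k2) => t _; rewrite /along scalerDr.
- by apply: iint_ext (iintD h3 k3) => t _; rewrite /along scalerDr.
- by apply: iint_ext (iintD h4 k4) => t _; rewrite /along scalerDr.
Qed.

Lemma has_cint_map (W : normedModType R[i]) (T : V -> W) nu h I : bounded_linear T ->
  has_cint nu h I -> has_cint nu (fun z => T (h z)) (T I).
Proof.
move=> /bounded_linearP[TL [C _ TC]] [I1 [I2 [I3 [I4 [h1 h2 h3 h4 ->]]]]].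
exists (T I1), (T I2), (T I3), (T I4); split; last by rewrite (linD TL) !(linB TL).
- by apply: iint_ext (iint_map TL TC h1) => t _; rewrite /along (linZ TL).
- by apply: iint_ext (iint_map TL TC h2) => t _; rewrite /along (linZ TL).
- by apply: iint_ext (iint_map TL TC h3) => t _; rewrite /along (linZ TL).
- by apply: iint_ext (iint_map TL TC h4) => t _; rewrite /along (linZ TL).
Qed.

Lemma has_cintZ nu h I (a : R[i]) : has_cint nu h I -> has_cint nu (fun z => a *: h z) (a *: I).
Proof.
apply: (@has_cint_map _ (fun x => a *: x)); apply/bounded_linearP; split.
  by move=> c x y; vring.
by exists (normc a); [exact: normc_ge0|move=> x; rewrite nrmZ].
Qed.

End Theory.

Lemma cisN (t : R) : - cis (- t) = cis (pi - t) /\ - cis t = cis (- (pi - t)).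
Proof.
split; apply/eqP; rewrite eq_complex /= ?cosN ?sinN cosB sinB cospi sinpi; apply/andP; split; apply/eqP; ring.
Qed.

Lemma on_contour_bisector (nu th : R) z : 0 < nu -> nu < th -> th < pi / 2 ->
  on_contour nu z -> bisector th z.
Proof.
move=> n0 nt tp [t t0]; have tb : 0 < th < pi / 2 by apply/andP; split; lra.
have n1 : `|nu| < th by rewrite gtr0_norm.
have n2 : `|- nu| < th by rewrite normrN.
case=> ->; [left|left|right|right]; rewrite ?mulrN; try exact: ray_sector.
  by exists (t%:C * cis (- nu)) => //; exact: ray_sector.
by exists (t%:C * cis nu) => //; exact: ray_sector.
Qed.

Lemma upper_outer (w nu t phi : R) : 0 < w -> w < nu -> nu < pi / 2 -> 0 < t ->
  nu <= phi <= pi - nu -> outer w (t%:C * cis phi).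
Proof.
move=> w0 wn np t0 /andP[p1 p2]; have := pi_gt0 R => pp.
apply: ray_outer => //; first by apply/andP; split; lra.
  by rewrite gtr0_norm; lra.
by rewrite gtr0_norm; lra.
Qed.

Lemma outerN (w : R) z : outer w z -> outer w (- z).
Proof. by rewrite /outer; case: z => x y /=; rewrite !normrN. Qed.

Lemma on_contour_outer (w nu : R) z : 0 < w -> w < nu -> nu < pi / 2 ->
  on_contour nu z -> outer w z.
Proof.
move=> w0 wn np [t t0]; have pp := pi_gt0 R.
have u1 : outer w (t%:C * cis nu) by apply: (@upper_outer w nu) => //; apply/andP; split; lra.
have u2 : outer w (t%:C * - cis (- nu)).
  by rewrite (cisN nu).1; apply: (@upper_outer w nu) => //; apply/andP; split; lra.
case=> ->; rewrite ?mulrN //.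
- by rewrite -[cis (- nu)]opprK mulrN; exact: outerN.
- by rewrite -mulrN.
- exact: outerN.
Qed.

Lemma contour_curve (nu : R) u : u = cis (- nu) \/ u = cis nu \/ u = - cis (- nu) \/ u = - cis nu ->
  normc u = 1.
Proof. by case=> [->|[->|[->|->]]]; rewrite ?normcopp normc_cis. Qed.

(** Integrands with an integrable weight along the contour. *)
Lemma has_cint_exists (V : completeNormedModType R[i]) (h : R[i] -> V) (nu C s : R) :
  0 <= C -> 0 < s -> (forall z, on_contour nu z -> ccont h z) ->
  (forall z, on_contour nu z -> nrm (h z) <= C * weight s (normc z) / normc z) ->
  exists2 I, has_cint nu h I & nrm I <= 8 * C / s.
Proof.
move=> C0 s0 hc hb.
have ray u : u = cis (- nu) \/ u = cis nu \/ u = - cis (- nu) \/ u = - cis nu ->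
    exists2 I, iint (along h u) I & nrm I <= 2 * C / s.
  move=> uE; have u1 := contour_curve uE.
  have onc t : 0 < t -> on_contour nu (t%:C * u).
    by move=> t0; exists t => //; case: uE => [->|[->|[->|->]]]; [exact: Or41|exact: Or42|exact: Or43|exact: Or44].
  have cu : curve (fun t => t%:C * u) (fun _ => u) 1 by apply: curve_ray; rewrite u1.
  apply: iint_exists => // t t0; first by apply: (cont_at_line cu); apply: hc; exact: onc.
  rewrite /along nrmZ u1 mul1r; have := hb _ (onc t t0).
  by rewrite normcM u1 mulr1 normcR gtr0_norm.
have [I1 h1 b1] := ray _ (or_introl erefl).
have [I2 h2 b2] := ray _ (or_intror (or_introl erefl)).
have [I3 h3 b3] := ray _ (or_intror (or_intror (or_introl erefl))).
have [I4 h4 b4] := ray _ (or_intror (or_intror (or_intror erefl))).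
exists ((I1 - I2) + (I3 - I4)); first by exists I1, I2, I3, I4.
have := nrmD (I1 - I2) (I3 - I4); have := nrmDB I1 I2; have := nrmDB I3 I4.
have -> : 8 * C / s = 4 * (2 * C / s) by ring.
lra.
Qed.

(** Both sectors have Cauchy's theorem, so integrands that are holomorphic
    inside the bisector integrate to zero. *)
Lemma has_cint_inside (V : completeNormedModType R[i]) (G : R[i] -> V) (nu th C s : R) :
  0 < nu -> nu < th -> th < pi / 2 -> 0 <= C -> 0 < s ->
  (forall z, bisector th z -> cdiff G z) ->
  (forall z, bisector th z -> nrm (G z) <= C * weight s (normc z) / normc z) ->
  has_cint nu G 0.
Proof.
move=> n0 nt tp C0 s0 Gd Gb; have tb : 0 < th < pi / 2 by apply/andP; split; lra.
have [||I [I1 [I2 [I3 [I4 [h1 h2 h3 h4 _]]]]] _] := has_cint_exists (nu := nu) (h := G) C0 s0.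
- by move=> z /(on_contour_bisector n0 nt tp)/Gd/cdiff_ccont.
- by move=> z /(on_contour_bisector n0 nt tp)/Gb.
exists I1, I2, I3, I4; split => //.
have nn : - nu <= nu by lra.
have inb t phi : 0 < t -> - nu <= phi <= nu -> bisector th (t%:C * cis phi).
  by move=> t0 /andP[p1 p2]; left; apply: ray_sector => //; rewrite ltr_norml; lra.
have nr t phi : 0 < t -> normc (t%:C * cis phi) = t.
  by move=> t0; rewrite normcM normc_cis mulr1 normcR gtr0_norm.
have -> : I1 = I2.
  apply: (sector_Cauchy nn C0 s0 _ _ h1 h2) => t phi t0 ph; first by apply: Gd; exact: inb.
  by have := Gb _ (inb t phi t0 ph); rewrite nr.
have opp u J : iint (along G (- u)) J -> iint (fun t => u *: G (- (t%:C * u))) (- J).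
  move=> /(iintZ (-1)); rewrite scaleN1r; apply: iint_ext => t _.
  by rewrite /along mulrN !scaleNr scale1r opprK.
have : - I3 = - I4.
  apply: (sector_Cauchy nn C0 s0 (G := fun z => G (- z)) _ _ (opp _ _ h3) (opp _ _ h4)) => t phi t0 ph.
    by apply: cdiff_opp; apply: Gd; apply/bisectorN => //; rewrite ?opprK; exact: inb.
  have /Gb : bisector th (- (t%:C * cis phi)) by apply/bisectorN => //; rewrite ?opprK; exact: inb.
  by rewrite normcopp nr.
by move=> /oppr_inj ->; rewrite !subrr addr0.
Qed.

(** The integral of [i t / (z^2 + t^2)] along a ray of the right half-plane
    becomes, after rotation, the limit of [Theta]. *)
Lemma iint_pole (V : normedModType R[i]) (v : V) (phi th t : R) : `|phi| < th -> th < pi / 2 -> 0 < t ->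
  iint (along (fun z => ('i * t%:C / (t%:C ^+ 2 + z ^+ 2)) *: v) (cis phi)) (('i * (pi / 2)%:C) *: v).
Proof.
move=> pt tp t0; set u := cis phi.
have tb : 0 < th < pi / 2 by have := normr_ge0 phi; lra.
pose z := t%:C * cis (- phi).
have bz : bisector th z by left; apply: ray_sector => //; rewrite normrN.
have [c0 s0] := trig_pos tb.
have x0 : 0 < complex.Re z.
  have sz : sector th z by apply: ray_sector => //; rewrite normrN.
  have /(sectorP _ tb) h := sz.
  by rewrite -(pmulr_lgt0 _ s0) (le_lt_trans _ h) // mulr_ge0 // ltW.
have uu : u * cis (- phi) = 1.
  apply/eqP; rewrite eq_complex /= cosN sinN; have := cos2Dsin2 phi.
  by rewrite !expr2 mulrN opprK => ->; rewrite eqxx /=; apply/eqP; ring.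
have u0 : u != 0.
  apply/eqP => uz; have := normc_cis phi; rewrite -/u uz normc0 => /eqP.
  by rewrite eq_sym oner_eq0.
have zu : z = t%:C / u.
  by rewrite /z; congr (_ * _); apply: (mulfI u0); rewrite uu mulfV.
have r0 := normc_gt0 (bisector_neq0 tb bz).
have lim0 q : 0 <= q -> normc (Theta z q) <= (cos th)^-1 * (normc z)^-1 * q.
  move=> q0; have := uprim_const_le q0 (Theta_uprim 0 q x0).
  move=> /(_ ((cos th)^-1 * (normc z)^-1)); rewrite (Theta0 x0) !subr0 normcE; apply.
  move=> q' _; rewrite normcE; apply: (le_trans (rker_le tb q' bz)).
  rewrite ler_wpM2l ?invr_ge0 ?(ltW c0) //; set r := normc z in r0 *.
  have q2 : 0 <= q' ^+ 2 by exact: sqr_ge0.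
  have d0 : 0 < q' ^+ 2 + r ^+ 2 by rewrite ltr_wpDl // exprn_gt0.
  rewrite ler_pdivrMr //; have -> : r^-1 * (q' ^+ 2 + r ^+ 2) = r^-1 * q' ^+ 2 + r.
    by field; rewrite gt_eqF.
  by rewrite lerDr mulr_ge0 // invr_ge0 ltW.
have n0 := nrm_ge0 v.
have ni : normc ('i : R[i]) = 1 by rewrite /normc /= expr0n /= add0r expr1n sqrtr1.
exists (fun s => ('i * Theta z s) *: v); split.
- move=> a b a0.
  have vB (q : R[i]^o) : nrm (('i * q) *: v) <= nrm v * nrm q.
    by rewrite nrmZ normcM ni mul1r mulrC normcE.
  have vL : linear (fun q : R[i]^o => ('i * q) *: v).
    by move=> k p q; rewrite /GRing.scale /=; vring.
  apply: uprim_ext (uprim_map vL vB (Theta_uprim a b x0)) => s /andP[s1 _].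
  have sp : 0 < s := lt_le_trans a0 s1.
  rewrite /along scalerA /rker zu; congr (_ *: _).
  have d1 : t%:C ^+ 2 + (s%:C * u) ^+ 2 != 0.
    by apply: (den_neq0 tb); left; exact: ray_sector.
  set d := _ + _ in d1 *; have -> : s%:C ^+ 2 + (t%:C / u) ^+ 2 = d / u ^+ 2 by rewrite /d; field.
  by clearbody d; field; rewrite d1 u0.
- move=> e e0; pose K := (cos th)^-1 * (normc z)^-1 * nrm v.
  have K0 : 0 <= K by rewrite !mulr_ge0 ?invr_ge0 // ltW.
  have K1 : 0 < K + 1 by rewrite ltr_wpDl.
  exists (e / (K + 1)); first by rewrite divr_gt0.
  move=> s /andP[sp]; rewrite ler_pdivlMr // => se.
  rewrite nrmZ normcM ni mul1r; apply: (@le_trans _ _ ((cos th)^-1 * (normc z)^-1 * s * nrm v)).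
    by rewrite ler_wpM2r // lim0 // ltW.
  have -> : (cos th)^-1 * (normc z)^-1 * s * nrm v = s * K by rewrite /K; ring.
  lra.
- move=> e e0; have v1 : 0 < nrm v + 1 by rewrite ltr_wpDl.
  have [T hT] := Theta_limit x0 (divr_gt0 e0 v1).
  exists (Num.max T 1); first by rewrite lt_max ltr01 orbT.
  move=> s; rewrite ge_max => /andP[/hT h _].
  rewrite -scalerBl -mulrBr nrmZ normcM ni mul1r.
  apply: (@le_trans _ _ (e / (nrm v + 1) * nrm v)); first by rewrite ler_wpM2r.
  rewrite mulrAC ler_pdivrMr // ler_wpM2l ?(ltW e0) // lerDl //.
Qed.

End Contour.

(** * The functional calculus *)

Section Calculus.
Variables (R : realType) (X : completeNormedModType R[i]) (D : unbounded_operator X).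
Variables (w : R).
Hypothesis bw : bisectorial_type D w.
Implicit Types (x y : X) (z : R[i]) (f g : R[i] -> R[i]) (t : R).
Notation res := (resolvent D).
Let w0 : 0 < w. Proof. by case/andP: (type_range bw). Qed.

Definition contour_const : R[i] := (2%:R * 'i%C * (pi : R)%:C)^-1.

Lemma fcalc_has nu f x I : has_cint nu (fun z => f z *: res z x) I ->
  fcalc D nu f x = contour_const *: I.
Proof. by move=> h; rewrite /fcalc (has_cintE h). Qed.

(** The value of [rker t] at [D], through the resolvents at its two poles; that it is the
    contour integral is [fcalc_rker]. *)
Definition rD (t : R) (x : X) : X :=
  (- 2^-1 : R[i]) *: (res (t%:C * 'i) x + res ((- t)%:C * 'i) x).

Lemma outer_i t : t != 0 -> outer w (t%:C * 'i).
Proof. by move=> t0; apply: outer_imaginary => //; exact: type_range bw. Qed.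

Lemma rD_bounded t : t != 0 -> bounded_linear (rD t).
Proof.
move=> t0; have o1 := outer_resolvent bw (outer_i t0).
have o2 : resolvent_set D ((- t)%:C * 'i).
  by apply: (outer_resolvent bw); apply: outer_i; rewrite oppr_eq0.
have /bounded_linearP[L1 [C1 C10 h1]] := res_bounded o1.
have /bounded_linearP[L2 [C2 C20 h2]] := res_bounded o2.
apply/bounded_linearP; split.
  by move=> a x y; rewrite /rD L1 L2; vring.
exists (normc (- 2^-1 : R[i]) * (C1 + C2)).
  by rewrite mulr_ge0 ?normc_ge0 // addr_ge0.
move=> x; rewrite /rD nrmZ -mulrA ler_wpM2l ?normc_ge0 //.
by apply: (le_trans (nrmD _ _)); rewrite mulrDl lerD.
Qed.

Section Angle.
Variables (nu th : R).
Hypotheses (wn : w < nu) (nt : nu < th) (tp : th < pi / 2).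
Let n0 : 0 < nu. Proof. exact: lt_trans wn. Qed.
Let np : nu < pi / 2. Proof. exact: lt_trans tp. Qed.
Let tb : 0 < th < pi / 2. Proof. by rewrite tp andbT (lt_trans n0). Qed.
Let c0 : 0 < cos th. Proof. by have [] := trig_pos tb. Qed.

Let onb z : on_contour nu z -> bisector th z.
Proof. exact: on_contour_bisector. Qed.
Let ono z : on_contour nu z -> outer w z.
Proof. exact: on_contour_outer. Qed.
Let onr z : on_contour nu z -> resolvent_set D z.
Proof. by move=> /ono; exact: outer_resolvent. Qed.

Lemma fcalc_estimate s : 0 < s -> exists2 K : R, 0 <= K & forall f C x, Hoo0 th f -> 0 <= C ->
  (forall z, bisector th z -> normc (f z) <= C * weight s (normc z)) ->
  exists I, [/\ has_cint nu (fun z => f z *: res z x) I, fcalc D nu f x = contour_const *: I &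
    nrm (fcalc D nu f x) <= K * C * nrm x].
Proof.
move=> s0; have [M M0 Mb] := res_bound bw.
exists (normc contour_const * (8 * M / s)).
  by rewrite mulr_ge0 ?normc_ge0 // divr_ge0 ?(ltW s0) // mulr_ge0.
move=> f C x /(Hoo0P _ tb)[fd _] C0 fb.
have [||||I hI bI] := @has_cint_exists R X (fun z => f z *: res z x) nu (C * M * nrm x) s.
- by rewrite !mulr_ge0 ?nrm_ge0.
- by [].
- move=> z oz; apply: cdiff_ccont; apply: cdiffZ; first by apply: fd; exact: onb.
  by apply: (res_cdiff bw); exact: ono.
- move=> z oz; rewrite nrmZ.
  have -> : C * M * nrm x * weight s (normc z) / normc z =
    C * weight s (normc z) * (M / normc z * nrm x) by ring.
  by apply: ler_pM; rewrite ?normc_ge0 ?nrm_ge0 // ?fb ?Mb //; [exact: onb|exact: ono].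
exists I; split => //; first exact: fcalc_has.
rewrite (fcalc_has hI) nrmZ -!mulrA ler_wpM2l ?normc_ge0 //.
by apply: (le_trans bI); rewrite le_eqVlt; apply/orP; left; apply/eqP; ring.
Qed.

Lemma fcalcP f x : Hoo0 th f -> exists2 I, has_cint nu (fun z => f z *: res z x) I &
  fcalc D nu f x = contour_const *: I.
Proof.
move=> hf; have /(Hoo0P _ tb)[fd [C [s [C0 s0 fb]]]] := hf.
have [K _ /(_ f C x hf (ltW C0) fb)[I [h1 h2 _]]] := fcalc_estimate s0.
by exists I.
Qed.

Lemma fcalc_ext f g x : Hoo0 th f -> (forall z, bisector th z -> f z = g z) ->
  fcalc D nu f x = fcalc D nu g x.
Proof.
move=> hf fg; have [I hI ->] := fcalcP x hf.
by rewrite (fcalc_has (has_cint_ext _ hI)) // => z /onb/fg ->.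
Qed.

Lemma fcalcD f g x : Hoo0 th f -> Hoo0 th g ->
  fcalc D nu (fun z => f z + g z) x = fcalc D nu f x + fcalc D nu g x.
Proof.
move=> hf hg; have [I hI ->] := fcalcP x hf; have [J hJ ->] := fcalcP x hg.
rewrite -scalerDr; apply: fcalc_has; apply: has_cint_ext (has_cintD hI hJ) => z _.
by rewrite scalerDl.
Qed.

Lemma fcalcZ a f x : Hoo0 th f -> fcalc D nu (fun z => a * f z) x = a *: fcalc D nu f x.
Proof.
move=> hf; have [I hI ->] := fcalcP x hf; rewrite scalerA mulrC -scalerA.
by apply: fcalc_has; apply: has_cint_ext (has_cintZ a hI) => z _; rewrite scalerA.
Qed.

Lemma fcalc0 x : fcalc D nu (fun _ => 0) x = 0.
Proof.
have := fcalcZ 0 x (Hoo0_0 tb); rewrite scale0r => <-; congr (fcalc D nu _ x).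
by apply/funext => z; rewrite mul0r.
Qed.

Lemma fcalc_sum n (F : nat -> R[i] -> R[i]) x : (forall j, Hoo0 th (F j)) ->
  fcalc D nu (fun z => \sum_(j < n) F j z) x = \sum_(j < n) fcalc D nu (F j) x.
Proof.
move=> hF; elim: n => [|n IH].
  by rewrite big_ord0 -[RHS](fcalc0 x); congr (fcalc D nu _ x); apply/funext => z; rewrite big_ord0.
rewrite big_ord_recr /= -IH -fcalcD //; last exact: Hoo0_sum.
by congr (fcalc D nu _ x); apply/funext => z; rewrite big_ord_recr.
Qed.

Let pole_bound t z : t != 0 -> bisector th z ->
  [/\ z - t%:C * 'i != 0, normc ((z - t%:C * 'i)^-1) <= ((cos th) * `|t|)^-1 &
      normc ((z - t%:C * 'i)^-1) <= ((cos th) * normc z)^-1].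
Proof.
move=> t0 bz; have [p1 p2] := pole_ge tb t bz.
have t1 : 0 < cos th * `|t| by rewrite mulr_gt0 ?normr_gt0.
have z1 : 0 < cos th * normc z by rewrite mulr_gt0 // (normc_gt0 (bisector_neq0 tb bz)).
have N0 := lt_le_trans t1 p2.
split; first by apply/eqP => e; move: N0; rewrite e normc0 ltxx.
  by rewrite normcV lef_pV2.
by rewrite normcV lef_pV2.
Qed.

Lemma Hoo0_pole t g : t != 0 -> Hoo0 th g -> Hoo0 th (fun z => (z - t%:C * 'i)^-1 * g z).
Proof.
move=> t0; apply: (Hoo0_mul (M := (cos th * `|t|)^-1) tb) => z bz.
  by apply: cdiff_pole; have [] := pole_bound t0 bz.
by have [] := pole_bound t0 bz.
Qed.

(** By the resolvent identity [R(m) R(z) = (R(m) - R(z)) / (z - m)], and the term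
    with [R(m)] integrates to zero by Cauchy's theorem. *)
Lemma res_fcalc t g x : t != 0 -> Hoo0 th g ->
  res (t%:C * 'i) (fcalc D nu g x) = - fcalc D nu (fun z => (z - t%:C * 'i)^-1 * g z) x.
Proof.
move=> t0 hg; set m := t%:C * 'i; have rm := outer_resolvent bw (outer_i t0).
have [TL _] := res_bounded rm; have [I hI ->] := fcalcP x hg.
have [J hJ ->] := fcalcP x (Hoo0_pole t0 hg).
rewrite (linZ TL) -scalerN; congr (_ *: _).
have h1 := has_cint_map (res_bounded rm) hI.
have h2 : has_cint nu (fun z => ((z - m)^-1 * g z) *: res m x) 0.
  have /(Hoo0P _ tb)[_ [C [s [C0 s0 gb]]]] := hg.
  apply: (has_cint_inside n0 nt tp (C := C / cos th * nrm (res m x)) _ s0).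
  - by rewrite mulr_ge0 ?nrm_ge0 // divr_ge0 // ltW.
  - move=> z bz; apply: (@cdiffZ _ _ (fun z => (z - m)^-1 * g z)); last exact: cdiff_cst.
    by have /(Hoo0P _ tb)[h _] := Hoo0_pole t0 hg; exact: h.
  - move=> z bz; rewrite nrmZ normcM.
    have -> : C / cos th * nrm (res m x) * weight s (normc z) / normc z =
      ((cos th)^-1 * (normc z)^-1) * (C * weight s (normc z)) * nrm (res m x) by ring.
    rewrite ler_wpM2r ?nrm_ge0 //; apply: ler_pM; rewrite ?normc_ge0 ?gb //.
    by have [_ _] := pole_bound t0 bz; rewrite invfM.
have := has_cintD h2 (has_cintZ (-1) hJ); rewrite add0r scaleN1r => h3.
apply: has_cint_unique h1 (has_cint_ext _ h3) => z oz.
have [zm _ _] := pole_bound t0 (onb oz).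
rewrite (linZ TL) scaleN1r mulrC -!scalerA -scalerN -scalerDr -scalerBr; congr (_ *: _).
by rewrite (res_identity x rm (onr oz)) scalerA mulVf // scale1r.
Qed.

(** Decompose [rker t] into partial fractions and use [res_fcalc] at both poles. *)
Lemma rD_fcalc t g x : t != 0 -> Hoo0 th g ->
  rD t (fcalc D nu g x) = fcalc D nu (fun z => rker t z * g z) x.
Proof.
move=> t0 hg; have tN : - t != 0 by rewrite oppr_eq0.
rewrite /rD !res_fcalc // -opprD -fcalcD; try exact: Hoo0_pole.
rewrite scaleNr scalerN opprK -fcalcZ; last by apply: Hoo0D; [|exact: Hoo0_pole|exact: Hoo0_pole].
have hp := Hoo0_pole t0 hg; have hn := Hoo0_pole tN hg.
apply: fcalc_ext; first exact: (Hoo0Z _ tb (Hoo0D tb hp hn)).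
move=> z bz; rewrite -mulrDl mulrA; congr (_ * _).
have [p1 _ _] := pole_bound t0 bz; have [p2 _ _] := pole_bound tN bz.
rewrite /rker den_factor; move: p1 p2; rewrite rmorphN mulNr opprK => p1 p2.
by field; rewrite p1 p2.
Qed.

(** Near its pole at [m = sg t i], the function [rker t z *: R(z) x] differs from
    [m / (t^2 + z^2) *: R(m) x] by a function that is holomorphic on the whole sector
    between the two rays of the contour that surround [m]. *)
Lemma half_residue t (sg : R) x I J : 0 < t -> sg ^+ 2 = 1 ->
  iint (along (fun z => rker t z *: res z x) (sg%:C * cis nu)) I ->
  iint (along (fun z => rker t z *: res z x) (sg%:C * cis (pi - nu))) J ->
  I - J = ('i * pi%:C) *: res ((sg * t)%:C * 'i) x.
Proof.
move=> t0 sg2 hI hJ.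
have ss : sg%:C * sg%:C = 1 :> R[i] by rewrite -rmorphM -expr2 sg2.
have sgP : sg = 1 \/ sg = -1.
  have : (sg - 1) * (sg + 1) == 0 by rewrite -subr_sqr sg2 expr1n subrr.
  by rewrite mulf_eq0 subr_eq0 addr_eq0 => /orP[/eqP->|/eqP->]; [left|right].
have sgn0 : `|sg| = 1 by apply/eqP; rewrite -(@eqrXn2 _ 2) // real_normK ?num_real // sg2 expr1n.
have ncs (z : R[i]) : normc (sg%:C * z) = normc z by rewrite normcM normcR sgn0 mul1r.
have sgz : sg != 0 by rewrite -normr_gt0 sgn0.
have st0 : sg * t != 0 by rewrite mulf_neq0 // gt_eqF.
set m := (sg * t)%:C * 'i; have rm := outer_resolvent bw (outer_i st0).
have mE : m = sg%:C * (t%:C * 'i) by rewrite /m rmorphM mulrA.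
set p := res m x; pose v := m *: p - x.
pose c z : X := (m / (t%:C ^+ 2 + z ^+ 2)) *: p.
pose F z : X := rker t z *: res z x - c z.
pose H z : X := - ((sg%:C * z + m)^-1 *: res (sg%:C * z) v).
have m2 : m * m = - t%:C ^+ 2.
  have i2 : 'i * 'i = -1 :> R[i] by rewrite -expr2 sqr_i.
  rewrite mE; transitivity (sg%:C * sg%:C * (t%:C * t%:C) * ('i * 'i) : R[i]); first by ring.
  rewrite ss i2; ring.
have HF z : resolvent_set D (sg%:C * z) -> t%:C ^+ 2 + (sg%:C * z) ^+ 2 != 0 ->
    H z = F (sg%:C * z).
  set z1 := sg%:C * z => rz d1; rewrite /H /F /c /rker -/z1.
  have dE : t%:C ^+ 2 + z1 ^+ 2 = (z1 - m) * (z1 + m).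
    by rewrite -[t%:C ^+ 2]opprK -m2; ring.
  have := d1; rewrite dE mulf_eq0 negb_or => /andP[d2 d3].
  have rx : res z1 x = p + (m - z1) *: res z1 p.
    by rewrite -(res_identity x rz rm) addrC subrK.
  have rL := res_linear rz; rewrite /v (linB rL) (linZ rL) rx.
  set A := res z1 p.
  have -> : (z1 / ((z1 - m) * (z1 + m))) *: (p + (m - z1) *: A) - (m / ((z1 - m) * (z1 + m))) *: p =
    ((z1 - m) * ((z1 - m) * (z1 + m))^-1) *: (p - z1 *: A) by vring.
  rewrite invfM mulrA mulfV // mul1r; vring.
have pp := pi_gt0 R.
have up tau phi : 0 < tau -> nu <= phi <= pi - nu ->
    [/\ outer w (sg%:C * (tau%:C * cis phi)), normc (tau%:C * cis phi) = tau &
        tau <= normc (sg%:C * (tau%:C * cis phi) + m) /\ t <= normc (sg%:C * (tau%:C * cis phi) + m)].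
  move=> tau0 ph; have o := upper_outer w0 wn np tau0 ph; have /andP[ph1 ph2] := ph.
  have nE : normc (tau%:C * cis phi) = tau by rewrite normcM normc_cis mulr1 normcR gtr0_norm.
  split=> //.
    have [->|->] := sgP.
    + by rewrite mul1r.
    + by rewrite rmorphN rmorph1 mulN1r; exact: outerN.
  rewrite mE -mulrDr ncs; set z := tau%:C * cis phi in nE *.
  have Im0 : 0 <= complex.Im z.
    rewrite /z /= mul0r addr0 mulr_ge0 ?(ltW tau0) //.
    by have := n0; move=> nu0; apply: sin_ge0_pi; lra.
  have := normc_pole (- t) z; rewrite rmorphN mulNr opprK nE => e.
  have tI : 0 <= t * complex.Im z by rewrite mulr_ge0 // ltW.
  have {}e : normc (z + t%:C * 'i) ^+ 2 = tau ^+ 2 + 2 * (t * complex.Im z) + t ^+ 2 by rewrite e; ring.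
  have q1 := sqr_ge0 t; have q2 := sqr_ge0 tau.
  have N0 := normc_ge0 (z + t%:C * 'i).
  by split; rewrite -ler_sqr ?nnegrE // ?e ?(ltW t0) ?(ltW tau0) //; lra.
have [M M0 Mb] := res_bound bw.
pose C2 := M * nrm v; pose C1 := 2 * M * nrm x / t ^+ 2 + 2 * nrm p / t.
have C20 : 0 <= C2 by rewrite mulr_ge0 ?nrm_ge0.
have t2 : 0 < t ^+ 2 by rewrite exprn_gt0.
have C10 : 0 <= C1.
  by rewrite addr_ge0 // divr_ge0 ?(ltW t0) ?(ltW t2) // !mulr_ge0 // nrm_ge0.
have C40 : 0 <= 4 * C2 / t ^+ 2 by rewrite divr_ge0 ?(ltW t2) // mulr_ge0.
pose C := C1 + 4 * C2 / t ^+ 2 + C2.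
have C0 : 0 <= C by exact: addr_ge0 (addr_ge0 C10 C40) C20.
have bH tau phi : 0 < tau -> nu <= phi <= pi - nu ->
    nrm (H (tau%:C * cis phi)) <= C * weight 1 tau / tau.
  move=> tau0 ph; have [oz nE [b1 b2]] := up _ _ tau0 ph; set z := tau%:C * cis phi in oz nE b1 b2 *.
  have tau2 : 0 < tau ^+ 2 by rewrite exprn_gt0.
  have B1 : nrm (H z) <= C2 / tau ^+ 2.
    rewrite /H nrmN nrmZ normcV.
    have -> : C2 / tau ^+ 2 = tau^-1 * (M / tau * nrm v) by rewrite /C2; field; rewrite gt_eqF.
    apply: ler_pM; rewrite ?invr_ge0 ?normc_ge0 ?nrm_ge0 //.
      by rewrite lef_pV2 ?posrE // (lt_le_trans tau0).
    by have := Mb _ v oz; rewrite ncs nE.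
  have B2 : nrm (H z) <= C1 + 4 * C2 / t ^+ 2.
    have [tt|tt] := leP (t / 2) tau.
      apply: (le_trans B1); apply: ler_wpDl => //.
      rewrite ler_pdivrMr // mulrAC ler_pdivlMr //.
      have q : t ^+ 2 <= 4 * tau ^+ 2.
        have : (t / 2) ^+ 2 <= tau ^+ 2 by rewrite ler_sqr ?nnegrE ?divr_ge0 // ltW.
        have -> : (t / 2) ^+ 2 = t ^+ 2 / 4 by field.
        lra.
      by have := ler_wpM2l C20 q; lra.
    apply: ler_wpDr => //.
    have d0 : t ^+ 2 / 2 <= normc (t%:C ^+ 2 + (sg%:C * z) ^+ 2).
      have := normcDB (t%:C ^+ 2 + (sg%:C * z) ^+ 2) ((sg%:C * z) ^+ 2).
      rewrite addrK !normcX ncs nE normcR gtr0_norm //.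
      have : tau ^+ 2 <= (t / 2) ^+ 2 by rewrite ler_sqr ?nnegrE ?divr_ge0 // ltW.
      have -> : (t / 2) ^+ 2 = t ^+ 2 / 4 by field.
      lra.
    have d1 : 0 < normc (t%:C ^+ 2 + (sg%:C * z) ^+ 2) by apply: lt_le_trans d0; rewrite divr_gt0.
    have di : normc ((t%:C ^+ 2 + (sg%:C * z) ^+ 2)^-1) <= 2 / t ^+ 2.
      rewrite normcV; have -> : 2 / t ^+ 2 = (t ^+ 2 / 2)^-1 by field; rewrite gt_eqF.
      by rewrite lef_pV2 ?posrE // divr_gt0.
    rewrite HF; last 2 first.
    - exact: (outer_resolvent bw).
    - by apply/eqP => e; move: d1; rewrite e normc0 ltxx.
    apply: (le_trans (nrmDB _ _)); apply: lerD; rewrite nrmZ normcM ?ncs ?nE.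
      have -> : 2 * M * nrm x / t ^+ 2 = (tau * (2 / t ^+ 2)) * (M / tau * nrm x).
        by field; rewrite !gt_eqF.
      apply: ler_pM; rewrite ?mulr_ge0 ?normc_ge0 ?nrm_ge0 ?(ltW tau0) //.
        by rewrite ler_wpM2l // ltW.
      by have := Mb _ x oz; rewrite ncs nE.
    have -> : normc m = t.
      by rewrite mE ncs normcM normcR gtr0_norm // /normc /= expr0n /= add0r expr1n sqrtr1 mulr1.
    have -> : 2 * nrm p / t = t * (2 / t ^+ 2) * nrm p by field; rewrite gt_eqF.
    by rewrite ler_wpM2r ?nrm_ge0 // ler_wpM2l // ltW.
  rewrite weight1 //; case: (leP tau tau^-1) => [h|h].
    rewrite mulfK ?gt_eqF // (le_trans B2) // lerDl //.
  apply: (le_trans B1); have -> : C * tau^-1 / tau = C / tau ^+ 2 by field; rewrite gt_eqF.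
  by rewrite ler_wpM2r ?invr_ge0 ?(ltW tau2) // lerDr addr_ge0.
have nn : nu <= pi - nu by have := np; lra.
have cH tau phi : 0 < tau -> nu <= phi <= pi - nu -> cdiff H (tau%:C * cis phi).
  move=> tau0 ph; have [oz nE [b1 b2]] := up _ _ tau0 ph.
  have sL : cdiff (fun z => sg%:C * z : R[i]^o) (tau%:C * cis phi).
    by apply: (@cdiffZ _ (R[i]^o) (fun _ => sg%:C) (fun z => z)); [exact: cdiff_cst|exact: cdiff_id].
  have e1 : cdiff (fun z => (sg%:C * z + m)^-1 : R[i]^o) (tau%:C * cis phi).
    apply: (@cdiff_inv _ (fun z => sg%:C * z + m)); last by apply: cdiffD => //; exact: cdiff_cst.
    by apply/eqP => e; move: b1; rewrite e normc0 leNgt tau0.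
  have e2 : cdiff (fun z => res (sg%:C * z) v) (tau%:C * cis phi).
    have [d hd] := res_cdiff bw v oz; exists (sg%:C *: d) => e /hd[r r0 hr]; exists r => // z zr.
    have E : sg%:C * z - sg%:C * (tau%:C * cis phi) = sg%:C * (z - tau%:C * cis phi) by ring.
    have := hr (sg%:C * z); rewrite E ncs => /(_ zr).
    by rewrite [sg%:C * (z - _)]mulrC -scalerA.
  have := cdiffZ (cdiff_cst (-1 : R[i]^o) _) (cdiffZ e1 e2).
  by apply: cdiff_ext => z; rewrite scaleN1r.
(* the explicit part, along the rays with direction [s1 cis phi] *)
have hc (s1 : R) phi : s1 ^+ 2 = 1 -> `|phi| < th ->
    iint (along c (s1%:C * cis phi)) ((s1 * sg)%:C *: (('i * (pi / 2)%:C) *: p)).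
  move=> s12 ph; have := iintZ (s1 * sg)%:C (iint_pole p ph tp t0).
  apply: iint_ext => s sp; rewrite /along /c mE.
  have -> : (s%:C * (s1%:C * cis phi)) ^+ 2 = (s%:C * cis phi) ^+ 2.
    have e1 : s1%:C * s1%:C = 1 :> R[i] by rewrite -rmorphM -expr2 s12.
    by transitivity ((s1%:C * s1%:C) * (s%:C * cis phi) ^+ 2 : R[i]); [ring|rewrite e1 mul1r].
  rewrite rmorphM /=; vring.
have onc s (e : R[i]) : 0 < s -> e = sg%:C * cis nu \/ e = sg%:C * cis (pi - nu) ->
    on_contour nu (s%:C * e).
  move=> sp; rewrite -(cisN nu).1 => he; exists s => //; move: he.
  have [->|->] := sgP.
    by rewrite !mul1r => -[->|->]; [exact: Or42|exact: Or43].
  by rewrite rmorphN rmorph1 !mulN1r opprK => -[->|->]; [exact: Or44|exact: Or41].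
have hH (u : R[i]) K L : (forall s, 0 < s -> on_contour nu (s%:C * (sg%:C * u))) ->
    iint (along (fun z => rker t z *: res z x) (sg%:C * u)) K -> iint (along c (sg%:C * u)) L ->
    iint (fun s => u *: H (s%:C * u)) (sg%:C *: (K - L)).
  move=> ou hK hL; apply: iint_ext (iintZ sg%:C (iintB hK hL)) => s sp.
  rewrite /along -scalerBr scalerA mulrA ss mul1r; congr (_ *: _).
  have E : sg%:C * (s%:C * u) = s%:C * (sg%:C * u) by ring.
  rewrite HF E //; first by apply: onr; exact: ou.
  by apply: (den_neq0 tb); apply: onb; exact: ou.
have n1 : `|nu| < th by rewrite gtr0_norm.
have n2 : `|- nu| < th by rewrite normrN.
have sgN : (- sg) ^+ 2 = 1 by rewrite sqrrN.
have k1 := hH _ _ _ (fun s sp => onc s _ sp (or_introl erefl)) hI (hc sg nu sg2 n1).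
have hc2 : iint (along c (sg%:C * cis (pi - nu))) ((- sg * sg)%:C *: (('i * (pi / 2)%:C) *: p)).
  have := hc (- sg) (- nu) sgN n2; rewrite -(cisN nu).1.
  by rewrite rmorphN mulNr mulrN.
have k2 := hH _ _ _ (fun s sp => onc s _ sp (or_intror erefl)) hJ hc2.
have := sector_Cauchy nn C0 ltr01 cH bH k1 k2.
move=> /(congr1 (fun q => sg%:C *: q)); rewrite !scalerA ss !scale1r.
have -> : (- sg * sg)%:C = -1 :> R[i] by rewrite mulNr -expr2 sg2 rmorphN rmorph1.
have -> : (sg * sg)%:C = 1 :> R[i] by rewrite -expr2 sg2.
have -> : ('i * pi%:C) *: p = 2%:R *: (('i * (pi / 2)%:C) *: p).
  rewrite scalerA; congr (_ *: _).
  have -> : pi%:C = 2 * (pi / 2)%:C :> R[i] by rewrite -(rmorph_nat (real_complex R) 2) -rmorphM mulrC divfK.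
  by ring.
set cc := 'i * (pi / 2)%:C => e.
have -> : I - J = (I - (1 * cc) *: p) - (J - (-1 * cc) *: p) + 2%:R *: (cc *: p) by vring.
by rewrite e subrr add0r.
Qed.

(** The two pairs of rays that surround the poles [t i] and [- t i] contribute half a
    resolvent each. *)
Lemma fcalc_rker t x : 0 < t -> fcalc D nu (rker t) x = rD t x.
Proof.
move=> t0; have [I hI ->] := fcalcP x (Hoo0_rker tb (lt0r_neq0 t0)).
case: hI => [I1 [I2 [I3 [I4 [h1 h2 h3 h4 ->]]]]].
have e1 : I2 - I3 = ('i * pi%:C) *: res (t%:C * 'i) x.
  have := @half_residue t 1 x I2 I3 t0; rewrite expr1n !mul1r -(cisN nu).1; exact.
have e2 : I4 - I1 = ('i * pi%:C) *: res ((- t)%:C * 'i) x.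
  have := @half_residue t (-1) x I4 I1 t0; rewrite sqrrN expr1n rmorphN rmorph1 !mulN1r -(cisN nu).1 opprK.
  exact.
have -> : I1 - I2 + (I3 - I4) = - ((I2 - I3) + (I4 - I1)) by vring.
rewrite e1 e2 -scalerDr -scaleNr scalerA /rD; congr (_ *: _).
have i0 : ('i : R[i]) != 0 by apply/eqP => /eqP; rewrite eq_complex /= oner_eq0 andbF.
have p0 : pi%:C != 0 :> R[i].
  by apply/eqP => /complexI /eqP; rewrite gt_eqF // pi_gt0.
by rewrite /contour_const -mulrA invfM mulrN -mulrA mulVf ?mulr1 // mulf_neq0.
Qed.

(** The value of [sgn_approx k] at [D]. *)
Definition sgnD (k : nat) (x : X) : X :=
  (2 / pi)%:C *: \sum_(j < 4 ^ k) (mesh R k)%:C *: rD (node R k j) x.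

Lemma fcalc_sgn_approx k x : fcalc D nu (sgn_approx k) x = sgnD k x.
Proof.
have hr j : Hoo0 th (rker (node R k j)) by apply: Hoo0_rker => //; rewrite gt_eqF // node_gt0.
rewrite /sgn_approx fcalcZ; last first.
  by apply: (@Hoo0_sum R th _ (fun j z => (mesh R k)%:C * rker (node R k j) z)) => // j; exact: Hoo0Z.
rewrite (@fcalc_sum _ (fun j z => (mesh R k)%:C * rker (node R k j) z)); last by move=> j; exact: Hoo0Z.
congr (_ *: _); apply: eq_bigr => j _; rewrite fcalcZ // fcalc_rker //.
exact: node_gt0.
Qed.

Lemma sgnD_fcalc k g x : Hoo0 th g ->
  sgnD k (fcalc D nu g x) = fcalc D nu (fun z => sgn_approx k z * g z) x.
Proof.
move=> hg; have nz j : node R k j != 0 by rewrite gt_eqF // node_gt0.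
have hr j : Hoo0 th (fun z => rker (node R k j) z * g z).
  have [c C1] : exists2 M : R, 0 <= M & forall z, bisector th z -> normc (rker (node R k j) z) <= M.
    have [[_ [M h]] _] := Hoo0_rker tb (nz j); exists `|M| => // z /h.
    by move=> h'; apply: le_trans h' (ler_norm M).
  move=> rb; apply: (Hoo0_mul tb _ rb hg) => z bz.
  by apply: cdiff_rker; exact: (den_neq0 tb).
have E : (fun z => sgn_approx k z * g z) =
    (fun z => (2 / pi)%:C * \sum_(j < 4 ^ k) (mesh R k)%:C * (rker (node R k j) z * g z)).
  apply/funext => z; rewrite /sgn_approx -mulrA mulr_suml; congr (_ * _).
  by apply: eq_bigr => j _; rewrite mulrA.
rewrite E fcalcZ; last first.
  by apply: (@Hoo0_sum R th _ (fun j z => (mesh R k)%:C * (rker (node R k j) z * g z))) => // j; exact: Hoo0Z.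
rewrite (@fcalc_sum _ (fun j z => (mesh R k)%:C * (rker (node R k j) z * g z))); last by move=> j; exact: Hoo0Z.
rewrite /sgnD; congr (_ *: _); apply: eq_bigr => j _; rewrite fcalcZ //.
by rewrite rD_fcalc.
Qed.

(** This is where the decay of [g] turns pointwise approximation of the sign into
    norm convergence, through the absolutely convergent contour integral. *)
Lemma sgnD_lim g x : Hoo0 th g ->
  lim_to (fun k => sgnD k (fcalc D nu g x)) (fcalc D nu (fun z => sgn_bisector th z * g z) x).
Proof.
move=> hg; have /(Hoo0P _ tb)[gd [C [s [C0 s0 gb]]]] := hg.
have [sg [K [sg0 K0 h]]] := sgn_approx_weighted tb s0.
have [L L0 hL] := fcalc_estimate sg0.
have hs := Hoo0_sgn tb hg.
have ha k : Hoo0 th (fun z => sgn_approx k z * g z).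
  have /(Hoo0P _ tb)[ad _] := Hoo0_sgn_approx k tb.
  exact: (Hoo0_mul tb ad (fun z => sgn_approx_le tb k (z := z)) hg).
have hd k : Hoo0 th (fun z => (sgn_approx k z - sgn_bisector th z) * g z).
  have := Hoo0D tb (ha k) (Hoo0Z (-1) tb hs).
  by congr (Hoo0 th _); apply/funext => z; ring.
have est k : nrm (sgnD k (fcalc D nu g x) - fcalc D nu (fun z => sgn_bisector th z * g z) x) <=
    L * C * K * nrm x * mesh R k `^ sg.
  have := fcalcD x (ha k) (Hoo0Z (-1) tb hs); rewrite (fcalcZ _ _ hs) scaleN1r -sgnD_fcalc // => <-.
  rewrite (_ : (fun z => _) = (fun z => (sgn_approx k z - sgn_bisector th z) * g z)); last first.
    by apply/funext => z; ring.
  have B0 : 0 <= C * (K * mesh R k `^ sg) by rewrite !mulr_ge0 ?powR_ge0 // ltW.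
  have [I [_ _]] := hL _ _ x (hd k) B0 (fun z bz => h k z (g z) C bz (ltW C0) (gb z bz)).
  by congr (_ <= _); ring.
move=> e e0; have Q0 : 0 <= L * C * K * nrm x by rewrite !mulr_ge0 ?nrm_ge0 // ltW.
have Q1 : 0 < L * C * K * nrm x + 1 by rewrite ltr_wpDl.
have [d d0 hd'] := powR_small sg0 (divr_gt0 e0 Q1); have [N hN] := mesh_small d0.
exists N => k /hN kd; apply: (le_trans (est k)).
have : mesh R k `^ sg <= e / (L * C * K * nrm x + 1) by apply: hd'; rewrite kd ltW // mesh_gt0.
rewrite ler_pdivlMr // => q; have := powR_ge0 (mesh R k) sg; lra.
Qed.

End Angle.
End Calculus.

(** * Splitting off the kernel *)

Lemma dense_approx (R : realType) (V : normedModType R[i]) (A : set V) x (e : R) :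
  dense A -> 0 < e -> exists2 a, A a & nrm (a - x) <= e.
Proof.
move=> dA e0; have nb : nbhs x (ball x e%:C) by apply: nbhsx_ballx; rewrite ltcR.
have [|a [Oa Aa]] := dA ((ball x e%:C)^°) _ (open_interior _).
  by exists x; exact: nbhs_singleton (nbhs_interior nb).
exists a => //; have := interior_subset Oa; rewrite -ball_normE /= normE ltcR nrmB.
exact: ltW.
Qed.

Section StrongLimits.
Variables (R : realType) (X : completeNormedModType R[i]).

Lemma strong_lim0 (T : nat -> X -> X) (M : R) x :
  (forall n a b, T n (a - b) = T n a - T n b) -> (forall n a, nrm (T n a) <= M * nrm a) ->
  (forall e : R, 0 < e -> exists2 a, nrm (a - x) <= e & lim_to (T^~ a) 0) ->
  lim_to (T^~ x) 0.
Proof.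
move=> TB TM h e e0; have M1 : 0 < `|M| + 1 by rewrite ltr_wpDl.
have e2 : 0 < e / 2 by rewrite divr_gt0.
have [a ax /(_ _ e2)[N hN]] := h _ (divr_gt0 e2 M1); exists N => n /hN; rewrite !subr0 => k.
have -> : T n x = T n a - T n (a - x) by rewrite TB subKr.
apply: (le_trans (nrmDB _ _)).
have : nrm (T n (a - x)) <= e / 2.
  apply: (le_trans (TM _ _)); apply: (@le_trans _ _ ((`|M| + 1) * nrm (a - x))).
    by rewrite ler_wpM2r ?nrm_ge0 // (le_trans (ler_norm M)) // lerDl.
  by rewrite mulrC -ler_pdivlMr.
lra.
Qed.

(** Uniformly bounded operators that converge on a dense set converge everywhere. *)
Lemma strong_cauchy (T : nat -> X -> X) (M : R) x :
  (forall n a b, T n (a - b) = T n a - T n b) -> (forall n a, nrm (T n a) <= M * nrm a) ->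
  (forall e : R, 0 < e -> exists2 a, nrm (a - x) <= e & exists l, lim_to (T^~ a) l) ->
  exists l, lim_to (T^~ x) l.
Proof.
move=> TB TM h; apply: cauchy_lim_to => e e0; have M1 : 0 < `|M| + 1 by rewrite ltr_wpDl.
have e4 : 0 < e / 4 by rewrite divr_gt0.
have [a ax [l /(_ _ e4)[N hN]]] := h _ (divr_gt0 e4 M1); exists N => n m /hN kn /hN km.
have bd j : nrm (T j (a - x)) <= e / 4.
  apply: (le_trans (TM _ _)); apply: (@le_trans _ _ ((`|M| + 1) * nrm (a - x))).
    by rewrite ler_wpM2r ?nrm_ge0 // (le_trans (ler_norm M)) // lerDl.
  by rewrite mulrC -ler_pdivlMr.
have E j : T j x = T j a - T j (a - x) by rewrite TB subKr.
have -> : T n x - T m x = (T n a - l) - (T m a - l) - (T n (a - x) - T m (a - x)).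
  by rewrite !E; vring.
have := bd n; have := bd m.
have := nrmDB (T n a - l - (T m a - l)) (T n (a - x) - T m (a - x)).
have := nrmDB (T n a - l) (T m a - l); have := nrmDB (T n (a - x)) (T m (a - x)).
lra.
Qed.

End StrongLimits.

Section Splitting.
Variables (R : realType) (X : completeNormedModType R[i]) (D : unbounded_operator X).
Implicit Types (x y p : X) (z : R[i]).
Notation res := (resolvent D).
Notation Y := (closure (Ran D)).
Variable w : R.
Hypothesis bw : bisectorial_type D w.

Lemma Ran_linear a x y : Ran D x -> Ran D y -> Ran D (a *: x + y).
Proof.
move=> [u du <-] [v dv <-]; exists (a *: u + v); first exact: dom_linear.
exact: opval_linear.
Qed.

Lemma Y_linear a x y : Y x -> Y y -> Y (a *: x + y).
Proof.
move=> /closureP xc /closureP yc; apply/closureP => e e0.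
have a1 : 0 < normc a + 1 by rewrite ltr_wpDl // normc_ge0.
have e2 : 0 < e / 2 by rewrite divr_gt0.
have [u Ru ux] := xc _ (divr_gt0 e2 a1); have [v Rv vy] := yc _ e2.
exists (a *: u + v); first exact: Ran_linear.
have -> : a *: u + v - (a *: x + y) = a *: (u - x) + (v - y) by vring.
apply: (le_trans (nrmD _ _)); rewrite nrmZ; move: ux; rewrite ler_pdivlMr // => ux.
by have := nrm_ge0 (u - x); lra.
Qed.

Lemma Y0 : Y 0.
Proof. by apply: subset_closure; exists 0; [exact: dom0|exact: op0]. Qed.

Lemma Y_Z a x : Y x -> Y (a *: x).
Proof. by move=> Yx; rewrite -[a *: x]addr0; apply: Y_linear Yx Y0. Qed.

Lemma Y_D x y : Y x -> Y y -> Y (x + y).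
Proof. by move=> Yx Yy; rewrite -[x]scale1r; exact: Y_linear. Qed.

Lemma Y_B x y : Y x -> Y y -> Y (x - y).
Proof. by move=> Yx Yy; have := @Y_linear (-1) _ _ Yy Yx; rewrite scaleN1r addrC. Qed.

Lemma Y_res z x : resolvent_set D z -> Y x -> Y (res z x).
Proof.
move=> rz /closureP xc; have /bounded_linearP[TL [C C0 TC]] := res_bounded rz.
have C1 : 0 < C + 1 by rewrite ltr_wpDl.
apply/closureP => e e0; have [u [v dv vu] ux] := xc _ (divr_gt0 e0 C1).
exists (res z u).
  rewrite -vu res_D //; exists (res z v); last by rewrite D_res.
  by have [] := res_spec v rz.
rewrite -(linB TL) (le_trans (TC _)) //; move: ux; rewrite ler_pdivlMr // => ux.
by have := nrm_ge0 (u - x); lra.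
Qed.

Lemma Ker_resE z p : resolvent_set D z -> Ker D p <-> z *: res z p = p.
Proof.
move=> rz; split=> [[dp Dp]|e].
  by apply/eqP; rewrite -subr_eq0 -res_D // Dp (lin0 (res_linear rz)).
have [d _] := res_spec p rz.
have dp : dom D p by rewrite -e; exact: domZ.
split=> //; have := D_res p rz; rewrite e subrr => e0.
by rewrite -e opZ // e0 scaler0.
Qed.

Lemma Ker_linear a x y : Ker D x -> Ker D y -> Ker D (a *: x + y).
Proof.
move=> [dx Dx] [dy Dy]; split; first exact: dom_linear.
by rewrite opval_linear // Dx Dy scaler0 addr0.
Qed.

Lemma res_i (t : R) : t != 0 -> resolvent_set D (t%:C * 'i).
Proof. by move=> t0; apply: (outer_resolvent bw); exact: (outer_i bw). Qed.

Let r1 : resolvent_set D ((1 : R)%:C * 'i).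
Proof. exact: res_i (oner_neq0 R). Qed.

Lemma Ker_lim u p : (forall n, Ker D (u n)) -> lim_to u p -> Ker D p.
Proof.
move=> Ku up; apply/(Ker_resE _ r1).
have /bounded_linearP[TL [C C0 TC]] := res_bounded r1.
have := lim_toZ ((1 : R)%:C * 'i) (lim_to_map (linB TL) TC up).
move=> h; apply: lim_to_unique h _; apply: eq_lim_to up => n.
by have /(Ker_resE _ r1) -> := Ku n.
Qed.

Lemma Ker_res z p : resolvent_set D z -> Ker D p -> Ker D (res z p).
Proof.
move=> rz /(Ker_resE _ r1) e; apply/(Ker_resE _ r1).
by rewrite (res_comm _ r1 rz) -(linZ (res_linear rz)) e.
Qed.

(** [z R(z)] with [z = 2 ^- n i]: it fixes the kernel and tends to zero on the
    range, hence singles out the kernel component. *)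
Definition ker_approx (n : nat) (x : X) : X :=
  ((mesh R n)%:C * 'i) *: res ((mesh R n)%:C * 'i) x.

Let rn n : resolvent_set D ((mesh R n)%:C * 'i).
Proof. by apply: res_i; rewrite gt_eqF // mesh_gt0. Qed.

Let normc_i (t : R) : normc (t%:C * 'i) = `|t|.
Proof. by rewrite normcM normcR /normc /= expr0n /= add0r expr1n sqrtr1 mulr1. Qed.

Lemma ker_approxB n x y : ker_approx n (x - y) = ker_approx n x - ker_approx n y.
Proof. by rewrite /ker_approx (linB (res_linear (rn n))) scalerBr. Qed.

Lemma scaled_res_bound : exists2 M : R, 0 <= M &
  forall (t : R) x, t != 0 -> nrm ((t%:C * 'i) *: res (t%:C * 'i) x) <= M * nrm x.
Proof.
have [M M0 h] := res_bound bw; exists M => // t x t0.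
have := h _ x (outer_i bw t0); rewrite normc_i nrmZ normc_i => k.
have tp : 0 < `|t| by rewrite normr_gt0.
apply: (@le_trans _ _ (`|t| * (M / `|t| * nrm x))); first by rewrite ler_wpM2l // ltW.
by rewrite le_eqVlt; apply/orP; left; apply/eqP; field; rewrite gt_eqF.
Qed.

Lemma ker_approx_bound : exists2 M : R, 0 <= M & forall n x, nrm (ker_approx n x) <= M * nrm x.
Proof.
have [M M0 h] := scaled_res_bound; exists M => // n x; apply: h.
by rewrite gt_eqF // mesh_gt0.
Qed.

Lemma mesh_lim0 (K : R) (u : nat -> X) : 0 <= K -> (forall n, nrm (u n) <= mesh R n * K) -> lim_to u 0.
Proof.
move=> K0 h e e0; have K1 : 0 < K + 1 by rewrite ltr_wpDl.
have [N hN] := mesh_small (divr_gt0 e0 K1); exists N => n /hN; rewrite subr0 ler_pdivlMr // => k.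
apply: (le_trans (h n)); have := mesh_gt0 R n; lra.
Qed.

Lemma ker_approx_Y y : Y y -> lim_to (ker_approx^~ y) 0.
Proof.
have [M M0 h] := ker_approx_bound.
move=> /closureP yc; apply: (strong_lim0 ker_approxB h) => e /yc[a [u du Du] ay]; exists a => //.
apply: (@mesh_lim0 ((M + 1) * nrm u)); first by rewrite mulr_ge0 ?nrm_ge0 // addr_ge0.
move=> n; rewrite -Du /ker_approx (res_D (rn n) du) -/(ker_approx n u) nrmZ normc_i.
rewrite ger0_norm ?(ltW (mesh_gt0 R n)) // ler_wpM2l ?(ltW (mesh_gt0 R n)) //.
by apply: (le_trans (nrmDB _ _)); rewrite mulrDl mul1r lerD.
Qed.

Lemma ker_approx_K p : Ker D p -> forall n, ker_approx n p = p.
Proof. by move=> Kp n; apply/(Ker_resE _ (rn n)). Qed.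

Lemma ker_approx_lim x p : Ker D p -> Y (x - p) -> lim_to (ker_approx^~ x) p.
Proof.
move=> Kp Yxp; have := lim_toD (ker_approx_Y Yxp) (lim_to_cst p); rewrite add0r.
by apply: eq_lim_to => n; rewrite ker_approxB (ker_approx_K Kp) subrK.
Qed.

Hypothesis split_dom : forall x, dom D x -> exists2 p, Ker D p & Y (x - p).

Lemma dense_dom x : forall e : R, 0 < e -> exists2 a, dom D a & nrm (a - x) <= e.
Proof. by move=> e e0; have [_ dD _ _ _] := bw; exact: dense_approx. Qed.

(** The kernel components of vectors of the domain that approximate [x] are a Cauchy
    sequence, being limits of uniformly bounded operators. *)
Lemma split_all x : exists2 p, Ker D p & Y (x - p).
Proof.
have [M M0 h] := ker_approx_bound.
have ex (n : nat) : exists ap : X * X, [/\ dom D ap.1, nrm (ap.1 - x) <= n.+1%:R^-1, Ker D ap.2 & Y (ap.1 - ap.2)].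
  have [|a da ax] := @dense_dom x n.+1%:R^-1; first by rewrite invr_gt0.
  by have [p Kp Yp] := split_dom da; exists (a, p).
have [s /all_and4[s1 s2 s3 s4]] := choice ex.
have la : lim_to (fun n => (s n).1) x.
  move=> e e0; have [N] := @exists_mesh R 1 e ler01 e0; rewrite div1r => hN; exists N => n Nn.
  apply: (le_trans (s2 n)); apply: le_trans (ltW hN).
  by rewrite lef_pV2 ?posrE // ler_nat.
have pB n m : nrm ((s n).2 - (s m).2) <= M * nrm ((s n).1 - (s m).1).
  have L := lim_toB (ker_approx_lim (s3 n) (s4 n)) (ker_approx_lim (s3 m) (s4 m)).
  by apply: (lim_to_le L) => k; rewrite -ker_approxB.
have [p hp] : exists p, lim_to (fun n => (s n).2) p.
  apply: cauchy_lim_to => e e0; have M1 : 0 < M + 1 by rewrite ltr_wpDl.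
  have e2 : 0 < e / (M + 1) / 2 by rewrite !divr_gt0.
  have [N hN] := la _ e2; exists N => n m /hN kn /hN km.
  apply: (le_trans (pB n m)); apply: (@le_trans _ _ ((M + 1) * nrm ((s n).1 - (s m).1))).
    by rewrite ler_wpM2r ?nrm_ge0 // lerDl.
  rewrite mulrC -ler_pdivlMr //; apply: (le_trans (nrm_tri _ x _)); rewrite (nrmB x); lra.
exists p; first exact: Ker_lim s3 hp.
by apply: closure_lim s4 _; exact: lim_toB la hp.
Qed.

Lemma kernel_projection : exists P : X -> X, [/\ bounded_linear P, forall x, Ker D (P x),
  forall x, Y (x - P x), forall x p, Ker D p -> Y (x - p) -> P x = p &
  forall z x, resolvent_set D z -> P (res z x) = res z (P x)].
Proof.
have [P PK] := choice (fun x => let: ex_intro2 p h1 h2 := split_all x in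
  ex_intro (fun p => Ker D p /\ Y (x - p)) p (conj h1 h2)).
have P1 x : Ker D (P x) by case: (PK x).
have P2 x : Y (x - P x) by case: (PK x).
have PU x p : Ker D p -> Y (x - p) -> P x = p.
  move=> Kp Yp; exact: lim_to_unique (ker_approx_lim (P1 x) (P2 x)) (ker_approx_lim Kp Yp).
have [M M0 h] := ker_approx_bound.
exists P; split => //.
  apply/bounded_linearP; split; last first.
    by exists M => // x; apply: (lim_to_le (ker_approx_lim (P1 x) (P2 x))) => n; exact: h.
  move=> a x y; apply: PU; first exact: Ker_linear.
  have -> : a *: x + y - (a *: P x + P y) = a *: (x - P x) + (y - P y) by vring.
  exact: Y_linear.
move=> z x rz; apply: PU; first exact: Ker_res.
by rewrite -(linB (res_linear rz)); exact: (Y_res rz (P2 x)).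
Qed.

End Splitting.

(** * The sign of a bisectorial operator *)

Section SignOperator.
Variables (R : realType) (X : completeNormedModType R[i]) (D : unbounded_operator X).
Implicit Types (x y p : X) (z : R[i]).
Notation res := (resolvent D).
Notation Y := (closure (Ran D)).
Variable w0 : R.
Hypothesis bw0 : bisectorial_type D w0.

Lemma type_below nu : omega_bi D < nu -> exists2 w, bisectorial_type D w & w < nu.
Proof.
have hi : has_inf [set w | bisectorial_type D w].
  split; first by exists w0.
  by exists 0 => v [_ _ /andP[v0 _] _ _]; exact: ltW.
rewrite -subr_gt0 => h; have [v bv vn] := inf_adherent h hi.
by exists v => //; move: vn; rewrite -/(omega_bi D) addrC subrK.
Qed.

Lemma omega_ge0 : 0 <= omega_bi D.
Proof.
apply: lb_le_inf; first by exists w0.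
by move=> v [_ _ /andP[v0 _] _ _]; exact: ltW.
Qed.

Lemma rD_linear t : t != 0 -> linear (rD D t).
Proof. by move=> t0; have [] := rD_bounded bw0 t0. Qed.

Let ri (t : R) : t != 0 -> resolvent_set D (t%:C * 'i).
Proof. exact: res_i bw0 _. Qed.

Lemma rD_Ker t p : t != 0 -> Ker D p -> rD D t p = 0.
Proof.
move=> t0 Kp; have tN : - t != 0 by rewrite oppr_eq0.
have /(Ker_resE _ (ri t0)) e1 := Kp; have /(Ker_resE _ (ri tN)) e2 := Kp.
have m0 : t%:C * 'i != 0 :> R[i] := outer_neq0 (outer_i bw0 t0).
apply: (scalerI m0); rewrite scaler0 /rD scalerA mulrC -scalerA scalerDr e1.
move: e2; rewrite rmorphN mulNr scaleNr => e2.
have -> : (t%:C * 'i) *: res (- (t%:C * 'i)) p = - p by rewrite -[in RHS]e2 opprK.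
by rewrite subrr scaler0.
Qed.

Lemma Y_rD t y : t != 0 -> Y y -> Y (rD D t y).
Proof.
move=> t0 Yy; have tN : - t != 0 by rewrite oppr_eq0.
by apply: Y_Z; apply: Y_D; apply: Y_res => //; exact: ri.
Qed.

(** [i t R(i t)] tends strongly to the identity. *)
Lemma scaled_res_lim (s : R) x : `|s| = 1 ->
  lim_to (fun n => ((s * (mesh R n)^-1)%:C * 'i) *: res ((s * (mesh R n)^-1)%:C * 'i) x) x.
Proof.
move=> s1; have [M M0 h] := scaled_res_bound bw0; have [M' M0' h'] := res_bound bw0.
have sn n : s * (mesh R n)^-1 != 0.
  by rewrite mulf_neq0 ?invr_eq0 ?(gt_eqF (mesh_gt0 R n)) // -normr_gt0 s1.
have ns n : `|s * (mesh R n)^-1| = (mesh R n)^-1.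
  by rewrite normrM s1 mul1r ger0_norm // invr_ge0 ltW // mesh_gt0.
pose T n x := ((s * (mesh R n)^-1)%:C * 'i) *: res ((s * (mesh R n)^-1)%:C * 'i) x - x.
have T0 : lim_to (T^~ x) 0.
  apply: (@strong_lim0 _ _ T (M + 1)).
  - by move=> n a b; rewrite /T (linB (res_linear (ri (sn n)))); vring.
  - by move=> n a; apply: (le_trans (nrmDB _ _)); rewrite mulrDl mul1r lerD // h.
  move=> e e0; have [a da ax] := dense_dom bw0 x e0; exists a => //.
  apply: (@mesh_lim0 _ _ (M' * nrm (D a))); first by rewrite mulr_ge0 ?nrm_ge0.
  move=> n; rewrite /T -(res_D (ri (sn n)) da); apply: (le_trans (h' _ _ (outer_i bw0 (sn n)))).
  rewrite normcM normcR ns /normc /= expr0n /= add0r expr1n sqrtr1 mulr1 invrK.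
  by rewrite mulrA [M' * _]mulrC.
by have := lim_toD T0 (lim_to_cst x); rewrite add0r; apply: eq_lim_to => n; rewrite /T subrK.
Qed.

(** [t^2 r_t(D) x] is a product of two scaled resolvents applied to [D x], hence close
    to [D x] for large [t]. *)
Lemma rD_product t x : t != 0 -> dom D x ->
  (t ^+ 2)%:C *: rD D t x = (t%:C * 'i) *: res (t%:C * 'i) (((- t)%:C * 'i) *: res ((- t)%:C * 'i) (D x)).
Proof.
move=> t0 dx; have tN : - t != 0 by rewrite oppr_eq0.
rewrite (res_D (ri tN) dx); set m := t%:C * 'i.
have mN : (- t)%:C * 'i = - m :> R[i] by rewrite rmorphN mulNr.
have rL := res_linear (ri t0); rewrite -/m in rL.
rewrite /rD -/m mN (linZ rL) (linB rL) (linZ rL).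
have m0 : m != 0 := outer_neq0 (outer_i bw0 t0).
have rN : resolvent_set D (- m) by rewrite -mN; exact: ri.
have e := res_identity x (ri t0) rN; rewrite -/m in e.
have -> : res m (res (- m) x) = (- m - m)^-1 *: (res m x - res (- m) x).
  by rewrite e scalerA mulVf ?scale1r // -opprD oppr_eq0 -mulr2n mulrn_eq0.
have i2 : 'i * 'i = -1 :> R[i] by rewrite -expr2 sqr_i.
have m2 : (t ^+ 2)%:C = - (m * m).
  rewrite rmorphXn /=; transitivity (- (t%:C * t%:C * ('i * 'i)) : R[i]); last by rewrite /m; ring.
  by rewrite i2; ring.
rewrite m2; set A := res m x; set B := res (- m) x.
have half : - m * (- m - m)^-1 = 2^-1 :> R[i].
  have d0 : - m - m != 0 by rewrite -opprD oppr_eq0 -mulr2n mulrn_eq0.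
  by apply: (mulIf d0); rewrite divfK //; field.
have -> : m *: (- m *: (- m *: ((- m - m)^-1 *: (A - B)) - A)) =
  m *: (- m *: ((- m * (- m - m)^-1) *: (A - B) - A)) by vring.
rewrite half; have h2 : (2^-1 : R[i]) + 2^-1 = 1 by field.
have -> : 2^-1 *: (A - B) - A = 2^-1 *: (A - B) - (2^-1 *: A + 2^-1 *: A).
  by rewrite -[in RHS]scalerDl h2 scale1r.
by vring.
Qed.

Hypothesis split_dom : forall x, dom D x -> exists2 p, Ker D p & Y (x - p).

Lemma rD_dense y (e : R) : Y y -> 0 < e ->
  exists t y', [/\ 0 < t, Y y' & nrm (rD D t y' - y) <= e].
Proof.
move=> /closureP yc e0; have e2 : 0 < e / 2 by rewrite divr_gt0.
have [_ [u du <-] uy] := yc _ e2.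
have [p Kp Yp] := split_all bw0 split_dom u; have [dp Dp] := Kp.
have dup : dom D (u - p) by exact: domB.
have Dup : D (u - p) = D u by rewrite opB // Dp subr0.
pose t n := (mesh R n)^-1.
have tp n : 0 < t n by rewrite invr_gt0 mesh_gt0.
have tn n : t n != 0 by rewrite gt_eqF.
have one : `|1 : R| = 1 by rewrite normr1.
have oneN : `|-1 : R| = 1 by rewrite normrN normr1.
have [M M0 h] := scaled_res_bound bw0.
have l1 := scaled_res_lim (D u) one; have l2 := scaled_res_lim (D u) oneN.
have L : lim_to (fun n => rD D (t n) ((t n ^+ 2)%:C *: (u - p))) (D u).
  move=> q q0; have M1 : 0 < M + 1 by rewrite ltr_wpDl.
  have q2 : 0 < q / 2 by rewrite divr_gt0.
  have [N1 h1] := l1 _ q2; have [N2 h2] := l2 _ (divr_gt0 q2 M1).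
  exists (maxn N1 N2) => n; rewrite geq_max => /andP[/h1 {}h1 /h2 {}h2].
  rewrite (linZ (rD_linear (tn n))) (rD_product (tn n) dup) Dup.
  move: h1 h2; rewrite mul1r mulN1r -/(t n).
  set B := ((- t n)%:C * 'i) *: _ => h1 h2; set m := (t n)%:C * 'i in h1 *.
  have -> : m *: res m B - D u = m *: res m (B - D u) + (m *: res m (D u) - D u).
    by rewrite (linB (res_linear (ri (tn n)))); vring.
  apply: (le_trans (nrmD _ _)); have := h (t n) (B - D u) (tn n); rewrite -/m => k.
  by move: h2; rewrite ler_pdivlMr // => h2; have := nrm_ge0 (B - D u); lra.
have [N /(_ N (leqnn N)) hN] := L _ e2.
exists (t N), ((t N ^+ 2)%:C *: (u - p)); split => //; first exact: Y_Z.
by apply: (le_trans (nrm_tri _ (D u) _)); lra.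
Qed.

Lemma eq_on_Y (T1 T2 : X -> X) : bounded_linear T1 -> bounded_linear T2 ->
  (forall t y, 0 < t -> Y y -> T1 (rD D t y) = T2 (rD D t y)) -> forall y, Y y -> T1 y = T2 y.
Proof.
move=> /bounded_linearP[L1 [C1 C10 h1]] /bounded_linearP[L2 [C2 C20 h2]] h y Yy.
apply/eqP; rewrite -subr_eq0; apply/eqP; apply: nrm_small => e e0.
have C0 : 0 < C1 + C2 + 1 by rewrite ltr_wpDl // addr_ge0.
have [t [y' [t0 Yy' ty]]] := rD_dense Yy (divr_gt0 e0 C0).
set a := rD D t y' in ty.
have -> : T1 y - T2 y = T2 (a - y) - T1 (a - y).
  by rewrite (linB L1) (linB L2) h //; vring.
apply: (le_trans (nrmDB _ _)); have := h1 (a - y); have := h2 (a - y).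
by move: ty; rewrite ler_pdivlMr // => ty; have := nrm_ge0 (a - y); lra.
Qed.

Variables (th0 : R).
Hypotheses (th0_range : omega_bi D < th0 < pi / 2) (calc : bounded_Hoo_calculus D th0).

(** An angle at which the operators [rD t] and [sgnD k] are values of the calculus. *)
Lemma calculus_angle : exists nu w, [/\ bisectorial_type D w, w < nu, nu < th0 & omega_bi D < nu].
Proof.
have /andP[ho _] := th0_range; pose nu := (omega_bi D + th0) / 2.
have n1 : omega_bi D < nu by rewrite /nu; lra.
by have [w bw wn] := type_below n1; exists nu, w; split => //; rewrite /nu; lra.
Qed.

(** This is where the boundedness of the calculus enters: [sgn_approx k] is bounded on
    the bisector independently of [k]. *)
Lemma sgnD_bounded : exists2 B : R, 0 <= B & forall k x, nrm (sgnD D k x) <= B * nrm x.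
Proof.
have [nu [w [bw wn nt on]]] := calculus_angle; have /andP[_ tp] := th0_range.
have tb : 0 < th0 < pi / 2 by rewrite tp andbT; have := omega_ge0; lra.
have [C hC] := calc; have [c0 s0] := trig_pos tb.
pose b := sgn_approx_bound th0.
have b0 : 0 <= b by rewrite !mulr_ge0 ?invr_ge0 ?(ltW c0) // ltW // pi_gt0.
exists (`|C| * b); first by rewrite mulr_ge0.
move=> k x; rewrite -(fcalc_sgn_approx bw wn nt tp k x).
have nr : omega_bi D < nu < th0 by rewrite on.
have := hC nu _ nr (Hoo0_sgn_approx k tb) x; rewrite !normE -rmorphM lecR => h.
apply: (le_trans h); rewrite ler_wpM2r ?nrm_ge0 //.
have ne : bisector th0 (1%:C * cis 0).
  by left; apply: ray_sector; rewrite ?normr0 //; case/andP: tb.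
set S := sup_norm _ _; have S1 : S <= b.
  by apply: ge_sup; [exists (normc (sgn_approx k (1%:C * cis 0))), (1%:C * cis 0)|move=> _ [z bz <-]; exact: sgn_approx_le].
have S0 : 0 <= S.
  apply: (@le_trans _ _ (normc (sgn_approx k (1%:C * cis 0)))); first exact: normc_ge0.
  apply: ub_le_sup; last by exists (1%:C * cis 0).
  by exists b => _ [z bz <-]; exact: sgn_approx_le.
apply: (@le_trans _ _ (`|C| * S)); first by rewrite ler_wpM2r // ler_norm.
by rewrite ler_wpM2l.
Qed.

Lemma sgnD_linear k : linear (sgnD D k).
Proof.
move=> a x y; rewrite /sgnD.
have E j : rD D (node R k j) (a *: x + y) = a *: rD D (node R k j) x + rD D (node R k j) y.
  by apply: rD_linear; rewrite gt_eqF // node_gt0.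
rewrite (eq_bigr (fun j : 'I_(4 ^ k) => a *: ((mesh R k)%:C *: rD D (node R k j) x) + (mesh R k)%:C *: rD D (node R k j) y)).
  by rewrite big_split /= -scaler_sumr; vring.
by move=> j _; rewrite E; vring.
Qed.

Lemma sgnD_Ker k p : Ker D p -> sgnD D k p = 0.
Proof.
move=> Kp; rewrite /sgnD big1 ?scaler0 // => j _; rewrite rD_Ker ?scaler0 //.
by rewrite gt_eqF // node_gt0.
Qed.

Lemma sgnD_Y k y : Y y -> Y (sgnD D k y).
Proof.
move=> Yy; apply: Y_Z; elim/big_ind : _ => [||j _]; first exact: Y0.
  by move=> u v; exact: Y_D.
by apply: Y_Z; apply: Y_rD => //; rewrite gt_eqF // node_gt0.
Qed.

Lemma sgnD_converges x : exists l, lim_to (fun k => sgnD D k x) l.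
Proof.
have [nu [w [bw wn nt on]]] := calculus_angle; have /andP[_ tp] := th0_range.
have tb : 0 < th0 < pi / 2 by rewrite tp andbT; have := omega_ge0; lra.
have [p Kp Yp] := split_all bw0 split_dom x; have [B B0 hB] := sgnD_bounded.
have sB k := linB (sgnD_linear k).
have [|l hl] := @strong_cauchy _ _ (sgnD D) B (x - p) sB hB.
  move=> e e0; have [t [y' [t0 Yy' ty]]] := rD_dense Yp e0; exists (rD D t y') => //.
  exists (fcalc D nu (fun z => sgn_bisector th0 z * rker t z) y').
  rewrite -(fcalc_rker bw wn nt tp _ t0); apply: (sgnD_lim bw wn nt tp).
  by apply: Hoo0_rker => //; rewrite gt_eqF.
exists l; apply: eq_lim_to hl => k; by rewrite sB (sgnD_Ker k Kp) subr0.
Qed.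

Lemma sgn_exists : exists F : X -> X, [/\ is_sgn D F, forall x, lim_to (fun k => sgnD D k x) (F x),
  forall y, Y y -> Y (F y) & forall y, Y y -> F (F y) = y].
Proof.
have [F hF] := choice sgnD_converges; have [B B0 hB] := sgnD_bounded.
have FL : linear F.
  move=> a x y; apply: lim_to_unique (hF _) _.
  by apply: eq_lim_to (lim_toD (lim_toZ a (hF x)) (hF y)) => k; rewrite sgnD_linear.
have Fb : bounded_linear F.
  by apply/bounded_linearP; split => //; exists B => // x; exact: lim_to_le (hF x) (hB^~ x).
have FK x : Ker D x -> F x = 0.
  by move=> Kx; apply: lim_to_unique (hF x) _; apply: eq_lim_to (lim_to_cst 0) => k; rewrite sgnD_Ker.
have FY y : Y y -> Y (F y).
  by move=> Yy; apply: closure_lim (hF y) => k; exact: sgnD_Y.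
have Fcalc th nu g x : omega_bi D < th < pi / 2 -> omega_bi D < nu < th -> Hoo0 th g ->
    F (fcalc D nu g x) = fcalc D nu (fun z => sgn_bisector th z * g z) x.
  move=> /andP[_ tp] /andP[hn nt] hg; have [w bw wn] := type_below hn.
  exact: lim_to_unique (hF _) (sgnD_lim bw wn nt tp x hg).
have FS : is_sgn D F.
  split=> // th thr _; split; last by move=> nu g nr hg x _; exact: (Fcalc th).
  split; first by split=> // a x y _ _; exact: FL.
  by have [_ [M hM]] := Fb; exists M.
exists F; split => //.
have FFb : bounded_linear (fun x => F (F x)).
  have /bounded_linearP[_ [C C0 hC]] := Fb; apply/bounded_linearP; split.
    by move=> a x y; rewrite !FL.
  exists (C * C); first by rewrite mulr_ge0.
  by move=> x; apply: (le_trans (hC _)); rewrite -mulrA ler_wpM2l.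
have idb : bounded_linear (@id X).
  by apply/bounded_linearP; split => //; exists 1 => // x; rewrite mul1r.
have [nu [w [bw wn nt on]]] := calculus_angle; have /andP[_ tp] := th0_range.
have tb : 0 < th0 < pi / 2 by rewrite tp andbT; have := omega_ge0; lra.
apply: (eq_on_Y FFb idb) => t y t0 Yy.
have hr : Hoo0 th0 (rker t) by apply: Hoo0_rker => //; rewrite gt_eqF.
rewrite -(fcalc_rker bw wn nt tp y t0) /= !(Fcalc th0) ?on //; last exact: Hoo0_sgn.
symmetry; apply: (fcalc_ext bw wn nt tp) => // z bz; rewrite mulrA sgn_bisectorE //.
by case: ifP; rewrite ?mul1r // mulrNN !mul1r.
Qed.

(** An operator of the extended calculus is prescribed on the ranges of the [rD t], which
    are dense in the closure of the range. *)
Lemma sgn_unique F G : is_sgn D F -> is_sgn D G -> F = G.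
Proof.
move=> [Fb FK FC] [Gb GK GC].
have [nu [w [bw wn nt on]]] := calculus_angle; have /andP[_ tp] := th0_range.
have tb : 0 < th0 < pi / 2 by rewrite tp andbT; have := omega_ge0; lra.
have FGY y : Y y -> F y = G y.
  apply: (eq_on_Y Fb Gb) => t {}y t0 Yy.
  have hr : Hoo0 th0 (rker t) by apply: Hoo0_rker => //; rewrite gt_eqF.
  have nr : omega_bi D < nu < th0 by rewrite on.
  have [_ h1] := FC _ th0_range calc; have [_ h2] := GC _ th0_range calc.
  by rewrite -(fcalc_rker bw wn nt tp y t0) (h1 _ _ nr hr _ Yy) (h2 _ _ nr hr _ Yy).
apply/funext => x; have [p Kp Yp] := split_all bw0 split_dom x.
have [FL _] := Fb; have [GL _] := Gb.
have -> : x = p + (x - p) by rewrite addrC subrK.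
by rewrite (linD FL) (linD GL) FK // GK // FGY.
Qed.

End SignOperator.

(** * Compact operators *)

Section TotallyBounded.
Variables (R : realType) (X : completeNormedModType R[i]).
Implicit Types (C Y : set X) (T S : X -> X) (x y : X).

Definition totally_bounded C : Prop := forall e : R, 0 < e ->
  exists s : seq X, forall y, C y -> exists2 x, x \in s & nrm (y - x) <= e.

Lemma precompact_totally_bounded C : precompact C -> totally_bounded C.
Proof.
rewrite precompactE compact_cover => cC e e0.
have [i _||D _ cD] := cC X setT (fun x => [set y | nrm (y - x) < e]).
- rewrite openE => y /= yi; apply/nbhs_ballP; exists (e - nrm (y - i))%:C.
    by rewrite /= ltcR subr_gt0.
  move=> z; rewrite -ball_normE /= normE ltcR => zy.
  by apply: (le_lt_trans (nrm_tri z y i)); rewrite (nrmB z); lra.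
- by move=> x _; exists x => //=; rewrite subrr nrm0.
exists (finmap.enum_fset D) => y /(@subset_closure _ C)/cD[x xD /= /ltW xy]; by exists x.
Qed.

(** An ultrafilter on a totally bounded set is Cauchy. *)
Lemma totally_bounded_precompact C : totally_bounded C -> precompact C.
Proof.
move=> tC; rewrite precompactE compact_ultra => F UF FC.
have FP : ProperFilter F := ultra_proper.
suff /cauchy_cvg/cvg_ex[l Fl] : cauchy F.
  exists l; split => //; apply: closed_closure => B Bl.
  exact: filter_ex (filterI FC (Fl _ Bl)).
apply/cauchy_ballP => d; rewrite ltcE /= => /andP[/eqP dI dR].
have dE : d = (complex.Re d)%:C by apply/eqP; rewrite eq_complex /= dI !eqxx.
set e := complex.Re d in dR dE; have e4 : 0 < e / 8 by rewrite divr_gt0.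
have [s hs] := tC _ e4.
(* one of the finitely many balls of the net belongs to the ultrafilter *)
have [x Fx] : exists x, F [set y | nrm (y - x) <= e / 4].
  have : F [set y | exists2 x, x \in s & nrm (y - x) <= e / 4].
    apply: filterS FC => y /closureP/(_ _ e4)[a /hs[x xs ax] ay]; exists x => //.
    by apply: (le_trans (nrm_tri _ a _)); rewrite (nrmB y); lra.
  elim: s {hs} => [|x s IH] Fs.
    by have [y [x]] := filter_ex Fs; rewrite in_nil.
  have [Fx|Fx] := in_ultra_setVsetC [set y | nrm (y - x) <= e / 4] UF; first by exists x.
  apply: IH; apply: filterS (filterI Fs Fx) => y [[z]].
  by rewrite inE => /orP[/eqP -> yx nyx|zs zy _]; [case: (nyx yx)|exists z].
near_simpl; exists ([set y | nrm (y - x) <= e / 4], [set y | nrm (y - x) <= e / 4]) => //=.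
move=> [y z] /= [yx zx]; rewrite -ball_normE /= dE normE ltcR.
by apply: (le_lt_trans (nrm_tri _ x _)); rewrite (nrmB x); lra.
Qed.

End TotallyBounded.

Section CompactOn.
Variables (R : realType) (X : completeNormedModType R[i]).
Implicit Types (Y : set X) (T S : X -> X) (x y : X).

(** The image of the unit ball of [Y] is totally bounded: for linear [T] this is
    compactness, but it makes sense and is stable for arbitrary maps. *)
Definition ball_tb Y T : Prop := totally_bounded (T @` (Y `&` [set x | `|x| <= 1])).

Lemma ball_tbP Y T : ball_tb Y T <-> forall e : R, 0 < e ->
  exists s : seq X, forall y, Y y -> nrm y <= 1 -> exists2 x, x \in s & nrm (T y - x) <= e.
Proof.
split=> h e /h[s hs]; exists s; [move=> y Yy y1|move=> x [y []]].
  by apply: hs; exists y => //; split => //=; rewrite normE lecR.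
by rewrite /= normE lecR => Yy y1 <-; exact: hs.
Qed.

Lemma compact_on_tb Y T : compact_on Y T -> ball_tb Y T.
Proof. by move=> [_ /precompact_totally_bounded]. Qed.

Lemma tb_compact_on Y T : linear_on Y T -> ball_tb Y T -> compact_on Y T.
Proof. by move=> TL /totally_bounded_precompact. Qed.

Lemma ball_tb_ext Y T S : (forall y, Y y -> T y = S y) -> ball_tb Y T -> ball_tb Y S.
Proof.
move=> TS /ball_tbP h; apply/ball_tbP => e /h[s hs]; exists s => y Yy y1.
by rewrite -TS //; exact: hs.
Qed.

Lemma ball_tb_subset Y Z T : Y `<=` Z -> ball_tb Z T -> ball_tb Y T.
Proof.
move=> YZ /ball_tbP h; apply/ball_tbP => e /h[s hs]; exists s => y /YZ; exact: hs.
Qed.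

(** A norm limit of compact operators is compact. *)
Lemma ball_tb_lim Y T : (forall e : R, 0 < e -> exists2 S, ball_tb Y S &
  forall y, Y y -> nrm y <= 1 -> nrm (T y - S y) <= e) -> ball_tb Y T.
Proof.
move=> h; apply/ball_tbP => e e0; have e2 : 0 < e / 2 by rewrite divr_gt0.
have [S /ball_tbP/(_ _ e2)[s hs] TS] := h _ e2; exists s => y Yy y1.
have [x xs Sx] := hs _ Yy y1; exists x => //.
by apply: (le_trans (nrm_tri _ (S y) _)); have := TS _ Yy y1; lra.
Qed.

Lemma ball_tbD Y T S : ball_tb Y T -> ball_tb Y S -> ball_tb Y (fun y => T y + S y).
Proof.
move=> /ball_tbP hT /ball_tbP hS; apply/ball_tbP => e e0.
have e2 : 0 < e / 2 by rewrite divr_gt0.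
have [s hs] := hT _ e2; have [t ht] := hS _ e2.
exists [seq a + b | a <- s, b <- t] => y Yy y1.
have [a aS Ta] := hs _ Yy y1; have [b bt Sb] := ht _ Yy y1.
exists (a + b); first exact: allpairs_f.
by rewrite opprD addrACA (le_trans (nrmD _ _)) // (splitr e) lerD.
Qed.

(** A Lipschitz map preserves total boundedness. *)
Lemma ball_tb_left Y T S (C : R) : (forall x y, nrm (S x - S y) <= C * nrm (x - y)) ->
  ball_tb Y T -> ball_tb Y (fun y => S (T y)).
Proof.
move=> SC /ball_tbP h; apply/ball_tbP => e e0; have C1 : 0 < `|C| + 1 by rewrite ltr_wpDl.
have [s hs] := h _ (divr_gt0 e0 C1); exists (map S s) => y Yy y1.
have [x xs Tx] := hs _ Yy y1; exists (S x); first exact: map_f.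
apply: (le_trans (SC _ _)); apply: (@le_trans _ _ ((`|C| + 1) * nrm (T y - x))).
  by rewrite ler_wpM2r ?nrm_ge0 // (le_trans (ler_norm C)) // lerDl.
by rewrite mulrC -ler_pdivlMr.
Qed.

Lemma ball_tb_linear Y T S : bounded_linear S -> ball_tb Y T -> ball_tb Y (fun y => S (T y)).
Proof.
move=> /bounded_linearP[SL [C _ SC]]; apply: (@ball_tb_left _ _ _ C) => x y.
by rewrite -(linB SL).
Qed.

Lemma ball_tbZ Y T (a : R[i]) : ball_tb Y T -> ball_tb Y (fun y => a *: T y).
Proof. by apply: (@ball_tb_left _ _ (fun x => a *: x) (normc a)) => x y; rewrite -scalerBr nrmZ. Qed.

Lemma ball_tb_sum Y n (T : 'I_n -> X -> X) :
  (forall i, ball_tb Y (T i)) -> ball_tb Y (fun y => \sum_(i < n) T i y).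
Proof.
elim: n T => [|n IH] T h.
  apply/ball_tbP => e e0; exists [:: 0] => y _ _; exists 0; rewrite ?inE //.
  by rewrite big_ord0 subrr nrm0 ltW.
have := ball_tbD (IH _ (fun i => h (widen_ord (leqnSn n) i))) (h ord_max).
by apply: ball_tb_ext => y _; rewrite big_ord_recr.
Qed.

Lemma ball_tb_right Y Z T S (C : R) : 0 < C ->
  (forall (a : R[i]) y, Z y -> Z (a *: y)) -> (forall (a : R[i]) y, Z y -> T (a *: y) = a *: T y) ->
  (forall y, Y y -> Z (S y)) -> (forall y, Y y -> nrm (S y) <= C * nrm y) ->
  ball_tb Z T -> ball_tb Y (fun y => T (S y)).
Proof.
move=> C0 ZZ TZ YS SC hT.
have /ball_tbP h := ball_tbZ C%:C hT; apply/ball_tbP => e /h[s hs]; exists s => y Yy y1.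
have Cn : C%:C != 0 :> R[i] by apply/eqP => /complexI/eqP; rewrite gt_eqF.
have ZS := YS _ Yy; have -> : T (S y) = C%:C *: T (C%:C^-1 *: S y).
  by rewrite TZ // scalerA divff // scale1r.
apply: hs; first exact: ZZ.
have -> : C%:C^-1 = (C^-1)%:C by rewrite fmorphV.
rewrite nrmZR gtr0_norm ?invr_gt0 // mulrC ler_pdivrMr // mul1r.
by apply: (le_trans (SC _ Yy)); rewrite -[leRHS]mulr1 ler_wpM2l // ltW.
Qed.

(** A linear map that is totally bounded on the unit ball is bounded. *)
Lemma ball_tb_bounded Y T :
  (forall (a : R[i]) y, Y y -> Y (a *: y)) -> (forall (a : R[i]) y, Y y -> T (a *: y) = a *: T y) ->
  ball_tb Y T -> exists2 C : R, 0 <= C & forall y, Y y -> nrm (T y) <= C * nrm y.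
Proof.
move=> YZ TZ /ball_tbP/(_ _ ltr01)[s hs].
have [B B0 hB] : exists2 B : R, 0 <= B & forall x, x \in s -> nrm x <= B.
  elim: s {hs} => [|x s [B B0 hB]]; first by exists 0.
  exists (B + nrm x); first by rewrite addr_ge0 ?nrm_ge0.
  move=> y; rewrite inE => /orP[/eqP ->|/hB h]; first by rewrite lerDr.
  by rewrite (le_trans h) // lerDl nrm_ge0.
exists (B + 1); first by rewrite addr_ge0.
move=> y Yy; have := nrm_ge0 y; rewrite le_eqVlt => /orP[/eqP/esym/nrm_eq0 ->|y0].
  by have := TZ 0 y Yy; rewrite !scale0r => ->; rewrite nrm0 mulr0.
have Yn := YZ ((nrm y)^-1)%:C _ Yy.
have [|x xs] := hs _ Yn; first by rewrite nrmZR gtr0_norm ?invr_gt0 // mulVf ?gt_eqF.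
rewrite TZ // => h; have := hB _ xs => xB.
have : nrm ((nrm y)^-1%:C *: T y) <= B + 1.
  by have := nrmD ((nrm y)^-1%:C *: T y - x) x; rewrite subrK; lra.
by rewrite nrmZR gtr0_norm ?invr_gt0 // mulrC ler_pdivrMr.
Qed.

(** Compact maps send bounded sequences to sequences with a cluster point. *)
Lemma ball_tb_cluster T (u : nat -> X) (C : R) : linear T -> ball_tb setT T ->
  (forall n, nrm (u n) <= C) ->
  exists p, forall (e : R) (N : nat), 0 < e -> exists2 n, (N <= n)%N & nrm (T (u n) - p) <= e.
Proof.
move=> TL hT uC; have C1 : 0 < `|C| + 1 by rewrite ltr_wpDl.
have hT' : ball_tb setT (fun x => (`|C| + 1)%:C *: T x) by exact: ball_tbZ.
pose v n := (`|C| + 1)^-1%:C *: u n.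
have v1 n : nrm (v n) <= 1.
  rewrite nrmZR gtr0_norm ?invr_gt0 // mulrC ler_pdivrMr // mul1r.
  by apply: (le_trans (uC n)); apply: (le_trans (ler_norm _)); rewrite lerDl.
have vE n : (`|C| + 1)%:C *: T (v n) = T (u n).
  by rewrite /v (linZ TL) scalerA -rmorphM divff ?gt_eqF // scale1r.
have := totally_bounded_precompact hT'; rewrite precompactE => cK.
have [|p _ hp] := compact_seq_cluster (u := fun n => T (u n)) cK.
  move=> n; apply: subset_closure; exists (v n) => //=.
  by split => //=; rewrite normE lecR.
exists p => e N e0; have [|n Nn] := hp e%:C N; first by rewrite ltcR.
by rewrite -ball_normE /= normE ltcR nrmB => /ltW; exists n.
Qed.

End CompactOn.

(** * Norm convergence of the approximations of the commutator *)

Section DyadicSums.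
Variable R : realType.

Lemma sum_telescope (h : R) m n : 0 < h -> (m <= n)%N ->
  \sum_(m <= j < n) h / ((1 + j%:R * h) * (1 + j.+1%:R * h)) <= (1 + m%:R * h)^-1.
Proof.
move=> h0 mn; have p j : 0 < 1 + j%:R * h by rewrite ltr_wpDr // mulr_ge0 // ltW.
suff -> : \sum_(m <= j < n) h / ((1 + j%:R * h) * (1 + j.+1%:R * h)) =
    (1 + m%:R * h)^-1 - (1 + n%:R * h)^-1 by rewrite gerBl invr_ge0 ltW.
elim: n mn => [|n IH].
  by rewrite leqn0 => /eqP ->; rewrite big_geq // subrr.
rewrite leq_eqVlt => /orP[/eqP ->|]; first by rewrite big_geq // subrr.
rewrite ltnS => mn; rewrite big_nat_recr //= IH //.
have := p m; have := p n; have := p n.+1; rewrite -natr1 => p1 p2 p3.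
by field; rewrite !gt_eqF.
Qed.

Lemma nrm_sum_nat (V : normedModType R[i]) m n (F : nat -> V) :
  nrm (\sum_(m <= i < n) F i) <= \sum_(m <= i < n) nrm (F i).
Proof.
elim/big_ind2 : _ => //; first by rewrite nrm0.
by move=> x1 x2 y1 y2 h1 h2; apply: (le_trans (nrmD _ _)); apply: lerD.
Qed.

Lemma sum_pairs (V : zmodType) n (f : nat -> V) :
  \sum_(0 <= j < n.*2) f j = \sum_(0 <= j < n) (f j.*2 + f j.*2.+1).
Proof.
elim: n => [|n IH]; first by rewrite !big_geq.
by rewrite doubleS !big_nat_recr //= IH addrA.
Qed.

Lemma meshS k : mesh R k.+1 = mesh R k / 2.
Proof. by rewrite /mesh exprSr. Qed.

Section Dyadic.
Variables (V : normedModType R[i]) (Psi : R -> V) (a : R).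
Hypothesis a0 : 0 <= a.
Hypothesis Psi_le : forall t, 0 < t -> nrm (Psi t) <= a / (1 + t) ^+ 2.
Hypothesis Psi_lip : forall t s, 0 < t -> 0 < s ->
  nrm (Psi t - Psi s) <= a * `|t - s| / ((1 + t) * (1 + s)).

Definition dyadic_sum k := \sum_(j < 4 ^ k) (mesh R k)%:C *: Psi (node R k j).

(** Half of the nodes of a step of the refinement are the old ones and pair up with
    their neighbours; the rest extends the range, where [Psi] is small. *)
Lemma dyadic_step k : nrm (dyadic_sum k.+1 - dyadic_sum k) <= 2 * a * mesh R k.
Proof.
have h0 := mesh_gt0 R k; have h'0 := mesh_gt0 R k.+1.
rewrite /dyadic_sum -(big_mkord xpredT (fun j => (mesh R k.+1)%:C *: Psi (node R k.+1 j))).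
rewrite -(big_mkord xpredT (fun j => (mesh R k)%:C *: Psi (node R k j))).
set n := (4 ^ k)%N; have n4 : (4 ^ k.+1 = n.*2.*2)%N by rewrite expnS -/n -!muln2 -mulnA mulnC.
rewrite n4 (@big_cat_nat _ _ _ n.*2) //=; last by rewrite -[n.*2.*2]addnn leq_addr.
rewrite sum_pairs addrAC -sumrB.
apply: (@le_trans _ _ (a * mesh R k / 4 + a * mesh R k)); last first.
  by have := mulr_ge0 a0 (ltW h0); lra.
apply: (le_trans (nrmD _ _)); apply: lerD.
- apply: (le_trans (nrm_sum_nat _ _ _)).
  apply: (@le_trans _ _ (\sum_(0 <= j < n) (a * mesh R k / 4) *
      (mesh R k / ((1 + j%:R * mesh R k) * (1 + j.+1%:R * mesh R k))))); last first.
    rewrite -mulr_sumr -[leRHS]mulr1 ler_wpM2l //; first by rewrite !mulr_ge0 ?invr_ge0 // ltW.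
    by apply: (le_trans (sum_telescope h0 (leq0n n))); rewrite mul0r addr0 invr1.
  apply: ler_sum => j _; have t0 := node_gt0 R k j; have s0 := node_gt0 R k.+1 j.*2.
  have -> : node R k.+1 j.*2.+1 = node R k j.
    by rewrite /node meshS -doubleS -muln2 natrM; field.
  have sE : node R k.+1 j.*2 = node R k j - mesh R k / 2.
    by rewrite /node meshS -!natr1 -muln2 natrM; field.
  have -> : (mesh R k.+1)%:C *: Psi (node R k.+1 j.*2) + (mesh R k.+1)%:C *: Psi (node R k j)
      - (mesh R k)%:C *: Psi (node R k j) = (mesh R k.+1)%:C *: (Psi (node R k.+1 j.*2) - Psi (node R k j)).
    have -> : mesh R k = mesh R k.+1 + mesh R k.+1 by rewrite meshS; field.
    by rewrite rmorphD; vring.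
  rewrite nrmZR gtr0_norm //; have := Psi_lip s0 t0.
  have -> : `|node R k.+1 j.*2 - node R k j| = mesh R k / 2.
    rewrite sE addrAC subrr add0r normrN ger0_norm // ltW //; lra.
  move=> /(ler_wpM2l (ltW h'0)) => k1; apply: (le_trans k1).
  have j1 : 0 <= j%:R * mesh R k by rewrite mulr_ge0 // ltW.
  have -> : a * mesh R k / 4 * (mesh R k / ((1 + j%:R * mesh R k) * (1 + j.+1%:R * mesh R k))) =
     mesh R k.+1 * (a * (mesh R k / 2) / ((1 + j%:R * mesh R k) * (1 + node R k j))).
    have tp : 0 < 1 + node R k j by lra.
    by rewrite meshS -/(node R k j); field; apply/andP; split; rewrite gt_eqF //; lra.
  rewrite ler_wpM2l ?(ltW h'0) // ler_wpM2l //; first by rewrite mulr_ge0 // ltW // divr_gt0.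
  have jn : j%:R * mesh R k <= node R k.+1 j.*2.
    by rewrite sE /node -natr1 mulrDl mul1r; lra.
  rewrite lef_pV2 ?posrE ?mulr_gt0 //; try lra.
  by rewrite ler_wpM2r //; lra.
- apply: (le_trans (nrm_sum_nat _ _ _)).
  apply: (@le_trans _ _ (\sum_(n.*2 <= j < n.*2.*2) a *
      (mesh R k.+1 / ((1 + j%:R * mesh R k.+1) * (1 + j.+1%:R * mesh R k.+1))))); last first.
    rewrite -mulr_sumr ler_wpM2l //.
    have nn : (n.*2 <= n.*2.*2)%N by rewrite -[n.*2.*2]addnn leq_addr.
    apply: (le_trans (sum_telescope h'0 nn)).
    have -> : n.*2%:R * mesh R k.+1 = (mesh R k)^-1.
      by rewrite -mesh_count -/n meshS -muln2 natrM; field.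
    by rewrite -[leRHS]invrK lef_pV2 ?posrE ?ltr_wpDl ?invr_gt0 // lerDr.
  apply: ler_sum => j _; have s0 := node_gt0 R k.+1 j.
  rewrite nrmZR gtr0_norm //; have /(ler_wpM2l (ltW h'0)) k1 := Psi_le s0.
  apply: (le_trans k1).
  have jn : j%:R * mesh R k.+1 <= node R k.+1 j by rewrite /node -natr1 mulrDl mul1r; lra.
  have j1 : 0 <= j%:R * mesh R k.+1 by rewrite mulr_ge0 // ltW.
  rewrite mulrCA -/(node R k.+1 j) ler_wpM2l // ler_wpM2l ?(ltW h'0) //.
  by rewrite lef_pV2 ?posrE ?exprn_gt0 ?mulr_gt0 ?expr2 ?ler_wpM2r //; lra.
Qed.

(** The steps are summable, so that the rate only depends on the bounds of [Psi]. *)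
Lemma dyadic_lim l k : lim_to dyadic_sum l -> nrm (l - dyadic_sum k) <= 4 * a * mesh R k.
Proof.
move=> L.
have st m : nrm (dyadic_sum (k + m) - dyadic_sum k) <= 4 * a * (mesh R k - mesh R (k + m)).
  elim: m => [|m IH]; first by rewrite addn0 !subrr nrm0 mulr0.
  rewrite addnS; apply: (le_trans (nrm_tri _ (dyadic_sum (k + m)) _)).
  by have := dyadic_step (k + m); rewrite meshS; lra.
have L2 : lim_to (fun m => dyadic_sum (k + m)) l.
  by move=> e /L[N h]; exists N => n Nn; apply: h; rewrite (leq_trans Nn) // leq_addl.
apply: (lim_to_le (lim_toB L2 (lim_to_cst (dyadic_sum k)))) => m.
apply: (le_trans (st m)); rewrite ler_wpM2l ?mulr_ge0 // gerBl; exact: ltW (mesh_gt0 R _).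
Qed.

End Dyadic.
End DyadicSums.

Section RangeCommutator.
Variables (R : realType) (X : completeNormedModType R[i]) (D : unbounded_operator X).
Implicit Types (x y : X) (z : R[i]) (t s : R).
Notation res := (resolvent D).
Notation Y := (closure (Ran D)).
Variable w : R.
Hypothesis bw : bisectorial_type D w.

Variable P : X -> X.
Hypothesis Pb : bounded_linear P.
Hypothesis PY : forall x, Y (x - P x).
Hypothesis Pres : forall z x, resolvent_set D z -> P (res z x) = res z (P x).

Hypothesis D_below : exists2 c : R, 0 <= c & forall y, Y y -> dom D y -> nrm y <= c * nrm (D y).
Hypothesis res_compact : forall t, t != 0 -> ball_tb Y (res (t%:C * 'i)).

Variables A delta : X -> X.
Hypothesis Ab : bounded_linear A.
Hypothesis db : bounded_linear delta.
Hypothesis A_dom : forall x, dom D x -> dom D (A x).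
Hypothesis deltaE : forall x, dom D x -> delta x = D (A x) - A (D x).

(** [[R(z), A] = R(z) [D, A] R(z)]. *)
Lemma res_commutator z y : resolvent_set D z ->
  res z (A y) - A (res z y) = res z (delta (res z y)).
Proof.
move=> rz; set u := res z y; have [du e] := res_spec y rz; have [AL _] := Ab.
have rL := res_linear rz; have dA := A_dom du.
have -> : A y = (z *: A u - D (A u)) + delta u.
  by rewrite deltaE // -e -/u (linB AL) (linZ AL); vring.
by rewrite (linD rL) res_inv // addrAC subrr add0r.
Qed.

Let Q x := x - P x.

Let QB x y : Q (x - y) = Q x - Q y.
Proof. by have [PL _] := Pb; rewrite /Q (linB PL); vring. Qed.

Let QZ a x : Q (a *: x) = a *: Q x.
Proof. by have [PL _] := Pb; rewrite /Q (linZ PL); vring. Qed.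

Let QY x : Y (Q x). Proof. exact: PY. Qed.

(** The commutator of the resolvent at [z] with [A], composed with [Q]. *)
Definition range_comm z y := res z (Q (delta (res z y))).

Lemma range_commE z y : resolvent_set D z -> Q (res z (A y) - A (res z y)) = range_comm z y.
Proof.
move=> rz; rewrite res_commutator // /range_comm /Q Pres //.
by rewrite (linB (res_linear rz)).
Qed.

Lemma Qdelta_bound : exists2 L : R, 0 < L & forall x, nrm (Q (delta x)) <= L * nrm x.
Proof.
have /bounded_linearP[_ [C C0 hC]] := Pb; have /bounded_linearP[_ [B B0 hB]] := db.
exists ((1 + C) * B + 1); first by rewrite ltr_wpDl // mulr_ge0 // addr_ge0.
move=> x; apply: (@le_trans _ _ ((1 + C) * nrm (delta x))).
  by apply: (le_trans (nrmDB _ _)); rewrite mulrDl mul1r lerD.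
apply: (@le_trans _ _ ((1 + C) * (B * nrm x))); first by rewrite ler_wpM2l // addr_ge0.
by rewrite mulrA ler_wpM2r ?nrm_ge0 // lerDl.
Qed.

Let ri t : t != 0 -> resolvent_set D (t%:C * 'i) := res_i bw (t := t).

(** On the range the resolvent is bounded near zero, since [D] is bounded below. *)
Lemma res_Y_bound : exists2 K : R, 0 < K &
  forall t y, t != 0 -> Y y -> nrm (res (t%:C * 'i) y) <= K / (1 + `|t|) * nrm y.
Proof.
have [c c0 hc] := D_below; have [M M0 hM] := scaled_res_bound bw.
have K0 : 0 <= c * (M + 1) + M by rewrite addr_ge0 // mulr_ge0 // addr_ge0.
exists (c * (M + 1) + M + 1); first by rewrite ltr_wpDl.
move=> t y t0 Yy; have rt := ri t0; have := hM t y t0.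
have [d _] := res_spec y rt; have := hc _ (Y_res rt Yy) d; rewrite (D_res _ rt).
move=> h1 h2; have t1 : 0 < 1 + `|t| by rewrite ltr_wpDr.
rewrite mulrAC ler_pdivlMr //.
have nt : nrm ((t%:C * 'i) *: res (t%:C * 'i) y) = `|t| * nrm (res (t%:C * 'i) y).
  by rewrite nrmZ normcM normcR /normc /= expr0n /= add0r expr1n sqrtr1 mulr1.
have h3 : nrm (res (t%:C * 'i) y) <= c * ((M + 1) * nrm y).
  apply: (le_trans h1); rewrite ler_wpM2l //; apply: (le_trans (nrmDB _ _)).
  by rewrite mulrDl mul1r lerD.
rewrite nt in h2; have := nrm_ge0 y; lra.
Qed.

(** Each of the two resolvents contributes a factor [(1 + |t|)^-1], and by the resolvent
    identity a difference of resolvents contributes two of them. *)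
Lemma range_comm_estimate : exists2 a : R, 0 <= a &
  (forall t y, t != 0 -> Y y -> nrm (range_comm (t%:C * 'i) y) <= a / (1 + `|t|) ^+ 2 * nrm y) /\
  (forall t s y, t != 0 -> s != 0 -> Y y ->
    nrm (range_comm (t%:C * 'i) y - range_comm (s%:C * 'i) y) <=
      a * `|t - s| / ((1 + `|t|) * (1 + `|s|)) * nrm y).
Proof.
have [K K0 hK] := res_Y_bound; have [L L0 hL] := Qdelta_bound.
have K3 : 0 <= 2 * L * K ^+ 3 by rewrite !mulr_ge0 ?exprn_ge0 // ltW.
have K2 : 0 <= L * K ^+ 2 by rewrite mulr_ge0 ?exprn_ge0 // ltW.
have fac t : 0 < K / (1 + `|t|) /\ K / (1 + `|t|) <= K.
  have t1 : 0 < 1 + `|t| by rewrite ltr_wpDr.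
  split; first by rewrite divr_gt0.
  by rewrite ler_pdivrMr // ler_peMr ?(ltW K0) // lerDl.
exists (2 * L * K ^+ 3 + L * K ^+ 2); first exact: addr_ge0.
split=> [t y t0 Yy|t s y t0 s0 Yy].
  have [f0 _] := fac t; have t1 : 0 < 1 + `|t| by rewrite ltr_wpDr.
  rewrite /range_comm; apply: (le_trans (hK _ _ t0 (@QY _))).
  apply: (@le_trans _ _ (K / (1 + `|t|) * (L * (K / (1 + `|t|) * nrm y)))).
    rewrite ler_wpM2l ?(ltW f0) //; apply: (le_trans (hL _)).
    by rewrite ler_wpM2l ?(ltW L0) // hK.
  have -> : K / (1 + `|t|) * (L * (K / (1 + `|t|) * nrm y)) =
     L * K ^+ 2 / (1 + `|t|) ^+ 2 * nrm y by field; rewrite gt_eqF.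
  rewrite ler_wpM2r ?nrm_ge0 // ler_wpM2r ?invr_ge0 ?exprn_ge0 // ?(ltW t1) // lerDr //.
have [f0 f1] := fac t; have [g0 g1] := fac s; set f := K / (1 + `|t|) in f0 f1.
set g := K / (1 + `|s|) in g0 g1.
have rt := ri t0; have rs := ri s0.
set m := t%:C * 'i in rt *; set m' := s%:C * 'i in rs *.
have md : normc (m' - m) = `|t - s|.
  rewrite /m /m' -mulrBl -rmorphB normcM normcR /normc /= expr0n /= add0r expr1n sqrtr1 mulr1.
  by rewrite distrC.
have dif v : Y v -> nrm (res m v - res m' v) <= `|t - s| * (f * (g * nrm v)).
  move=> Yv; rewrite res_identity // nrmZ md ler_wpM2l //.
  apply: (le_trans (hK _ _ t0 (Y_res rs Yv))); rewrite ler_wpM2l ?(ltW f0) //; exact: hK.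
have [dL _] := db; have rL := res_linear rs.
have -> : range_comm m y - range_comm m' y =
  (res m (Q (delta (res m y))) - res m' (Q (delta (res m y))))
   + res m' (Q (delta (res m y - res m' y))).
  rewrite /range_comm (linB dL) QB (linB rL (Q (delta (res m y)))); vring.
apply: (le_trans (nrmD _ _)).
have e1 : nrm (res m (Q (delta (res m y))) - res m' (Q (delta (res m y)))) <=
    `|t - s| * (f * g) * (L * K) * nrm y.
  have -> : `|t - s| * (f * g) * (L * K) * nrm y = `|t - s| * (f * (g * (L * (K * nrm y)))) by ring.
  apply: (le_trans (dif _ (@QY _))); rewrite ler_wpM2l // ler_wpM2l ?(ltW f0) //.
  rewrite ler_wpM2l ?(ltW g0) //; apply: (le_trans (hL _)); rewrite ler_wpM2l ?(ltW L0) //.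
  by apply: (le_trans (hK _ _ t0 Yy)); rewrite ler_wpM2r ?nrm_ge0.
have e2 : nrm (res m' (Q (delta (res m y - res m' y)))) <= `|t - s| * (f * g) * (L * K) * nrm y.
  apply: (le_trans (hK _ _ s0 (@QY _))); apply: (@le_trans _ _ (K * (L * (`|t - s| * (f * (g * nrm y)))))).
    apply: ler_pM; rewrite ?nrm_ge0 ?(ltW g0) //; apply: (le_trans (hL _)).
    by rewrite ler_wpM2l ?(ltW L0) // dif.
  by rewrite le_eqVlt; apply/orP; left; apply/eqP; ring.
apply: (le_trans (lerD e1 e2)).
have t1 : 0 < 1 + `|t| by rewrite ltr_wpDr.
have s1 : 0 < 1 + `|s| by rewrite ltr_wpDr.
have -> : `|t - s| * (f * g) * (L * K) * nrm y + `|t - s| * (f * g) * (L * K) * nrm y =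
   2 * L * K ^+ 3 * `|t - s| / ((1 + `|t|) * (1 + `|s|)) * nrm y.
  by rewrite /f /g; field; rewrite !gt_eqF.
rewrite ler_wpM2r ?nrm_ge0 // ler_wpM2r ?invr_ge0 ?mulr_ge0 ?(ltW t1) ?(ltW s1) //.
by rewrite ler_wpM2r // lerDl.
Qed.

Lemma range_comm_compact t : t != 0 -> ball_tb Y (range_comm (t%:C * 'i)).
Proof.
move=> t0; have rt := ri t0; have [L L0 hL] := Qdelta_bound; have [K K0 hK] := res_Y_bound.
have t1 : 0 < 1 + `|t| by rewrite ltr_wpDr.
apply: (@ball_tb_right _ _ _ Y _ (fun y => Q (delta (res (t%:C * 'i) y))) (L * (K / (1 + `|t|)))).
- by rewrite mulr_gt0 // divr_gt0.
- by move=> a y; exact: Y_Z.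
- by move=> a y _; rewrite (linZ (res_linear rt)).
- by move=> y _; exact: QY.
- by move=> y Yy; apply: (le_trans (hL _)); rewrite -mulrA ler_wpM2l ?(ltW L0) // hK.
- exact: res_compact.
Qed.

Definition rD_comm t y := (- 2^-1) *: (range_comm (t%:C * 'i) y + range_comm ((- t)%:C * 'i) y).

Lemma rD_commE t y : t != 0 -> Q (rD D t (A y) - A (rD D t y)) = rD_comm t y.
Proof.
move=> t0; have tN : - t != 0 by rewrite oppr_eq0.
have [AL _] := Ab; rewrite /rD_comm /rD -!range_commE //; try exact: ri.
rewrite !QB !QZ !(linZ AL) !(linD AL) QZ /Q; have [PL _] := Pb; rewrite !(linD PL); vring.
Qed.

Lemma rD_comm_estimate : exists2 a : R, 0 <= a & forall y, Y y ->
  (forall t, 0 < t -> nrm (rD_comm t y) <= a * nrm y / (1 + t) ^+ 2) /\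
  (forall t s, 0 < t -> 0 < s -> nrm (rD_comm t y - rD_comm s y) <=
      a * nrm y * `|t - s| / ((1 + t) * (1 + s))).
Proof.
have [a a0 [h1 h2]] := range_comm_estimate; exists a => // y Yy.
have n2 : normc (- 2^-1 : R[i]) = 2^-1.
  have -> : (- 2^-1 : R[i]) = (- 2^-1)%:C by rewrite rmorphN fmorphV rmorph_nat.
  by rewrite normcR normrN ger0_norm // invr_ge0.
split=> [t t0|t s t0 s0].
  have tn : t != 0 by rewrite gt_eqF.
  have tN : - t != 0 by rewrite oppr_eq0.
  rewrite /rD_comm nrmZ n2; have := nrmD (range_comm (t%:C * 'i) y) (range_comm ((- t)%:C * 'i) y).
  have := h1 _ _ tn Yy; have := h1 _ _ tN Yy; rewrite normrN gtr0_norm //.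
  rewrite [in X in _ -> _ -> _ -> X]mulrAC; lra.
have tn : t != 0 by rewrite gt_eqF.
have tN : - t != 0 by rewrite oppr_eq0.
have sn : s != 0 by rewrite gt_eqF.
have sN : - s != 0 by rewrite oppr_eq0.
have -> : rD_comm t y - rD_comm s y = (- 2^-1) *:
   ((range_comm (t%:C * 'i) y - range_comm (s%:C * 'i) y) +
    (range_comm ((- t)%:C * 'i) y - range_comm ((- s)%:C * 'i) y)).
  by rewrite /rD_comm; vring.
rewrite nrmZ n2; have := nrmD (range_comm (t%:C * 'i) y - range_comm (s%:C * 'i) y)
    (range_comm ((- t)%:C * 'i) y - range_comm ((- s)%:C * 'i) y).
have := h2 _ _ _ tn sn Yy; have := h2 _ _ _ tN sN Yy.
rewrite !normrN !(gtr0_norm t0) !(gtr0_norm s0) -opprD normrN.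
have -> : a * nrm y * `|t - s| / ((1 + t) * (1 + s)) = a * `|t - s| / ((1 + t) * (1 + s)) * nrm y by ring.
lra.
Qed.

Lemma rD_comm_compact t : t != 0 -> ball_tb Y (rD_comm t).
Proof.
move=> t0; apply: ball_tbZ; apply: ball_tbD; apply: range_comm_compact => //.
by rewrite oppr_eq0.
Qed.

Lemma sgnD_comm k y :
  Q (sgnD D k (A y) - A (sgnD D k y)) = (2 / pi)%:C *: dyadic_sum (fun t => rD_comm t y) k.
Proof.
have [AL _] := Ab; have [PL _] := Pb.
have As n (f : 'I_n -> X) : A (\sum_(i < n) f i) = \sum_(i < n) A (f i).
  by elim/big_rec2 : _ => [|i u v _ <-]; rewrite ?(lin0 AL) // (linD AL).
have Q0 : Q 0 = 0 by rewrite /Q (lin0 PL) subrr.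
have QD x x' : Q (x + x') = Q x + Q x' by rewrite /Q (linD PL); vring.
have Qs n (f : 'I_n -> X) : Q (\sum_(i < n) f i) = \sum_(i < n) Q (f i).
  by elim/big_rec2 : _ => [|i u v _ <-]; rewrite ?Q0 // QD.
rewrite /sgnD (linZ AL) -scalerBr QZ As -sumrB Qs; congr (_ *: _).
apply: eq_bigr => j _; rewrite (linZ AL) -scalerBr QZ rD_commE // gt_eqF //.
exact: node_gt0.
Qed.

(** Compactness passes from the finite sums [sgnD k] to their limit because the
    commutators converge in norm, although the [sgnD k] converge only strongly. *)
Lemma range_commutator_compact F : bounded_linear F ->
  (forall x, lim_to (fun k => sgnD D k x) (F x)) ->
  ball_tb Y (fun y => Q (F (A y) - A (F y))).
Proof.
move=> Fb FL; have [a a0 ha] := rD_comm_estimate.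
have p0 : (0 : R) < 2 / pi by rewrite divr_gt0 // pi_gt0.
have q0 : 0 <= 2 / pi * (4 * a) by rewrite mulr_ge0 ?(ltW p0) // mulr_ge0.
apply: ball_tb_lim => e e0; have [|N hN] := @mesh_small R (e / (2 / pi * (4 * a) + 1)).
  by rewrite divr_gt0 // ltr_wpDl.
exists (fun y => Q (sgnD D N (A y) - A (sgnD D N y))).
  apply: (@ball_tb_ext _ _ _ (fun y => (2 / pi)%:C *: dyadic_sum (fun t => rD_comm t y) N)).
    by move=> y _; rewrite sgnD_comm.
  apply: ball_tbZ; apply: (@ball_tb_sum _ _ Y _ (fun j y => (mesh R N)%:C *: rD_comm (node R N j) y)).
  move=> j; apply: ball_tbZ; apply: rD_comm_compact.
  by rewrite gt_eqF // node_gt0.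
move=> y Yy y1; have [h1 h2] := ha y Yy.
have [AL _] := Ab; have /bounded_linearP[_ [CA CA0 hCA]] := Ab.
have /bounded_linearP[_ [CP CP0 hCP]] := Pb.
have QC x : nrm (Q x) <= (1 + CP) * nrm x.
  by apply: (le_trans (nrmDB _ _)); rewrite mulrDl mul1r lerD.
have L : lim_to (fun k => Q (sgnD D k (A y) - A (sgnD D k y))) (Q (F (A y) - A (F y))).
  apply: (lim_to_map QB QC); apply: lim_toB (FL _) _.
  exact: lim_to_map (linB AL) hCA (FL y).
have p1 : (2 / pi)%:C != 0 :> R[i] by apply/eqP => /complexI/eqP; rewrite gt_eqF.
have L' : lim_to (dyadic_sum (fun t => rD_comm t y)) ((2 / pi)%:C^-1 *: Q (F (A y) - A (F y))).
  apply: eq_lim_to (lim_toZ (2 / pi)%:C^-1 L) => k.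
  by rewrite sgnD_comm scalerA mulVf // scale1r.
have ay : 0 <= a * nrm y by rewrite mulr_ge0 ?nrm_ge0.
have := dyadic_lim ay h1 h2 N L'; move=> /(ler_wpM2l (ltW p0)).
rewrite -{1}(gtr0_norm p0) -nrmZR scalerBr scalerA divff // scale1r -sgnD_comm => h.
apply: (le_trans h); have := hN _ (leqnn N).
rewrite ler_pdivlMr ?ltr_wpDl // => k; have m0 := mesh_gt0 R N.
apply: le_trans k; rewrite mulrDr mulr1 mulrC -[X in X + _]mulrC.
have : a * nrm y <= a by rewrite -[leRHS]mulr1 ler_wpM2l.
move=> /(ler_wpM2l (ltW m0)) /(ler_wpM2l (ltW p0)); lra.
Qed.

End RangeCommutator.

(** * Compact resolvents and compact inverses *)

Section CompactnessHypotheses.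
Variables (R : realType) (X : completeNormedModType R[i]) (D : unbounded_operator X).
Implicit Types (x y p : X) (z : R[i]) (t : R).
Notation res := (resolvent D).
Notation Y := (closure (Ran D)).
Variable w : R.
Hypothesis bw : bisectorial_type D w.

(** The common consequences of the two compactness hypotheses. *)
Definition range_good : Prop := [/\ forall x, dom D x -> exists2 p, Ker D p & Y (x - p),
  exists2 c : R, 0 <= c & forall y, Y y -> dom D y -> nrm y <= c * nrm (D y) &
  forall t, t != 0 -> ball_tb Y (res (t%:C * 'i))].

Let ri t : t != 0 -> resolvent_set D (t%:C * 'i) := res_i bw (t := t).

Lemma Y_D_dom x : dom D x -> Y (D x).
Proof. by move=> dx; apply: subset_closure; exists x. Qed.

(** With [T] the inverse of [D] on its range, [x - T (D x)] is the kernel component of [x],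
    and [R(z) = T (z R(z) - 1)]. *)
Lemma compact_inverse_range_good : compact_inverse_on_range D -> range_good.
Proof.
move=> [T [cT T1 T2]]; have hT := compact_on_tb cT; have [[TY TL] _] := cT.
have TZ (a : R[i]) y : Y y -> T (a *: y) = a *: T y.
  have T0 : T 0 = 0.
    by have := TL (-1) _ _ (@Y0 _ _ D) (@Y0 _ _ D); rewrite scaler0 addr0 scaleN1r addNr.
  by move=> Yy; have := TL a _ _ Yy (@Y0 _ _ D); rewrite T0 !addr0.
have YZ (a : R[i]) y : Y y -> Y (a *: y) by exact: Y_Z.
have [C C0 hC] := ball_tb_bounded YZ TZ hT.
split.
- move=> x dx; have YD := Y_D_dom dx; have [d e] := T1 _ YD.
  exists (x - T (D x)); last by rewrite subKr; exact: TY.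
  by split; [exact: domB|rewrite opB // e subrr].
- by exists C => // y Yy dy; rewrite -{1}(T2 y Yy dy); apply: hC; exact: Y_D_dom.
move=> t t0; have rt := ri t0; set m := t%:C * 'i in rt *.
have [M M0 hM] := scaled_res_bound bw.
apply: (@ball_tb_ext _ _ _ (fun y => T (m *: res m y - y))).
  by move=> y Yy; rewrite -D_res // T2 //; [exact: Y_res|have [] := res_spec y rt].
apply: (ball_tb_right (Z := Y) (C := M + 1)) => //.
- by rewrite ltr_wpDl.
- by move=> y Yy; apply: Y_B => //; apply: Y_Z; exact: Y_res.
move=> y _; apply: (le_trans (nrmDB _ _)); rewrite mulrDl mul1r lerD //; exact: hM.
Qed.

Definition cluster_seq (v : nat -> X) p : Prop :=
  forall (e : R) (N : nat), 0 < e -> exists2 n, (N <= n)%N & nrm (v n - p) <= e.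

Lemma Y_cluster v p : (forall n, Y (v n)) -> cluster_seq v p -> Y p.
Proof.
move=> Yv vp; apply/closureP => e e0; have e2 : 0 < e / 2 by rewrite divr_gt0.
have [n _ np] := vp _ 0%N e2; have /closureP/(_ _ e2)[a Ra an] := Yv n.
by exists a => //; apply: (le_trans (nrm_tri _ (v n) _)); lra.
Qed.

(** The graph of [D] being closed, it suffices to see it through a resolvent. *)
Lemma Ker_cluster v p : (forall n, dom D (v n)) -> lim_to (fun n => D (v n)) 0 ->
  cluster_seq v p -> Ker D p.
Proof.
move=> dv Dv vp; have r1 := ri (oner_neq0 R); set m := (1 : R)%:C * 'i in r1.
apply/(Ker_resE _ r1); apply/eqP; rewrite -subr_eq0; apply/eqP; apply: nrm_small => e e0.
have /bounded_linearP[TL [C C0 TC]] := res_bounded r1.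
have [M M0 hM] := scaled_res_bound bw.
have C1 : 0 < M + 1 + C + 1 by rewrite !ltr_wpDl // addr_ge0 // addr_ge0.
have e1 : 0 < e / (M + 1 + C + 1) by rewrite divr_gt0.
have [N hN] := Dv _ e1; have [n /hN] := vp _ N e1; rewrite subr0.
have -> : m *: res m p - p = res m (D (v n)) - (m *: res m (v n - p) - (v n - p)).
  by rewrite (res_D r1 (dv n)) (linB TL); vring.
move=> h2 h1; apply: (le_trans (nrmDB _ _)).
have k1 := TC (D (v n)); have k2 := hM 1 (v n - p) (oner_neq0 R); rewrite -/m in k2.
have k3 := nrmDB (m *: res m (v n - p)) (v n - p).
have k4 := ler_wpM2l C0 h2; have k5 := ler_wpM2l M0 h1.
set q := e / (M + 1 + C + 1) in h1 h2 k4 k5 e1.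
have : q * (M + 1 + C + 1) = e by rewrite /q divfK // gt_eqF.
lra.
Qed.

Lemma Ker_Y0 p : Ker D p -> Y p -> p = 0.
Proof.
move=> Kp Yp; apply: lim_to_unique (ker_approx_Y bw Yp); apply: eq_lim_to (lim_to_cst p) => n.
by rewrite (ker_approx_K bw Kp).
Qed.

Section Resolvent.
Variable z0 : R[i].
Hypothesis rz0 : resolvent_set D z0.
Hypothesis res_tb : ball_tb setT (res z0).

(** A compact resolvent gives the bounded sequence [ker_approx n x] a cluster point;
    it is the kernel component of [x]. *)
Lemma compact_resolvent_split x : dom D x -> exists2 p, Ker D p & Y (x - p).
Proof.
move=> dx; have [M M0 hM] := ker_approx_bound bw.
have mn n : mesh R n != 0 by rewrite gt_eqF // mesh_gt0.
set u := z0 *: x - D x; have ux : res z0 u = x by exact: res_inv.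
have vE n : ker_approx D n x = res z0 (ker_approx D n u).
  by rewrite /ker_approx (linZ (res_linear rz0)) -(res_comm _ _ rz0) ?ux //; exact: ri.
have [p hp] := ball_tb_cluster (res_linear rz0) res_tb (fun n => hM n u).
have cp : cluster_seq (fun n => ker_approx D n x) p.
  by move=> e N e0; have [n Nn h] := hp e N e0; exists n => //; rewrite vE.
exists p; last first.
  apply: (@Y_cluster (fun n => x - ker_approx D n x)).
    move=> n; have rn := ri (mn n).
    have -> : x - ker_approx D n x = (-1) *: D (res ((mesh R n)%:C * 'i) x).
      by rewrite D_res // scaleN1r opprB.
    by apply: Y_Z; apply: Y_D_dom; have [] := res_spec x rn.
  move=> e N /(cp _ N)[n Nn h]; exists n => //.
  have -> : x - ker_approx D n x - (x - p) = - (ker_approx D n x - p) by vring.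
  by rewrite nrmN.
apply: Ker_cluster cp => [n|].
  by apply: domZ; have [] := res_spec x (ri (mn n)).
apply: (@mesh_lim0 _ _ ((M + 1) * nrm x)); first by rewrite mulr_ge0 ?nrm_ge0 // addr_ge0.
move=> n; have rn := ri (mn n); have [d _] := res_spec x rn.
rewrite /ker_approx opZ // D_res // -/(ker_approx D n x) nrmZ.
rewrite normcM normcR [normc 'i]/normc /= expr0n /= add0r expr1n sqrtr1 mulr1.
rewrite ger0_norm ?(ltW (mesh_gt0 R n)) // ler_wpM2l ?(ltW (mesh_gt0 R n)) //.
by apply: (le_trans (nrmDB _ _)); rewrite mulrDl mul1r lerD.
Qed.

(** Otherwise a sequence of unit vectors of the range, on which [D] tends to zero,
    would cluster at a unit vector of the kernel. *)
Lemma compact_resolvent_below :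
  exists2 c : R, 0 <= c & forall y, Y y -> dom D y -> nrm y <= c * nrm (D y).
Proof.
apply: contrapT => nh.
have bad (n : nat) : exists y, [/\ Y y, dom D y, nrm y = 1 & nrm (D y) <= n.+1%:R^-1].
  apply: contrapT => nb; apply: nh; exists n.+1%:R => // y Yy dy.
  rewrite leNgt; apply/negP => lt; apply: nb.
  have y0 : 0 < nrm y by apply: le_lt_trans lt; rewrite mulr_ge0 ?nrm_ge0.
  exists ((nrm y)^-1%:C *: y); split; [exact: Y_Z|exact: domZ|..].
    by rewrite nrmZR gtr0_norm ?invr_gt0 // mulVf // gt_eqF.
  rewrite opZ // nrmZR gtr0_norm ?invr_gt0 // mulrC ler_pdivrMr // mulrC ler_pdivlMr //.
  by rewrite mulrC ltW.
have [v /all_and4[v1 v2 v3 v4]] := choice bad.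
have vb n : nrm (z0 *: v n - D (v n)) <= normc z0 + 1.
  apply: (le_trans (nrmDB _ _)); rewrite nrmZ v3 mulr1 lerD // (le_trans (v4 n)) //.
  by rewrite invf_le1 // ler1n.
have [p hp] := ball_tb_cluster (res_linear rz0) res_tb vb.
have cp : cluster_seq v p.
  by move=> e N /(hp _ N)[n Nn]; rewrite res_inv // => h; exists n.
have Kp : Ker D p.
  apply: Ker_cluster cp => // e e0; have [N] := @exists_mesh R 1 e ler01 e0; rewrite div1r => hN.
  exists N => n Nn; rewrite subr0 (le_trans (v4 n)) // (le_trans _ (ltW hN)) //.
  by rewrite lef_pV2 ?posrE // ler_nat.
have p0 := Ker_Y0 Kp (Y_cluster v1 cp).
have [|n _] := cp (2^-1) 0%N; first by rewrite invr_gt0.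
by rewrite p0 subr0 v3; lra.
Qed.

Lemma compact_resolvent_all z : resolvent_set D z -> ball_tb setT (res z).
Proof.
move=> rz; have /bounded_linearP[_ [C C0 hC]] := res_bounded rz.
apply: (@ball_tb_ext _ _ _ (fun x => res z0 x + (z0 - z) *: res z0 (res z x))).
  by move=> x _; rewrite -opprB scaleNr -res_identity // opprB addrC subrK.
apply: ball_tbD => //; apply: ball_tbZ.
apply: (ball_tb_right (Z := setT) (C := C + 1)) => //.
- by rewrite ltr_wpDl.
- by move=> a y _; rewrite (linZ (res_linear rz0)).
by move=> y _; apply: (le_trans (hC y)); rewrite ler_wpM2r ?nrm_ge0 // lerDl.
Qed.

Lemma compact_resolvent_range_good : range_good.
Proof.
split; [exact: compact_resolvent_split|exact: compact_resolvent_below|].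
by move=> t t0; apply: ball_tb_subset (compact_resolvent_all (ri t0)).
Qed.

(** On the kernel the identity is a multiple of the resolvent. *)
Lemma compact_resolvent_projection P : bounded_linear P -> (forall x, Ker D (P x)) ->
  ball_tb setT P.
Proof.
move=> /bounded_linearP[PL [C C0 hC]] PK.
apply: (@ball_tb_ext _ _ _ (fun x => z0 *: res z0 (P x))).
  by move=> x _; apply/Ker_resE.
apply: ball_tbZ; apply: (ball_tb_right (Z := setT) (C := C + 1)) => //.
- by rewrite ltr_wpDl.
- by move=> a y _; rewrite (linZ (res_linear rz0)).
by move=> y _; apply: (le_trans (hC y)); rewrite ler_wpM2r ?nrm_ge0 // lerDl.
Qed.

End Resolvent.
End CompactnessHypotheses.

(** * The Fredholm modules *)

Section Fredholm.
Variables (R : realType) (A X : completeNormedModType R[i]).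
Variables (mul : A -> A -> A) (rep : A -> X -> X) (D : unbounded_operator X).
Notation Y := (closure (Ran D)).

(** The conclusion common to both cases: [P] is the projection onto the kernel and [F] the
    sign, whose commutators are compact from the range to itself. *)
Definition sgn_module (P F : X -> X) : Prop :=
  [/\ bounded_linear P, forall x, Ker D (P x), forall x, Y (x - P x) &
      forall y, Y y -> P y = 0] /\
  [/\ unique (is_sgn D) F, forall y, Y y -> F (F y) = y &
      forall a, ball_tb Y (fun y => F (rep a y) - rep a (F y) - P (F (rep a y) - rep a (F y)))].

(** [range_commutator_compact] for the Lipschitz elements, then a norm limit. *)
Lemma sgn_module_exists : pre_spectral_triple mul rep D ->
  (forall w, bisectorial_type D w -> range_good D) -> exists P F, sgn_module P F.
Proof.
move=> [[_ [hom [M hM]]] _ [w bw] [th thr calc] dL] /(_ w bw) [split_dom below res_tb].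
have [P [Pb PK PY PU Pres]] := kernel_projection bw split_dom.
have [F [Fs FL FY FF]] := sgn_exists bw split_dom thr calc.
have [Fb FK _] := Fs; exists P, F; split.
  split => // y Yy; apply: PU; last by rewrite subr0.
  by split; [exact: dom0|exact: op0].
split => //; first by split=> // G; exact: (sgn_unique bw split_dom thr calc).
have [hb hl _] := hom => a.
have /bounded_linearP[FLin [CF CF0 hCF]] := Fb.
have /bounded_linearP[PLin [CP CP0 hCP]] := Pb.
have rM b x : nrm (rep b x) <= `|M| * nrm b * nrm x.
  have := hM b x; rewrite !normE -!rmorphM lecR => /le_trans; apply.
  by rewrite -!mulrA ler_wpM2r ?ler_norm // mulr_ge0 ?nrm_ge0.
pose K := (1 + CP) * (2 * CF * `|M|).
have K0 : 0 <= K by rewrite /K mulr_ge0 ?addr_ge0 // mulr_ge0 // mulr_ge0.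
have K1 : 0 < K + 1 by rewrite ltr_wpDl.
apply: ball_tb_lim => e e0; have [b Lb ba] := dense_approx a dL (divr_gt0 e0 K1).
pose G c y := F (rep c y) - rep c (F y); exists (fun y => G b y - P (G b y)).
  have [bd [T Tb TE]] := Lb.
  exact: (range_commutator_compact bw Pb PY Pres below res_tb (hb b) Tb bd TE Fb FL).
move=> y Yy y1.
have rB x : rep a x - rep b x = rep (a - b) x.
  have := hl (-1) b a x; rewrite !scaleN1r [- b + a]addrC => ->.
  by rewrite addrC.
have GB : G a y - G b y = G (a - b) y.
  by rewrite /G -!rB (linB FLin); vring.
have -> : G a y - P (G a y) - (G b y - P (G b y)) = G (a - b) y - P (G (a - b) y).
  by rewrite -GB (linB PLin (G a y)); vring.
have k1 : nrm (G (a - b) y) <= 2 * CF * `|M| * nrm (a - b).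
  apply: (le_trans (nrmDB _ _)).
  set d := nrm (a - b); have d0 : 0 <= `|M| * d by rewrite mulr_ge0 ?nrm_ge0.
  have r1 x : nrm x <= 1 -> nrm (rep (a - b) x) <= `|M| * d.
    by move=> x1; apply: (le_trans (rM _ _)); rewrite -[leRHS]mulr1 ler_wpM2l.
  have e1 : nrm (F (rep (a - b) y)) <= CF * (`|M| * d).
    by apply: (le_trans (hCF _)); rewrite ler_wpM2l // r1.
  have e2 : nrm (rep (a - b) (F y)) <= `|M| * d * CF.
    apply: (le_trans (rM _ _)); rewrite ler_wpM2l //; apply: (le_trans (hCF y)).
    by rewrite -[leRHS]mulr1 ler_wpM2l.
  lra.
have k2 : nrm (G (a - b) y - P (G (a - b) y)) <= (1 + CP) * (2 * CF * `|M| * nrm (a - b)).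
  apply: (le_trans (nrmDB _ _)); apply: (@le_trans _ _ ((1 + CP) * nrm (G (a - b) y))).
    by rewrite mulrDl mul1r lerD.
  by rewrite ler_wpM2l // addr_ge0.
apply: (le_trans k2); move: ba; rewrite ler_pdivlMr // nrmB => ba.
apply: le_trans ba; rewrite !mulrA -[in leLHS](mulrA (1 + CP)) -/K.
have := nrm_ge0 (a - b); rewrite /K; lra.
Qed.

Section Conclusions.
Variables (P F : X -> X).
Hypothesis hom : is_homomorphism mul rep.
Hypothesis PF : sgn_module P F.

Let Pb : bounded_linear P. Proof. by case: PF => -[]. Qed.
Let PK x : Ker D (P x). Proof. by case: PF => -[]. Qed.
Let QY x : Y (x - P x). Proof. by case: PF => -[]. Qed.
Let PY y : Y y -> P y = 0. Proof. by case: PF => -[_ _ _ h _]; exact: h. Qed.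
Let Fb : bounded_linear F. Proof. by case: PF => _ [[[]]]. Qed.
Let FK x : Ker D x -> F x = 0. Proof. by case: PF => _ [[[_ h _] _] _ _]; exact: h. Qed.
Let FF y : Y y -> F (F y) = y. Proof. by case: PF => _ [_ h _]; exact: h. Qed.
Let FL : linear F. Proof. by case: Fb. Qed.
Let PL : linear P. Proof. by case: Pb. Qed.
Let comm a x := F (rep a x) - rep a (F x).

Let rep_b a : bounded_linear (rep a). Proof. by case: hom. Qed.
Let rep_l a : linear (rep a). Proof. by case: (rep_b a). Qed.

Let comm_linear a : linear (comm a).
Proof. by move=> c x y; rewrite /comm !(rep_l, FL); vring. Qed.

Let comm_bounded a : bounded_linear (comm a).
Proof.
apply/bounded_linearP; split; first exact: comm_linear.
have /bounded_linearP[_ [C C0 hC]] := Fb; have /bounded_linearP[_ [M M0 hM]] := rep_b a.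
exists (C * M + M * C); first by rewrite addr_ge0 // mulr_ge0.
move=> x; apply: (le_trans (nrmDB _ _)); rewrite mulrDl; apply: lerD; rewrite -mulrA.
  by apply: (le_trans (hC _)); rewrite ler_wpM2l.
by apply: (le_trans (hM _)); rewrite ler_wpM2l.
Qed.

Let F_split x : F x = F (x - P x).
Proof. by rewrite (linB FL) (FK (PK x)) subr0. Qed.

Let FF_split x : F (F x) = x - P x.
Proof. by rewrite (F_split x) FF. Qed.

Let Q_linear : linear (fun x => x - P x).
Proof. by move=> c x y; rewrite PL; vring. Qed.

Let Q_bounded : exists2 C : R, 0 < C & forall x, nrm (x - P x) <= C * nrm x.
Proof.
have /bounded_linearP[_ [C C0 hC]] := Pb; exists (1 + C); first by rewrite ltr_wpDr.
by move=> x; apply: (le_trans (nrmDB _ _)); rewrite mulrDl mul1r lerD.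
Qed.

Lemma sgn_degenerate_Fredholm : degenerate_Fredholm_module mul rep F.
Proof.
have /bounded_linearP[_ [CP CP0 hCP]] := Pb; have [C C0 hC] := Q_bounded.
split=> //; exists Y, (fun x => x - P x); split.
- split => //.
  + exact: closed_closure.
  + by apply/bounded_linearP; split=> //; exists C => //; exact: ltW.
  + by move=> y Yy; rewrite PY // subr0.
  + move=> x; split=> [|Fx]; last by rewrite -FF_split Fx (lin0 FL).
    by move=> Qx /=; rewrite F_split Qx (lin0 FL).
- apply: tb_compact_on.
    split=> // c x y Yx Yy; rewrite !FL !FF // !subrr.
    by rewrite !(lin0 PL) subr0 scaler0 addr0.
  apply: (@ball_tb_ext _ _ _ (fun y => 0 *: y)).
    by move=> y Yy; rewrite FF // subrr (lin0 PL) subrr scale0r.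
  apply/ball_tbP => e e0; exists [:: 0] => y _ _; exists 0; rewrite ?inE //.
  by rewrite scale0r subrr nrm0 ltW.
- move=> a; apply: tb_compact_on; last by case: PF => _ [_ _]; exact.
  split=> // c x y _ _; exact: etrans (congr1 (fun u => u - P u) (comm_linear a c x y)) (Q_linear c _ _).
Qed.

(** On the whole space the commutator is its part between the ranges up to terms with
    a factor [P]. *)
Lemma sgn_odd_Fredholm : ball_tb setT P -> odd_Fredholm_module mul rep F.
Proof.
move=> Ptb; have [C C0 hC] := Q_bounded.
split=> //.
  apply: tb_compact_on.
    by split=> // c x y _ _; rewrite !FL; vring.
  apply: (@ball_tb_ext _ _ _ (fun x => (-1) *: P x)); last exact: ball_tbZ.
  by move=> x _; rewrite FF_split scaleN1r; vring.
move=> a; apply: tb_compact_on.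
  by split=> // c x y _ _; exact: comm_linear.
have [CL _] := comm_bounded a.
apply: (@ball_tb_ext _ _ _ (fun x => (comm a (x - P x) - P (comm a (x - P x))) +
    P (comm a (x - P x)) + comm a (P x))).
  by move=> x _; rewrite subrK -(linD CL) subrK.
apply: ball_tbD; last exact: ball_tb_linear Ptb.
apply: ball_tbD.
  apply: (@ball_tb_right _ _ setT Y (fun y => comm a y - P (comm a y)) (fun x => x - P x) C) => //.
  - by move=> c y; exact: Y_Z.
  - by move=> c y _; rewrite (linZ CL) (linZ PL); vring.
  - by case: PF => _ [_ _]; exact.
have /bounded_linearP[_ [B B0 hB]] := comm_bounded a.
apply: (@ball_tb_right _ _ setT setT P (fun x => comm a (x - P x)) (B * C + 1)) => //.
- by rewrite ltr_wpDl // mulr_ge0 // ltW.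
- by move=> c y _; rewrite (linZ PL).
move=> y _; apply: (@le_trans _ _ (B * (C * nrm y))).
  by apply: (le_trans (hB _)); rewrite ler_wpM2l.
by rewrite mulrA ler_wpM2r ?nrm_ge0 // lerDl.
Qed.

End Conclusions.
End Fredholm.

Theorem proposition7p7 (R : realType) (A X : completeNormedModType R[i])
    (mul : A -> A -> A) (rep : A -> X -> X) (D : unbounded_operator X) :
  (compact_spectral_triple mul rep D ->
     exists2 F : X -> X, unique (is_sgn D) F & odd_Fredholm_module mul rep F) /\
  (degenerate_compact_spectral_triple mul rep D ->
     exists2 F : X -> X, unique (is_sgn D) F & degenerate_Fredholm_module mul rep F).
Proof.
split=> [[T [z0 rz0 /compact_on_tb cz0]]|[T ci]]; have [[_ [hom _]] _ [w bw] _ _] := T.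
  have [P [F PF]] := sgn_module_exists T (fun w bw => compact_resolvent_range_good bw rz0 cz0).
  exists F; first by case: PF => _ [].
  have [[Pb PK _ _] _] := PF; apply: (sgn_odd_Fredholm hom PF).
  exact: (compact_resolvent_projection rz0 cz0 Pb PK).
have [P [F PF]] := sgn_module_exists T (fun w bw => compact_inverse_range_good bw ci).
by exists F; [case: PF => _ []|exact: sgn_degenerate_Fredholm hom PF].
Qed.
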